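(* Let $k\geq 2$ be an integer, let $F_1,\dots,F_k$ be nonzero quadratic forms in $N$ variables over $\overline{\mathbb Q}$, and let $V\subseteq\overline{\mathbb Q}^N$ be an $L$-dimensional subspace, where $N\geq L\geq\frac{k(k+1)}{2}+1$. Then there exists $\boldsymbol 0\neq\boldsymbol w\in V$ such that $F_m(\boldsymbol w)=0$ for all $1\leq m\leq k$ and $$h(\boldsymbol w)\leq\left(3^{\frac{L^2}{2}}N^{\frac{3(L+1)}{2}}\mathcal H(V)\right)^{20B_k^2/81}\left(\prod_{n=1}^{k-1}H(F_n)\right)^{B_k}H(F_k)^2,$$ where $B_2=9$ and $$B_k=\frac14\times 36^{2^{k-2}}\prod_{m=3}^k m^{2^{k-m+1}}$$ for all $k\geq 3$.
   Context: Heights. Let $K$ be a number field of degree $d=[K:\mathbb Q]$ with set of places $M(K)$. For $v \in M(K)$ let $d_v=[K_v:\mathbb Q_v]$ be the local degree and $|\cdot|_v$ the absolute value on $K_v$ extending the usual absolute value on $\mathbb R$ (if $v\mid\infty$) or the usual $p$-adic absolute value on $\mathbb Q_p$ (if $v\mid p$). For $\boldsymbol x=(x_1,\dots,x_N)\in K_v^N$ put $H_v(\boldsymbol x)=\max_i |x_i|_v^{d_v}$, and for $v\mid\infty$ also $\mathcal H_v(\boldsymbol x)=\left(\sum_i |x_i|_v^2\right)^{d_v/2}$. For nonzero $\boldsymbol x\in K^N$ put $$H(\boldsymbol x)=\Big(\prod_{v\in M(K)}H_v(\boldsymbol x)\Big)^{1/d},\qquad \mathcal H(\boldsymbol x)=\Big(\prod_{v\nmid\infty}H_v(\boldsymbol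 x)\prod_{v\mid\infty}\mathcal H_v(\boldsymbol x)\Big)^{1/d},$$ and for $\boldsymbol x \in K^N$ put $h(\boldsymbol x)=H(1,\boldsymbol x)$. These do not depend on the choice of a number field $K$ containing the coordinates, so they are defined over $\overline{\mathbb Q}$. For an $L$-dimensional subspace $V\subseteq\overline{\mathbb Q}^N$ with basis $\boldsymbol v_1,\dots,\boldsymbol v_L$, $\mathcal H(V)=\mathcal H(\boldsymbol v_1\wedge\dots\wedge\boldsymbol v_L)$, i.e. $\mathcal H$ of the vector of $L\times L$ minors of the basis matrix; this is independent of the basis. A quadratic form is $F(\boldsymbol X)=\sum_{i,j=1}^N f_{ij}X_iX_j$ with $f_{ij}=f_{ji}\in\overline{\mathbb Q}$; $H(F)$ is the height $H$ of the symmetric coefficient matrix $(f_{ij})$ regarded as a vector. *)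

(* Defs.v *)
From mathcomp Require Import all_boot all_order all_algebra all_field.
From mathcomp Require Import boolp classical_sets fsbigop reals exp.

Set Implicit Arguments.
Unset Strict Implicit.
Unset Printing Implicit Defensive.

Import Order.TTheory GRing.Theory Num.Theory.
Local Open Scope ring_scope.

(* [algC], the algebraic closure of [rat], plays the role of \overline{Q}; a
   number field is a [K : fieldExtType rat]; absolute values and heights take
   their values in an arbitrary model [R] of the real numbers. *)

Section AbsoluteValues.
Variables (R : realType) (K : fieldExtType rat).

Definition is_absolute_value (v : K -> R) : Prop :=
  [/\ forall x, 0 <= v x,
      forall x, v x = 0 <-> x = 0,
      forall x y, v (x * y) = v x * v y
    & forall x y, v (x + y) <= v x + v y].

Definition padic_abs (p : nat) (q : rat) : R :=
  if q == 0 then 0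
  else p%:R ^+ logn p `|denq q|%N / p%:R ^+ logn p `|numq q|%N.

(* A place of K is represented by its unique absolute value that restricts to
   the usual absolute value, or to a usual p-adic absolute value, on rat. *)
Definition infinite_places : set (K -> R) :=
  [set v | is_absolute_value v /\ forall q : rat, v q%:A = ratr `|q|]%classic.

Definition finite_places : set (K -> R) :=
  [set v | is_absolute_value v /\
     exists2 p : nat, prime p & forall q : rat, v q%:A = padic_abs p q]%classic.

Definition places : set (K -> R) :=
  (infinite_places `|` finite_places)%classic.

(* The completion K_v is the ring of v-Cauchy sequences of K modulo the null
   sequences; likewise Q_v, for the restriction of v to rat. *)
Definition cauchy_for (T : zmodType) (v : T -> R) (a : nat -> T) : Prop :=
  forall e : R, 0 < e -> exists n0 : nat, forall m n : nat,
    (n0 <= m)%N -> (n0 <= n)%N -> v (a m - a n) < e.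

Definition null_for (T : zmodType) (v : T -> R) (a : nat -> T) : Prop :=
  forall e : R, 0 < e -> exists n0 : nat, forall n : nat,
    (n0 <= n)%N -> v (a n) < e.

Definition restr_rat (v : K -> R) (q : rat) : R := v q%:A.

(* The classes of the sequences b 0, ..., b (n - 1) form a basis of K_v over
   Q_v: they lie in K_v, they span it, and they are linearly independent. *)
Definition local_basis (v : K -> R) (n : nat) (b : 'I_n -> nat -> K) : Prop :=
  [/\ forall i, cauchy_for v (b i),
      forall a : nat -> K, cauchy_for v a ->
        exists2 c : 'I_n -> nat -> rat,
          forall i, cauchy_for (restr_rat v) (c i) &
          null_for v (fun t => a t - \sum_i c i t *: b i t)
    & forall c : 'I_n -> nat -> rat,
        (forall i, cauchy_for (restr_rat v) (c i)) ->
        null_for v (fun t => \sum_i c i t *: b i t) ->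
        forall i, null_for (restr_rat v) (c i)].

(* d_v = [K_v : Q_v] *)
Definition local_degree (v : K -> R) : nat :=
  xget 0%N [set n | exists b : 'I_n -> nat -> K, local_basis v b]%classic.

Variable I : finType.
Implicit Type x : I -> K.

Definition local_height (v : K -> R) x : R :=
  \big[Num.max/0]_i v (x i) ^+ local_degree v.

Definition local_l2_height (v : K -> R) x : R :=
  (\sum_i v (x i) ^+ 2) `^ ((local_degree v)%:R / 2).

Definition field_degree : nat := \dim {:K}.

(* For x != 0 all but finitely many factors of the products over places are 1,
   so that these finitely supported products are the full products. *)
Definition field_height x : R :=
  (\big[*%R/1]_(v \in places) local_height v x) `^ field_degree%:R^-1.

Definition field_l2_height x : R :=
  ((\big[*%R/1]_(v \in finite_places) local_height v x) *
   (\big[*%R/1]_(v \in infinite_places) local_l2_height v x))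
    `^ field_degree%:R^-1.

End AbsoluteValues.

Record number_field_model (I : finType) (x : I -> algC) := NumberFieldModel {
  model_field : fieldExtType rat;
  model_embed : {rmorphism model_field -> algC};
  model_coord : I -> model_field;
  _ : forall i, model_embed (model_coord i) = x i
}.

Lemma number_field_model_of (I : finType) (x : I -> algC) :
  number_field_model x.
Proof.
have [K [iota [s Ds _]]] := num_field_exists (codom x).
apply: (@NumberFieldModel _ _ K iota (fun i => s`_(enum_rank i))) => i.
have sz_s : size s = #|I| by rewrite -(size_map iota) Ds size_codom.
by rewrite -(nth_map _ 0) ?sz_s // Ds nth_codom enum_rankK.
Qed.

(* Heights of a vector over algC, computed in some number field containing its
   coordinates; the value does not depend on this number field. *)
Section Heights.
Variables (R : realType) (I : finType) (x : I -> algC).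

Definition height : R :=
  field_height R (model_coord (number_field_model_of x)).

Definition l2_height : R :=
  field_l2_height R (model_coord (number_field_model_of x)).

End Heights.
Arguments height R {I} x.
Arguments l2_height R {I} x.

(* h(x) = H(1, x) *)
Definition affine_height (R : realType) (N : nat) (w : 'rV[algC]_N) : R :=
  height R (fun o : option 'I_N => if o is Some i then w 0 i else 1).

Definition increasing_maps (L N : nat) : finType :=
  {f : {ffun 'I_L -> 'I_N} |
    [forall i : 'I_L, forall j : 'I_L, (i < j)%N ==> (f i < f j)%N]}.

Definition maximal_minors (L N : nat) (A : 'M[algC]_(L, N))
    (f : increasing_maps L N) : algC :=
  \det (colsub (val f) A).

Definition basis_matrix (N : nat) (V : {vspace 'rV[algC]_N}) :
    'M[algC]_(\dim V, N) :=
  \matrix_(i < \dim V, j < N) (tnth (vbasis V) i) 0 j.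

Definition subspace_height (R : realType) (N : nat)
    (V : {vspace 'rV[algC]_N}) : R :=
  l2_height R (maximal_minors (basis_matrix V)).

(* A quadratic form is given by its symmetric coefficient matrix. *)
Definition is_quadratic_form (N : nat) (F : 'M[algC]_N) : Prop :=
  forall i j, F i j = F j i.

Definition quad_eval (N : nat) (F : 'M[algC]_N) (w : 'rV[algC]_N) : algC :=
  \sum_i \sum_j F i j * w 0 i * w 0 j.

Definition form_height (R : realType) (N : nat) (F : 'M[algC]_N) : R :=
  height R (fun ij : 'I_N * 'I_N => F ij.1 ij.2).

Definition Bconst (R : realType) (k : nat) : R :=
  if k == 2%N then 9
  else 4^-1 * 36 ^+ (2 ^ (k - 2)) *
       \prod_(3 <= m < k.+1) m%:R ^+ (2 ^ (k - m + 1)).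

(* Main.v *)
Require Import Defs.
From HB Require Import structures.
From mathcomp Require Import all_boot all_order perm all_algebra all_field.
From mathcomp Require Import boolp classical_sets filter fsbigop reals exp.
From mathcomp Require Import ring lra zify.

(** Common zeros of quadratic forms are found by induction on their number.
    Suppose that x1 is a small common zero of F_1, ..., F_j in a space of
    dimension n. The vectors orthogonal to x1 for these j forms make up a
    subspace of codimension at most j which contains x1, and it contains a
    complement W of the line of x1, of dimension at least n - j - 1. A common
    zero x2 of F_1, ..., F_j in W, given by the induction hypothesis again,
    spans with x1 a plane on which F_1, ..., F_j vanish identically, and the
    binary form that F_{j+1} induces on this plane has a nontrivial zero. As
    the dimension needed increases by j + 1 at this step, dimension
    k(k+1)/2 + 1 suffices for k forms. This is [common_zero_step].

    All bounds go through one principle, [vheight_sum_prod]: when the entries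
    of a vector are signed sums of at most C products taking one entry from
    each of finitely many vectors, its height is at most C times the product of
    theirs. It bounds the height of W, which is written down by Cramer's rule
    ([polar_subspace]), of matrix products, and of the reduced basis of V,
    whose entries are quotients of maximal minors ([subspace_basis]). A binary
    form has two zeros, whose heights multiply to at most 4 times the height of
    the form, essentially by the Mahler inequality in degree 2, and the smaller
    one is kept ([isotropic_binary]). The squares of the heights obey
    bounds with integral exponents, and the constants B_k dominate those
    exponents with room to spare: they satisfy B_{k+1} = 4 (k+1)^2 B_k^2,
    whereas the exponent s of the product of heights becomes
    2 j^2 s^2 + 6 j s + 4 s + 4 when passing from j to j + 1 forms, starting
    from s = 1, and s <= 2 B_k is what the theorem requires. For the final bound the zero is scaled to have a
    coordinate 1, so that its affine height is its projective height.

    The height being defined through all the places of a number field K, the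
    principle rests on three facts: the product formula, which gives invariance
    under scaling ([field_height_scale]); the equality of the sum of the
    archimedean local degrees with [K : Q], which lets a constant C come out as
    C ([field_height_dom]); and the independence of the height of the field
    ([heightE]). They follow from a description of the places above a place a
    of Q. Write K = Q[X]/(f), and let k be the completion of Q at a. The
    places above a correspond to the monic irreducible factors g of f over k,
    since an absolute value extends uniquely to the finite extension k[X]/(g):
    it is |N(P)|^(1/n) for the norm N and the degree n of g, which is comparable
    with the maximum of the coefficients by compactness, and an absolute value
    is determined by its comparability class ([gabsD], [gabs_unique],
    [lplace_surj]). The local degree at this place is n
    ([local_degree_lplace]). Since the norm from k[X]/(f) is the product of the
    norms from the k[X]/(g), the product of the normalised absolute values of x
    above a is the absolute value at a of the norm of x ([prod_lplace]), and the
    product formula is reduced to that of Q. *)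

Set Implicit Arguments.
Unset Strict Implicit.
Unset Printing Implicit Defensive.

Import Order.TTheory GRing.Theory Num.Theory.
Local Open Scope ring_scope.

(** * Comparing reals through their powers *)

Lemma bernoulli_ge (R : realType) (x : R) (m : nat) :
  0 <= x -> 1 + m%:R * x <= (1 + x) ^+ m.
Proof.
move=> x0; elim: m => [|m IH]; first by rewrite mul0r addr0 expr0.
rewrite exprS; apply: le_trans (_ : (1 + x) * (1 + m%:R * x) <= _).
  have : 0 <= m%:R * x * x by rewrite !mulr_ge0.
  by rewrite -[m.+1]addn1 natrD; nra.
by rewrite ler_wpM2l // addr_ge0.
Qed.

(** Multiplicative constants are removed by taking powers: an inequality
    between all powers up to a factor of polynomial growth is an inequality,
    as (x / y)^m would otherwise grow exponentially. *)
Lemma le_of_expr_le (R : realType) (C x y : R) : 0 <= x -> 0 <= y ->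
  (forall m : nat, x ^+ m <= C * m.+1%:R * y ^+ m) -> x <= y.
Proof.
move=> x0 y0 H; rewrite leNgt; apply/negP => yx.
have xp : 0 < x by apply: le_lt_trans yx.
have [y00|yp] := eqVneq y 0.
  by have := H 1%N; rewrite y00 expr0n mulr0 expr1 leNgt xp.
have {}yp : 0 < y by rewrite lt0r yp.
pose d := x / y - 1.
have d0 : 0 < d by rewrite subr_gt0 ltr_pdivlMr // mul1r.
have xy : x / y = 1 + d by rewrite /d addrC subrK.
have B m : (1 + d) ^+ m <= C * m.+1%:R.
  by rewrite -xy expr_div_n ler_pdivrMr ?exprn_gt0.
have C1 : 1 <= C by have := B 0; rewrite expr0 mulr1.
(* Squaring the Bernoulli bound gives quadratic growth against a linear one.
   *)
have Q (m : nat) : m%:R * (d * d) <= 3 * C.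
  have [->|m0] := posnP m; first by rewrite mul0r; nra.
  have := B (m + m)%N; rewrite exprD.
  have b := bernoulli_ge m (ltW d0).
  have mp : 0 < m%:R :> R by rewrite ltr0n.
  have m1 : 1 <= m%:R :> R by rewrite ler1n.
  have : (m%:R * d) * (m%:R * d) <= (1 + d) ^+ m * (1 + d) ^+ m.
    have md : 0 <= m%:R * d by rewrite mulr_ge0 // ltW.
    by apply: ler_pM => //; apply: le_trans b; rewrite lerDr.
  rewrite -[(m + m).+1]addn1 !natrD => h1 h2.
  have h3 : m%:R * d * (m%:R * d) <= C * (m%:R + m%:R + 1) by apply: le_trans h1 h2.
  have h4 : C * (m%:R + m%:R + 1) <= m%:R * (3 * C).
    have : 0 <= C * (m%:R - 1) by rewrite mulr_ge0 ?subr_ge0 //; lra.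
    by rewrite -subr_ge0 => h; rewrite -subr_ge0; lra.
  rewrite -(ler_pM2l mp); apply: le_trans h4; apply: le_trans h3.
  by rewrite le_eqVlt; apply/orP; left; apply/eqP; ring.
have [n nP] : exists n : nat, 3 * C / (d * d) < n%:R.
  exists (Num.truncn (3 * C / (d * d))).+1; apply: truncnS_gt.
have := Q n; rewrite leNgt; rewrite ltr_pdivrMr in nP; last by rewrite mulr_gt0.
by rewrite nP.
Qed.

(** * Absolute values *)

Record absValue (R : realType) (F : fieldType) := AbsValue {
  abs_fun :> F -> R;
  abs_ge0 : forall x, 0 <= abs_fun x;
  abs_eq0P : forall x, abs_fun x = 0 <-> x = 0;
  absM : forall x y, abs_fun (x * y) = abs_fun x * abs_fun y;
  absD : forall x y, abs_fun (x + y) <= abs_fun x + abs_fun y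
}.

Section AbsTheory.
Variables (R : realType) (F : fieldType) (a : absValue R F).

Lemma abs0 : a 0 = 0. Proof. exact/abs_eq0P. Qed.

Lemma abs_eq0 x : (a x == 0) = (x == 0).
Proof. by apply/eqP/eqP => [|->]; [move/abs_eq0P | exact: abs0]. Qed.

Lemma abs_gt0 x : (0 < a x) = (x != 0).
Proof. by rewrite lt0r abs_eq0 abs_ge0 andbT. Qed.

Lemma abs1 : a 1 = 1.
Proof.
have : a 1 * (a 1 - 1) == 0 by rewrite mulrBr mulr1 -absM mulr1 subrr.
by rewrite mulf_eq0 abs_eq0 oner_eq0 /= subr_eq0 => /eqP.
Qed.

Lemma absX x n : a (x ^+ n) = a x ^+ n.
Proof. by elim: n => [|n IH]; rewrite ?expr0 ?abs1 // !exprS absM IH. Qed.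

Lemma absV x : a x^-1 = (a x)^-1.
Proof.
have [->|x0] := eqVneq x 0; first by rewrite invr0 abs0 invr0.
by apply: (mulfI (x:=a x)); rewrite ?abs_eq0 // -absM !divff ?abs1 ?abs_eq0.
Qed.

Lemma absN x : a (- x) = a x.
Proof.
by apply/eqP; rewrite -(@eqrXn2 _ 2) ?abs_ge0 // -!absX sqrrN.
Qed.

Lemma absB x y : a (x - y) <= a x + a y.
Proof. by rewrite (le_trans (absD _ _ _)) // absN. Qed.

Lemma abs_distC x y : a (x - y) = a (y - x).
Proof. by rewrite -opprB absN. Qed.

Lemma abs_dist x y : `|a x - a y| <= a (x - y).
Proof.
have h1 := absD a (x - y) y; have h2 := absD a (y - x) x.
rewrite !subrK in h1 h2; rewrite abs_distC in h2.
by rewrite ler_norml; apply/andP; split; lra.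
Qed.

Lemma abs_triangle y x z : a (x - z) <= a (x - y) + a (y - z).
Proof. by have := absD a (x - y) (y - z); rewrite addrA subrK. Qed.

Lemma abs_sum (I : Type) (r : seq I) (P : pred I) (f : I -> F) :
  a (\sum_(i <- r | P i) f i) <= \sum_(i <- r | P i) a (f i).
Proof.
elim/big_ind2: _ => [|x1 x2 y1 y2 h1 h2|//]; first by rewrite abs0.
by apply: le_trans (absD _ _ _) _; rewrite lerD.
Qed.

Lemma abs_prod (I : Type) (r : seq I) (P : pred I) (f : I -> F) :
  a (\prod_(i <- r | P i) f i) = \prod_(i <- r | P i) a (f i).
Proof. by apply: (big_morph a (absM a) abs1). Qed.

Lemma abs_nat n : a n%:R <= n%:R.
Proof.
elim: n => [|n IH]; first by rewrite abs0.
by rewrite -[n.+1]addn1 !natrD (le_trans (absD _ _ _)) // lerD // abs1.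
Qed.

Lemma abs_sign (b : bool) x : a ((-1) ^+ b * x) = a x.
Proof. by case: b; rewrite ?expr1 ?mulN1r ?absN // expr0 mul1r. Qed.

End AbsTheory.

(** * Completion of a field with respect to an absolute value *)

(** The limit is the supremum of the eventual lower bounds. *)
Lemma real_cauchy_lim (R : realType) (u : nat -> R) :
  (forall e, 0 < e -> exists n0, forall m n, (n0 <= m)%N -> (n0 <= n)%N ->
     `|u m - u n| < e) ->
  exists l, forall e, 0 < e -> exists n0, forall n, (n0 <= n)%N -> `|u n - l| < e.
Proof.
move=> Cu.
pose S := [set x : R | exists n0, forall n, (n0 <= n)%N -> x <= u n]%classic.
have S1 e n0 : 0 < e -> (forall m n, (n0 <= m)%N -> (n0 <= n)%N -> `|u m - u n| < e) ->
    S (u n0 - e).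
  move=> e0 h; exists n0 => n hn; have := h n0 n (leqnn _) hn.
  by rewrite ltr_norml => /andP [_ h2]; lra.
have S2 e n0 : 0 < e -> (forall m n, (n0 <= m)%N -> (n0 <= n)%N -> `|u m - u n| < e) ->
    ubound S (u n0 + e).
  move=> e0 h x [n1 hx]; have hx1 := hx (maxn n0 n1) (leq_maxr _ _).
  have := h n0 (maxn n0 n1) (leqnn _) (leq_maxl _ _).
  by rewrite ltr_norml => /andP [h1 _]; lra.
have SS : has_sup S.
  have [n0 h] := Cu 1 ltr01.
  by split; [exists (u n0 - 1); apply: S1 | exists (u n0 + 1); apply: S2].
exists (sup S) => e e0; have e2 : 0 < e / 3 by rewrite divr_gt0.
have [n0 h] := Cu _ e2; exists n0 => n hn.
have a1 := sup_upper_bound SS (S1 _ _ e2 h).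
have a2 : sup S <= u n0 + e / 3 by apply: ge_sup (S2 _ _ e2 h); case: SS.
have := h n0 n (leqnn _) hn.
by rewrite !ltr_norml => /andP [h1 h2]; apply/andP; split; lra.
Qed.

Section Sequences.
Variables (R : realType) (F : fieldType) (a : absValue R F).
Implicit Types s t : nat -> F.

Lemma cauchy_cst (x : F) : cauchy_for a (fun=> x).
Proof. by move=> e e0; exists 0%N => m n _ _; rewrite subrr abs0. Qed.

Lemma cauchyD s t : cauchy_for a s -> cauchy_for a t ->
  cauchy_for a (fun n => s n + t n).
Proof.
move=> cs ct e e0; have e2 : 0 < e / 2 by rewrite divr_gt0.
have [n1 h1] := cs _ e2; have [n2 h2] := ct _ e2.
exists (maxn n1 n2) => m n; rewrite !geq_max => /andP [m1 m2] /andP [k1 k2].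
have -> : s m + t m - (s n + t n) = (s m - s n) + (t m - t n) by ring.
have := absD a (s m - s n) (t m - t n); have := h1 _ _ m1 k1; have := h2 _ _ m2 k2.
lra.
Qed.

Lemma cauchyN s : cauchy_for a s -> cauchy_for a (fun n => - s n).
Proof.
move=> cs e e0; have [n1 h1] := cs _ e0; exists n1 => m n hm hn.
by rewrite -opprD absN; apply: h1.
Qed.

Lemma cauchy_bounded s : cauchy_for a s ->
  exists2 B : R, 0 < B & forall n, a (s n) <= B.
Proof.
move=> cs; have [n0 h0] := cs 1 ltr01.
exists (1 + \sum_(i < n0.+1) a (s i)).
  by rewrite ltr_pwDl // sumr_ge0 // => i _; apply: abs_ge0.
move=> n; have [hn|hn] := leqP n0 n.
  have := h0 n n0 hn (leqnn _); have := absD a (s n - s n0) (s n0).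
  rewrite subrK big_ord_recr /=.
  have : 0 <= \sum_(i < n0) a (s i) by rewrite sumr_ge0 // => i _; apply: abs_ge0.
  lra.
have hn' : (n < n0.+1)%N by apply: leqW.
rewrite (bigD1 (Ordinal hn')) //=.
have : 0 <= \sum_(i < n0.+1 | i != Ordinal hn') a (s i).
  by rewrite sumr_ge0 // => i _; apply: abs_ge0.
lra.
Qed.

Lemma cauchyM s t : cauchy_for a s -> cauchy_for a t ->
  cauchy_for a (fun n => s n * t n).
Proof.
move=> cs ct e e0; have [B B0 hB] := cauchy_bounded cs.
have [D D0 hD] := cauchy_bounded ct.
have e1 : 0 < e / 2 / D by rewrite !divr_gt0.
have e2 : 0 < e / 2 / B by rewrite !divr_gt0.
have [n1 h1] := cs _ e1; have [n2 h2] := ct _ e2.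
exists (maxn n1 n2) => m n; rewrite !geq_max => /andP [m1 m2] /andP [k1 k2].
have -> : s m * t m - s n * t n = s m * (t m - t n) + (s m - s n) * t n by ring.
apply: le_lt_trans (absD _ _ _) _; rewrite !absM.
have H1 : a (s m) * a (t m - t n) < e / 2.
  apply: le_lt_trans (ler_wpM2r (abs_ge0 _ _) (hB m)) _.
  by rewrite mulrC -ltr_pdivlMr // h2.
have H2 : a (s m - s n) * a (t n) < e / 2.
  apply: le_lt_trans (ler_wpM2l (abs_ge0 _ _) (hD n)) _.
  by rewrite -ltr_pdivlMr // h1.
lra.
Qed.

Lemma nullD s t : null_for a s -> null_for a t -> null_for a (fun n => s n + t n).
Proof.
move=> ns nt e e0; have e2 : 0 < e / 2 by rewrite divr_gt0.
have [n1 h1] := ns _ e2; have [n2 h2] := nt _ e2.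
exists (maxn n1 n2) => n; rewrite geq_max => /andP [k1 k2].
by have := absD a (s n) (t n); have := h1 _ k1; have := h2 _ k2; lra.
Qed.

Lemma nullN s : null_for a s -> null_for a (fun n => - s n).
Proof.
move=> ns e e0; have [n1 h1] := ns _ e0; exists n1 => n hn.
by rewrite absN; apply: h1.
Qed.

Lemma nullM s t : cauchy_for a s -> null_for a t ->
  null_for a (fun n => s n * t n).
Proof.
move=> cs nt e e0; have [B B0 hB] := cauchy_bounded cs.
have eB : 0 < e / B by rewrite divr_gt0.
have [n1 h1] := nt _ eB; exists n1 => n hn; rewrite absM.
apply: le_lt_trans (ler_wpM2r (abs_ge0 _ _) (hB n)) _.
by rewrite mulrC -ltr_pdivlMr // h1.
Qed.

Lemma null_sum (I : Type) (r : seq I) (u : I -> nat -> F) :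
  (forall i, null_for a (u i)) -> null_for a (fun n => \sum_(i <- r) u i n).
Proof.
move=> nu; elim: r => [|i r IH].
  by move=> e e0; exists 0%N => n _; rewrite big_nil abs0.
have := nullD (nu i) IH; congr null_for; apply/funext => n.
by rewrite big_cons.
Qed.

Lemma cauchy_sum (I : Type) (r : seq I) (u : I -> nat -> F) :
  (forall i, cauchy_for a (u i)) -> cauchy_for a (fun n => \sum_(i <- r) u i n).
Proof.
move=> nu; elim: r => [|i r IH].
  by move=> e e0; exists 0%N => m n _ _; rewrite !big_nil subrr abs0.
have := cauchyD (nu i) IH; congr cauchy_for; apply/funext => n.
by rewrite big_cons.
Qed.

(** This bound makes the inverses of a nonzero class Cauchy. *)
Lemma cauchy_away s : cauchy_for a s -> ~ null_for a s ->
  exists2 c : R, 0 < c & exists n0, forall n, (n0 <= n)%N -> c <= a (s n).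
Proof.
move=> cs nns; apply: contrapT => H; apply: nns => e e0.
have e2 : 0 < e / 2 by rewrite divr_gt0.
have [n0 h0] := cs _ e2; exists n0 => n hn.
apply: contrapT => /negP; rewrite -leNgt => he; apply: H.
exists (e / 2) => //; exists n0 => m hm.
have := h0 _ _ hn hm; have := absD a (s n - s m) (s m); rewrite subrK; lra.
Qed.

Lemma cauchyV s : cauchy_for a s -> ~ null_for a s ->
  cauchy_for a (fun n => (s n)^-1).
Proof.
move=> cs ns e e0; have [c c0 [n0 h0]] := cauchy_away cs ns.
have ec : 0 < e * (c * c) by rewrite !mulr_gt0.
have [n1 h1] := cs _ ec.
exists (maxn n0 n1) => m n; rewrite !geq_max => /andP [m1 m2] /andP [k1 k2].
have am := h0 _ m1; have an := h0 _ k1.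
have sm : s m != 0 by rewrite -(abs_gt0 a); apply: lt_le_trans am.
have sn : s n != 0 by rewrite -(abs_gt0 a); apply: lt_le_trans an.
have -> : (s m)^-1 - (s n)^-1 = (s n - s m) / (s m * s n).
  by field; rewrite sm sn.
rewrite absM absV absM ltr_pdivrMr; last by rewrite mulr_gt0 // abs_gt0.
apply: lt_le_trans (h1 _ _ k2 m2) _.
apply: ler_wpM2l; first exact: ltW.
by apply: ler_pM => //; apply: ltW.
Qed.

Lemma cauchy_abs s : cauchy_for a s ->
  forall e, 0 < e -> exists n0, forall m n, (n0 <= m)%N -> (n0 <= n)%N ->
     `|a (s m) - a (s n)| < e.
Proof.
move=> cs e e0; have [n0 h0] := cs _ e0; exists n0 => m n hm hn.
by apply: le_lt_trans (abs_dist _ _ _) (h0 _ _ hm hn).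
Qed.

End Sequences.

Section Completion.
Variables (R : realType) (F : fieldType) (a : absValue R F).
Implicit Types s t : nat -> F.

(** The same Cauchy sequence is chosen in every class modulo null sequences,
    so that equality of chosen sequences is equality in the completion. *)
Definition canon s : nat -> F :=
  xget (fun=> 0) [set t | cauchy_for a t /\ null_for a (fun n => s n - t n)]%classic.

Lemma canonP s : cauchy_for a s ->
  cauchy_for a (canon s) /\ null_for a (fun n => s n - canon s n).
Proof.
move=> cs; rewrite /canon; case: xgetP => [y yP //|/(_ s) []]; split=> //.
by move=> e e0; exists 0%N => n _; rewrite subrr abs0.
Qed.

Lemma canon_eq s t : null_for a (fun n => s n - t n) -> canon s = canon t.
Proof.
move=> st; rewrite /canon; congr xget; apply/funext => u; apply/propext.
split=> -[cu hu]; split=> //.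
  by have := nullD (nullN st) hu; congr null_for; apply/funext => n; ring.
by have := nullD st hu; congr null_for; apply/funext => n; ring.
Qed.

Record completion := Completion {
  crep : nat -> F;
  _ : `[< cauchy_for a crep /\ canon crep = crep >]
}.

HB.instance Definition _ := [isSub for crep].
HB.instance Definition _ := [Choice of completion by <:].

(** Makes [cmk] total on sequences. *)
Definition guard s := if `[< cauchy_for a s >] then s else fun=> 0.

Lemma guard_cauchy s : cauchy_for a (guard s).
Proof. by rewrite /guard; case: ifP => [/asboolP //|_]; apply: cauchy_cst. Qed.

Lemma cmk_subproof s :
  `[< cauchy_for a (canon (guard s)) /\ canon (canon (guard s)) = canon (guard s) >].
Proof.
have [h1 h2] := canonP (guard_cauchy s).
by apply/asboolP; split=> //; apply/esym/canon_eq.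
Qed.

(** Sealed, so that conversion never unfolds the field operations below. *)
Fact cmk_key : {f : (nat -> F) -> completion | forall s, f s = Completion (cmk_subproof s)}.
Proof. by exists (fun s => Completion (cmk_subproof s)). Qed.

Definition cmk s : completion := sval cmk_key s.

Lemma crepE s : crep (cmk s) = canon (guard s).
Proof. by rewrite /cmk (svalP cmk_key). Qed.

Lemma crep_cauchy x : cauchy_for a (crep x).
Proof. by case: x => s /= /asboolP []. Qed.

Lemma crep_cmk s : cauchy_for a s -> null_for a (fun n => s n - crep (cmk s) n).
Proof.
move=> cs; rewrite crepE /guard; case: asboolP => // _.
by case: (canonP cs).
Qed.

Lemma cmkP s t : cauchy_for a s -> cauchy_for a t ->
  cmk s = cmk t <-> null_for a (fun n => s n - t n).
Proof.
move=> cs ct; split=> [e|st].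
  have h1 := crep_cmk cs; have h2 := crep_cmk ct; rewrite -e in h2.
  by have := nullD h1 (nullN h2); congr null_for; apply/funext => n; ring.
apply/val_inj; rewrite /= !crepE /guard; do 2!case: asboolP => // _.
exact: canon_eq.
Qed.

Lemma cmkK x : cmk (crep x) = x.
Proof.
apply/val_inj; rewrite /= crepE /guard; case: asboolP => [_|/(_ (crep_cauchy x))//].
by case: x => s /= /asboolP [].
Qed.

Lemma cmkW x : exists2 s, cauchy_for a s & x = cmk s.
Proof. by exists (crep x); [exact: crep_cauchy | rewrite cmkK]. Qed.

Definition czero := cmk (fun=> 0).
Definition cone := cmk (fun=> 1).
Definition cadd x y := cmk (fun n => crep x n + crep y n).
Definition copp x := cmk (fun n => - crep x n).
Definition cmul x y := cmk (fun n => crep x n * crep y n).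
Definition cinv x := if x == czero then czero else cmk (fun n => (crep x n)^-1).

Lemma caddE s t : cauchy_for a s -> cauchy_for a t ->
  cadd (cmk s) (cmk t) = cmk (fun n => s n + t n).
Proof.
move=> cs ct; apply/cmkP; first exact: cauchyD (crep_cauchy _) (crep_cauchy _).
  exact: cauchyD.
have := nullN (nullD (crep_cmk cs) (crep_cmk ct)).
by congr null_for; apply/funext => n; ring.
Qed.

Lemma coppE s : cauchy_for a s -> copp (cmk s) = cmk (fun n => - s n).
Proof.
move=> cs; apply/cmkP; first exact: cauchyN (crep_cauchy _).
  exact: cauchyN.
by have := crep_cmk cs; congr null_for; apply/funext => n; ring.
Qed.

Lemma cmulE s t : cauchy_for a s -> cauchy_for a t ->
  cmul (cmk s) (cmk t) = cmk (fun n => s n * t n).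
Proof.
move=> cs ct; apply/cmkP; first exact: cauchyM (crep_cauchy _) (crep_cauchy _).
  exact: cauchyM.
have h1 := nullM (crep_cauchy (cmk t)) (crep_cmk cs).
have h2 := nullM cs (crep_cmk ct).
by have := nullN (nullD h1 h2); congr null_for; apply/funext => n /=; ring.
Qed.

Let cc := @cauchy_cst R F a.

Lemma caddA : associative cadd.
Proof.
move=> x y z; have [s cs ->] := cmkW x; have [t ct ->] := cmkW y.
have [u cu ->] := cmkW z; rewrite !caddE; do ?[exact: cauchyD | by []].
by congr cmk; apply/funext => n; ring.
Qed.

Lemma caddC : commutative cadd.
Proof. by move=> x y; congr cmk; apply/funext => n; ring. Qed.

Lemma cadd0 : left_id czero cadd.
Proof.
move=> x; have [s cs ->] := cmkW x; rewrite caddE //.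
by congr cmk; apply/funext => n; ring.
Qed.

Lemma caddN : left_inverse czero copp cadd.
Proof.
move=> x; have [s cs ->] := cmkW x; rewrite coppE // caddE //; last exact: cauchyN.
by congr cmk; apply/funext => n; ring.
Qed.

Lemma cmulA : associative cmul.
Proof.
move=> x y z; have [s cs ->] := cmkW x; have [t ct ->] := cmkW y.
have [u cu ->] := cmkW z; rewrite !cmulE; do ?[exact: cauchyM | by []].
by congr cmk; apply/funext => n; ring.
Qed.

Lemma cmulC : commutative cmul.
Proof. by move=> x y; congr cmk; apply/funext => n; ring. Qed.

Lemma cmul1 : left_id cone cmul.
Proof.
move=> x; have [s cs ->] := cmkW x; rewrite cmulE //.
by congr cmk; apply/funext => n; ring.
Qed.

Lemma cmulDl : left_distributive cmul cadd.
Proof.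
move=> x y z; have [s cs ->] := cmkW x; have [t ct ->] := cmkW y.
have [u cu ->] := cmkW z; rewrite caddE // !cmulE // ?caddE;
  do ?[exact: cauchyM | exact: cauchyD | by []].
by congr cmk; apply/funext => n; ring.
Qed.

Lemma cone_neq0 : cone != czero.
Proof.
apply/eqP => /cmkP h; have [n0 /(_ n0 (leqnn _))] := h (cc _) (cc _) 1 ltr01.
by rewrite subr0 abs1 ltxx.
Qed.

Lemma cmk_eq0 s : cauchy_for a s -> cmk s = czero <-> null_for a s.
Proof.
move=> cs; rewrite /czero cmkP //; have -> // : (fun n => s n - 0) = s.
by apply/funext => n; rewrite subr0.
Qed.

Lemma cmulV x : x != czero -> cmul (cinv x) x = cone.
Proof.
move=> x0; rewrite /cinv (negPf x0); have [s cs xE] := cmkW x.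
have nx : ~ null_for a (crep x).
  by move/(cmk_eq0 (crep_cauchy x)); rewrite cmkK; apply/eqP.
rewrite -{2}[x]cmkK cmulE; [|exact: cauchyV (crep_cauchy _) nx|exact: crep_cauchy].
have [c c0 [n0 h0]] := cauchy_away (crep_cauchy x) nx.
apply/cmkP => //; first exact: cauchyM (cauchyV (crep_cauchy x) nx) (crep_cauchy x).
move=> e e0; exists n0 => n hn; rewrite mulVf ?subrr ?abs0 //.
by rewrite -(abs_gt0 a); apply: lt_le_trans (h0 _ hn).
Qed.

Lemma cinv0 : cinv czero = czero.
Proof. by rewrite /cinv eqxx. Qed.

HB.instance Definition _ :=
  GRing.isZmodule.Build completion caddA caddC cadd0 caddN.
HB.instance Definition _ :=
  GRing.Zmodule_isComNzRing.Build completion cmulA cmulC cmul1 cmulDl cone_neq0.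
HB.instance Definition _ :=
  GRing.ComNzRing_isField.Build completion cmulV cinv0.

Definition cemb (x : F) : completion := cmk (fun=> x).

Lemma cmkD s t : cauchy_for a s -> cauchy_for a t ->
  cmk (fun n => s n + t n) = cmk s + cmk t.
Proof. by move=> cs ct; rewrite -caddE. Qed.

Lemma cmkN s : cauchy_for a s -> cmk (fun n => - s n) = - cmk s.
Proof. by move=> cs; rewrite -coppE. Qed.

Lemma cmkM s t : cauchy_for a s -> cauchy_for a t ->
  cmk (fun n => s n * t n) = cmk s * cmk t.
Proof. by move=> cs ct; rewrite -cmulE. Qed.

Lemma cemb_additive : zmod_morphism cemb.
Proof. by move=> x y; rewrite -cmkN // -cmkD. Qed.

Lemma cemb_multiplicative : monoid_morphism cemb.
Proof. by split=> // x y; rewrite -cmkM. Qed.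

HB.instance Definition _ := GRing.isZmodMorphism.Build F completion cemb cemb_additive.
HB.instance Definition _ := GRing.isMonoidMorphism.Build F completion cemb cemb_multiplicative.

Definition is_lim_abs s (l : R) :=
  forall e, 0 < e -> exists n0, forall n, (n0 <= n)%N -> `|a (s n) - l| < e.

Lemma is_lim_abs_unique s t l l' : null_for a (fun n => s n - t n) ->
  is_lim_abs s l -> is_lim_abs t l' -> l = l'.
Proof.
move=> st hl hl'; apply/eqP; rewrite -subr_eq0 -normr_eq0 eq_le normr_ge0 andbT.
rewrite leNgt; apply/negP => e0; set e := `|l - l'| in e0.
have e3 : 0 < e / 4 by rewrite divr_gt0.
have [n1 h1] := hl _ e3; have [n2 h2] := hl' _ e3; have [n3 h3] := st _ e3.
pose n := maxn n1 (maxn n2 n3).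
have := h1 n (leq_maxl _ _).
have := h2 n (leq_trans (leq_maxl _ _) (leq_maxr _ _)).
have := h3 n (leq_trans (leq_maxr _ _) (leq_maxr _ _)).
have := abs_dist a (s n) (t n).
have : e <= `|a (s n) - l| + `|a (t n) - l'| + `|a (s n) - a (t n)|.
  rewrite /e; have -> : l - l' = - (a (s n) - l) + (a (t n) - l') + (a (s n) - a (t n)).
    by ring.
  apply: le_trans (ler_normD _ _) _; rewrite lerD2r.
  by apply: le_trans (ler_normD _ _) _; rewrite normrN.
lra.
Qed.

Fact cabs_key : {f : completion -> R | forall x, is_lim_abs (crep x) (f x)}.
Proof.
apply: cid.
have [f hf] := choice (fun x => real_cauchy_lim (cauchy_abs (crep_cauchy x))).
by exists f.
Qed.

Definition cabs (x : completion) : R := sval cabs_key x.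

Lemma cabsP x : is_lim_abs (crep x) (cabs x).
Proof. exact: svalP cabs_key x. Qed.

Lemma cabs_lim s : cauchy_for a s -> is_lim_abs s (cabs (cmk s)).
Proof.
move=> cs; have [l hl] := real_cauchy_lim (cauchy_abs cs).
by rewrite -(is_lim_abs_unique (crep_cmk cs) hl (cabsP _)).
Qed.

Lemma cabs_eq s l : cauchy_for a s -> is_lim_abs s l -> cabs (cmk s) = l.
Proof.
move=> cs hl; apply: is_lim_abs_unique (cabs_lim cs) hl.
by move=> e e0; exists 0%N => n _; rewrite subrr abs0.
Qed.

Lemma cabs_emb x : cabs (cemb x) = a x.
Proof.
by apply: cabs_eq => // e e0; exists 0%N => n _; rewrite subrr normr0.
Qed.

Lemma cabs_ge0 x : 0 <= cabs x.
Proof.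
rewrite leNgt; apply/negP => h; have e0 : 0 < - cabs x by rewrite oppr_gt0.
have [n0 /(_ n0 (leqnn _))] := cabsP x e0.
have := abs_ge0 a (crep x n0); rewrite ltr_norml => ? /andP [? ?]; lra.
Qed.

Lemma cabs_eq0P x : cabs x = 0 <-> x = 0.
Proof.
split=> [h|->]; last by rewrite -[0]/(cemb 0) cabs_emb abs0.
rewrite -[x]cmkK; apply/(cmk_eq0 (crep_cauchy x)) => e e0.
have [n0 h0] := cabsP x e0; exists n0 => n hn; have := h0 _ hn.
by rewrite h subr0 ger0_norm ?abs_ge0.
Qed.

Lemma cabsM x y : cabs (x * y) = cabs x * cabs y.
Proof.
have hx := crep_cauchy x; have hy := crep_cauchy y.
rewrite -[x in LHS]cmkK -[y in LHS]cmkK -cmkM //; apply: cabs_eq; first exact: cauchyM.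
have [B B0 hB] := cauchy_bounded hx.
move=> e e0; have Y0 := cabs_ge0 y.
have e1 : 0 < e / 2 / B by rewrite !divr_gt0.
have e2 : 0 < e / 2 / (cabs y + 1) by rewrite !divr_gt0 // ltr_wpDl.
have [n1 h1] := cabsP x e2; have [n2 h2] := cabsP y e1.
exists (maxn n1 n2) => n; rewrite geq_max => /andP [k1 k2].
rewrite absM.
have -> : a (crep x n) * a (crep y n) - cabs x * cabs y =
  a (crep x n) * (a (crep y n) - cabs y) + (a (crep x n) - cabs x) * cabs y by ring.
apply: le_lt_trans (ler_normD _ _) _; rewrite !normrM.
have H1 : `|a (crep x n)| * `|a (crep y n) - cabs y| < e / 2.
  rewrite ger0_norm ?abs_ge0 //.
  apply: le_lt_trans (ler_wpM2r (normr_ge0 _) (hB n)) _.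
  by rewrite mulrC -ltr_pdivlMr // h2.
have H2 : `|a (crep x n) - cabs x| * `|cabs y| <= e / 2.
  rewrite (ger0_norm Y0); apply: le_trans (_ : e / 2 / (cabs y + 1) * (cabs y + 1) <= _).
    by apply: ler_pM => //; [rewrite ltW // h1 | rewrite lerDl].
  by rewrite divfK // gt_eqF // ltr_wpDl.
lra.
Qed.

Lemma cabsD x y : cabs (x + y) <= cabs x + cabs y.
Proof.
have hx := crep_cauchy x; have hy := crep_cauchy y.
rewrite -[x in leLHS]cmkK -[y in leLHS]cmkK -cmkD //; rewrite leNgt; apply/negP => h.
set z := cmk _ in h; pose e := cabs z - (cabs x + cabs y).
have e0 : 0 < e / 3 by rewrite divr_gt0 // subr_gt0.
have [n1 h1] := cabsP x e0; have [n2 h2] := cabsP y e0.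
have [n3 h3] := cabs_lim (cauchyD hx hy) e0.
pose n := maxn n1 (maxn n2 n3).
have := h1 n (leq_maxl _ _).
have := h2 n (leq_trans (leq_maxl _ _) (leq_maxr _ _)).
have := h3 n (leq_trans (leq_maxr _ _) (leq_maxr _ _)).
have := absD a (crep x n) (crep y n).
rewrite -/z !ltr_norml => ? /andP [? ?] /andP [? ?] /andP [? ?].
by have : e = cabs z - (cabs x + cabs y) by []; lra.
Qed.

Fact completion_abs_key : {f : absValue R completion | forall x, f x = cabs x}.
Proof. by exists (AbsValue cabs_ge0 cabs_eq0P cabsM cabsD). Qed.

Definition completion_abs : absValue R completion := sval completion_abs_key.

Lemma completion_absE x : completion_abs x = cabs x.
Proof. exact: svalP completion_abs_key x. Qed.

Lemma completion_abs_emb x : completion_abs (cemb x) = a x.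
Proof. by rewrite completion_absE cabs_emb. Qed.

Lemma completion_abs_dist x y : completion_abs (cemb x - cemb y) = a (x - y).
Proof. by rewrite -rmorphB completion_abs_emb. Qed.

Lemma completion_lim s : cauchy_for a s -> forall e, 0 < e ->
  exists n0, forall n, (n0 <= n)%N -> completion_abs (cemb (s n) - cmk s) < e.
Proof.
move=> cs e e0; have e2 : 0 < e / 2 by rewrite divr_gt0.
have [n0 h0] := cs _ e2; exists n0 => n hn.
have cs' : cauchy_for a (fun m => s n - s m) by apply: cauchyD => //; apply: cauchyN.
have -> : cemb (s n) - cmk s = cmk (fun m => s n - s m) by rewrite cmkD ?cmkN //; apply: cauchyN.
rewrite completion_absE; have [n1 h1] := cabs_lim cs' e2.
have := h1 (maxn n0 n1) (leq_maxr _ _); have := h0 _ _ hn (leq_maxl n0 n1).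
rewrite ltr_norml => ? /andP [? ?]; lra.
Qed.

Lemma completion_dense (x : completion) e : 0 < e ->
  exists y : F, completion_abs (x - cemb y) < e.
Proof.
move=> e0; have [n0 h0] := completion_lim (crep_cauchy x) e0.
exists (crep x n0); rewrite abs_distC; have := h0 n0 (leqnn _).
by rewrite cmkK.
Qed.

End Completion.

(** * Irreducible factors and splitting fields *)

Section Irreducible.
Variable k : fieldType.
Implicit Types p q g : {poly k}.

Lemma exists_irreducible_factor p : (1 < size p)%N ->
  exists2 q, irreducible_poly q & q %| p.
Proof.
have [n le_n] := ubnP (size p); elim: n => // n IH in p le_n *.
move=> p1; have [irr|nirr] := pselect (irreducible_poly p).
  by exists p => //; apply: dvdpp.
have [q q1 /andP [qp nqp]] : exists2 q : {poly k}, size q != 1 & (q %| p) && ~~ (q %= p).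
  apply: contrapT => H; apply: nirr; split=> // q q1 qp.
  by apply: contrapT => /negP h; apply: H; exists q => //; rewrite qp.
have p0 : p != 0 by rewrite -size_poly_gt0 (leq_trans _ p1).
have q0 : q != 0 by apply: contraNneq p0 => q0; rewrite q0 dvd0p in qp.
have sqp : (size q < size p)%N.
  by rewrite ltn_neqAle dvdp_leq // andbT; apply: contraNneq nqp => /eqP; rewrite dvdp_size_eqp.
have sq : (1 < size q)%N by rewrite ltn_neqAle eq_sym q1 size_poly_gt0.
have [r rirr rq] := IH q (leq_trans sqp le_n) sq.
by exists r => //; apply: dvdp_trans qp.
Qed.

Lemma irredp_size p : irreducible_poly p -> (1 < size p)%N.
Proof. by case. Qed.

Lemma irredp_coprime g p : irreducible_poly g -> coprimep g p = ~~ (g %| p).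
Proof.
move=> gi; apply/idP/idP => [cop|].
  apply/negP => gp; have := cop; rewrite /coprimep; have /eqp_size -> := dvdp_gcd_idl gp.
  by move/eqP => h; have := irredp_size gi; rewrite h.
apply: contraR => ncop; rewrite /coprimep in ncop.
have h := gi.2 _ ncop (dvdp_gcdl g p).
by rewrite -(eqp_dvdl _ h) dvdp_gcdr.
Qed.

Lemma irredp_dvd_prod (I : eqType) (r : seq I) (f : I -> {poly k}) g :
  irreducible_poly g -> g %| \prod_(i <- r) f i -> exists2 i, i \in r & g %| f i.
Proof.
move=> gi; elim: r => [|i r IH].
  rewrite big_nil dvdp1 => /eqP h; by have := irredp_size gi; rewrite h.
rewrite big_cons => h; have [gfi|ngfi] := boolP (g %| f i).
  by exists i; rewrite ?mem_head.
rewrite Gauss_dvdpr ?irredp_coprime // in h.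
by have [j jr gj] := IH h; exists j; rewrite // in_cons jr orbT.
Qed.

Lemma monic_irredp_eq p q : p \is monic -> q \is monic ->
  irreducible_poly p -> irreducible_poly q -> p %| q -> p = q.
Proof.
move=> pm qm pi qi pq; apply/eqP; rewrite -eqp_monic //.
by apply: qi.2 => //; have := irredp_size pi; case: (size p) => [|[]].
Qed.

Lemma monic_irred_factorization p : p \is monic ->
  exists gs : seq {poly k},
    (forall g, g \in gs -> g \is monic /\ irreducible_poly g) /\ p = \prod_(g <- gs) g.
Proof.
have [n le_n] := ubnP (size p); elim: n => // n IH in p le_n *.
move=> pm; have [p1|p1] := leqP (size p) 1.
  exists [::]; split=> //; rewrite big_nil; apply/eqP.
  have p0 := monic_neq0 pm.
  have s1 : size p = 1%N by apply/eqP; rewrite eqn_leq p1 size_poly_gt0.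
  by rewrite -eqp_monic ?monic1 // -size_poly_eq1 s1.
have [q qi qp] := exists_irreducible_factor p1.
have q0 : q != 0 := irredp_neq0 qi.
have lq : (lead_coef q)^-1 != 0 by rewrite invr_eq0 lead_coef_eq0.
pose g := (lead_coef q)^-1 *: q.
have gq : g %= q by rewrite eqp_scale.
have gm : g \is monic by rewrite monicE lead_coefZ mulVf // lead_coef_eq0.
have gi : irreducible_poly g.
  split; first by rewrite (eqp_size gq); case: qi.
  move=> r r1 rg; rewrite (eqp_dvdr _ gq) in rg.
  by apply: eqp_trans (qi.2 _ r1 rg) _; rewrite eqp_sym.
have gp : g %| p by rewrite (eqp_dvdl _ gq).
have pE : p = g * (p %/ g) by rewrite mulrC divpK.
have rm : p %/ g \is monic by rewrite -(monicMr _ gm) divpK.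
have [|gs [hgs pgs]] := IH (p %/ g) _ rm.
  rewrite size_divp ?monic_neq0 //; have := irredp_size gi.
  by move: le_n p1; case: (size p) => // s; case: (size g) => [|[]] //= *; lia.
exists (g :: gs); split=> [h|]; last by rewrite big_cons -pgs.
by rewrite in_cons => /orP [/eqP -> //|]; apply: hgs.
Qed.

End Irreducible.

(** One root is adjoined at a time; the field grows with the polynomial, hence
    the quantification over [k] inside the induction. *)
Lemma exists_splitting (n : nat) : forall (k : fieldType) (p : {poly k}), (size p <= n)%N ->
  exists (L : fieldType) (f : {rmorphism k -> L}) (c : L) (bs : seq L),
    map_poly f p = c *: \prod_(b <- bs) ('X - b%:P).
Proof.
elim: n => [|n IH] k p sp.
  exists k, idfun, 0, [::]; rewrite scale0r.
  by move: sp; rewrite size_poly_leq0 => /eqP ->; rewrite rmorph0.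
have [p1|p1] := leqP (size p) 1.
  exists k, idfun, p`_0, [::]; rewrite big_nil map_poly_id // alg_polyC.
  exact: size1_polyC.
have [q qi qp] := exists_irreducible_factor p1.
have [L _ [z qz _]] := irredp_FAdjoin qi.
have pz : root (map_poly (in_alg L) p) z.
  by apply: root_dvdp qz; rewrite dvdp_map.
have [p' p'E] := factor_theorem _ _ pz.
have p0 : p != 0 by rewrite -size_poly_gt0 (leq_trans _ p1).
have sp' : (size p' <= n)%N.
  have p'0 : p' != 0.
    apply: contraNneq p0 => h; move: p'E; rewrite h mul0r => /eqP.
    by rewrite map_poly_eq0.
  by rewrite -(size_map_poly (in_alg L)) p'E size_Mmonic ?monicXsubC // size_XsubC addn2 in sp.
have [L' [f [c [bs h]]]] := IH L p' sp'.
exists L', (f \o in_alg L), c, (rcons bs (f z)).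
rewrite map_poly_comp p'E rmorphM /= h rmorphB /= map_polyX map_polyC /=.
by rewrite -cats1 big_cat /= big_seq1 scalerAl.
Qed.

(** * Norms from quotients of polynomial rings *)

Section Norm.
Variable k : fieldType.
Implicit Types p q g P Q : {poly k}.

(** The companion matrix of [g], with a dimension of the form [n.+1] so that
    polynomials can be evaluated at it. *)
Definition cmx g : 'M[k]_((size g).-2.+1) :=
  \matrix_(i, j) (if i == (size g).-2 :> nat then - g`_j else (i.+1 == j :> nat)%:R).

Lemma char_poly_cmx g : g \is monic -> (1 < size g)%N -> char_poly (cmx g) = g.
Proof.
move=> gm g1; rewrite -[RHS]companionmxK // /cmx /companionmx.
have : (size g).-1 = (size g).-2.+1 by lia.
by case: _ / => //.
Qed.

(** The norm of the class of [P] from [k[X]/(g)] down to [k]. *)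
Definition pnorm g P : k := \det (horner_mx (cmx g) P).

Lemma pnormM g P Q : pnorm g (P * Q) = pnorm g P * pnorm g Q.
Proof. by rewrite /pnorm rmorphM detM. Qed.

Lemma pnormC g c : (1 < size g)%N -> pnorm g c%:P = c ^+ (size g).-1.
Proof.
by move=> g1; rewrite /pnorm horner_mx_C det_scalar; congr (_ ^+ _); lia.
Qed.

Lemma pnorm1 g : pnorm g 1 = 1.
Proof. by rewrite /pnorm rmorph1 det1. Qed.

Lemma pnorm_eqmod g P Q : g \is monic -> (1 < size g)%N -> g %| P - Q ->
  pnorm g P = pnorm g Q.
Proof.
move=> gm g1 /dvdpP [S e].
rewrite -[P](subrK Q) e /pnorm rmorphD rmorphM /=.
have := Cayley_Hamilton (cmx g); rewrite char_poly_cmx // => ->.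
by rewrite mulr0 add0r.
Qed.

Lemma pnorm_modp g P : g \is monic -> (1 < size g)%N -> pnorm g (P %% g) = pnorm g P.
Proof.
move=> gm g1; apply: pnorm_eqmod => //; rewrite {2}(divp_eq P g).
by rewrite opprD addrCA subrr addr0 dvdpNr dvdp_mull.
Qed.

(** An inverse modulo [g] has an inverse norm, by multiplicativity. *)
Lemma pnorm_eq0 g P : g \is monic -> irreducible_poly g ->
  (pnorm g P == 0) = (g %| P).
Proof.
move=> gm gi; have g1 := irredp_size gi; apply/idP/idP => [|gP]; last first.
  rewrite (@pnorm_eqmod _ _ 0) ?subr0 //.
  by rewrite /pnorm rmorph0 det0.
apply: contraLR => ngP; have : coprimep g P by rewrite irredp_coprime.
case/Bezout_eq1_coprimepP => -[u v] /= e.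
have : pnorm g (v * P) = 1.
  rewrite -(pnorm1 g); apply: pnorm_eqmod => //.
  by rewrite -e opprD addrCA subrr addr0 dvdpNr dvdp_mull.
rewrite pnormM => h; apply/eqP => h0; move/eqP: h.
by rewrite h0 mulr0 eq_sym oner_eq0.
Qed.

End Norm.

(** Splitting [P] into linear factors, the determinant of [P(A)] is a product
    of values of the characteristic polynomial of [A] at the roots of [P]. So
    it depends only on that characteristic polynomial, and in a multiplicative
    way. *)
Lemma det_horner_mx (k : fieldType) (P : {poly k}) :
  exists (L : fieldType) (f : {rmorphism k -> L}) (rho : {poly k} -> L),
  [/\ rho 1 = 1,
      forall p q, p \is monic -> q \is monic -> rho (p * q) = rho p * rho q
    & forall n (A : 'M[k]_n.+1), f (\det (horner_mx A P)) = rho (char_poly A)].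
Proof.
have [L [f [c [bs Pbs]]]] := exists_splitting (leqnn (size P)).
pose rho (p : {poly k}) := c ^+ (size p).-1 *
   \prod_(b <- bs) ((-1) ^+ (size p).-1 * (map_poly f p).[b]).
exists L, f, rho; split=> [|p q pm qm|n A].
- rewrite /rho size_poly1 mul1r big1 // => b _.
  by rewrite rmorph1 hornerC mulr1.
- have p0 := monic_neq0 pm; have q0 := monic_neq0 qm.
  have -> : rho (p * q) = c ^+ ((size p).-1 + (size q).-1) *
    \prod_(b <- bs) ((-1) ^+ ((size p).-1 + (size q).-1) * (map_poly f (p * q)).[b]).
    rewrite /rho size_mul //.
    have -> // : ((size p + size q).-1.-1 = (size p).-1 + (size q).-1)%N.
    by move: p0 q0; rewrite -!size_poly_gt0; lia.
  rewrite /rho exprD -!mulrA; congr (_ * _); rewrite mulrCA; congr (_ * _).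
  rewrite -big_split /=; apply: eq_bigr => b _.
  by rewrite rmorphM /= hornerM exprD; ring.
- rewrite -det_map_mx map_horner_mx Pbs linearZ /= detZ /rho size_char_poly /=.
  congr (_ * _); rewrite rmorph_prod /=.
  have -> : \det (\prod_(b <- bs) horner_mx (map_mx f A) ('X - b%:P)) =
            \prod_(b <- bs) \det (horner_mx (map_mx f A) ('X - b%:P)).
    by apply: (big_morph (fun M : 'M[L]_n.+1 => \det M)); [exact: detM | exact: det1].
  apply: eq_bigr => b _; rewrite rmorphB /= horner_mx_X horner_mx_C.
  rewrite -opprB -scaleN1r detZ; congr (_ * _).
  rewrite map_char_poly /char_poly -[RHS]/(horner_eval b _) -det_map_mx.
  congr (\det _); apply/matrixP => i j; rewrite !mxE /horner_eval.
  by rewrite /= /horner_eval !hornerE hornerMn hornerX.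
Qed.

Lemma char_poly_rho_exp (k : fieldType) (L : fieldType) (rho : {poly k} -> L) p e :
  rho 1 = 1 -> (forall p q, p \is monic -> q \is monic -> rho (p * q) = rho p * rho q) ->
  p \is monic -> rho (p ^+ e) = rho p ^+ e.
Proof.
move=> r1 rM pm; elim: e => [|e IH]; first by rewrite !expr0.
by rewrite !exprS rM ?monic_exp // IH.
Qed.

Section NormMultiplicative.
Variable k : fieldType.

(** This is [det_horner_mx] for companion matrices, as each polynomial is the
    characteristic polynomial of its own. *)
Lemma pnorm_prod (gs : seq {poly k}) (P : {poly k}) :
  (forall g, g \in gs -> g \is monic /\ (1 < size g)%N) -> gs != [::] ->
  pnorm (\prod_(g <- gs) g) P = \prod_(g <- gs) pnorm g P.
Proof.
move=> hgs gs0; have [L [f [rho [r1 rM rdet]]]] := det_horner_mx P.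
have r_pnorm g : g \is monic -> (1 < size g)%N -> f (pnorm g P) = rho g.
  by move=> gm g1; rewrite /pnorm rdet char_poly_cmx.
have mon (s : seq {poly k}) : (forall g, g \in s -> g \is monic /\ (1 < size g)%N) ->
    \prod_(g <- s) g \is monic.
  by move=> hs; rewrite big_seq; apply: monic_prod => g /hs [].
have pr (s : seq {poly k}) : (forall g, g \in s -> g \is monic /\ (1 < size g)%N) ->
    rho (\prod_(g <- s) g) = \prod_(g <- s) rho g.
  elim: s => [|g s IH] hs; first by rewrite !big_nil.
  have hg := hs g (mem_head _ _).
  have hs' h : h \in s -> h \is monic /\ (1 < size h)%N.
    by move=> hin; apply: hs; rewrite in_cons hin orbT.
  by rewrite !big_cons rM ?IH ?mon //; case: hg.
apply: (fmorph_inj f); rewrite rmorph_prod /= r_pnorm ?mon //; last first.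
  move: gs0 hgs; case: gs => // g s _ hs; have [gm g1] := hs g (mem_head _ _).
  have sm : \prod_(j <- s) j \is monic.
    by apply: mon => h hin; apply: hs; rewrite in_cons hin orbT.
  rewrite big_cons size_monicM ?monic_neq0 //.
  have := monic_neq0 sm; rewrite -size_poly_gt0.
  by move: (size _) (size _) g1 => a b; lia.
by rewrite pr // big_seq [RHS]big_seq; apply: eq_bigr => g /hgs [gm g1]; rewrite r_pnorm.
Qed.

Lemma det_horner_mx_exp n m (A : 'M[k]_n.+1) (B : 'M[k]_m.+1) e (P : {poly k}) :
  char_poly A = char_poly B ^+ e ->
  \det (horner_mx A P) = \det (horner_mx B P) ^+ e.
Proof.
move=> AB; have [L [f [rho [r1 rM rdet]]]] := det_horner_mx P.
apply: (fmorph_inj f); rewrite rmorphXn /= !rdet AB.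
by apply: char_poly_rho_exp => //; apply: char_poly_monic.
Qed.

(** All the eigenvalues are roots of [p], so every irreducible factor of the
    characteristic polynomial is a multiple of [p], and [p] can be divided out
    repeatedly. *)
Lemma char_poly_irred_annihilator n (A : 'M[k]_n.+1) (p : {poly k}) :
  p \is monic -> irreducible_poly p -> horner_mx A p = 0 ->
  exists e, char_poly A = p ^+ e.
Proof.
move=> pm pi pA.
have key (q : {poly k}) : irreducible_poly q -> q %| char_poly A -> p %| q.
  move=> qi qA; have [L _ [z qz _]] := irredp_FAdjoin qi.
  have Az : root (map_poly (in_alg L) (char_poly A)) z.
    by apply: root_dvdp qz; rewrite dvdp_map.
  rewrite map_char_poly -root_mxminpoly in Az.
  have pz : root (map_poly (in_alg L) p) z.
    apply: root_dvdp Az; apply: mxminpoly_min.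
    by rewrite -map_horner_mx pA map_mx0.
  apply: contraLR isT => npq; have : coprimep p q by rewrite irredp_coprime.
  rewrite -(coprimep_map (in_alg L)) => cop.
  by have := coprimep_root cop pz; rewrite (rootP qz) eqxx.
have {key} : forall q, irreducible_poly q -> q %| char_poly A -> p %| q := key.
have : char_poly A \is monic := char_poly_monic A.
move: (char_poly A) => f; have [m le_m] := ubnP (size f).
elim: m => // m IH in f le_m * => fm key.
have [f1|f1] := leqP (size f) 1.
  exists 0%N; rewrite expr0; apply/eqP; rewrite -eqp_monic ?monic1 // -size_poly_eq1.
  by rewrite eqn_leq f1 size_poly_gt0 monic_neq0.
have [q qi qf] := exists_irreducible_factor f1.
have pf : p %| f by apply: dvdp_trans (key q qi qf) qf.
have fE : f = p * (f %/ p) by rewrite mulrC divpK.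
have rm : f %/ p \is monic by rewrite -(monicMr _ pm) divpK.
have [||e he] := IH (f %/ p) _ rm.
- rewrite size_divp ?monic_neq0 //; have := irredp_size pi.
  by move: le_m f1; case: (size f) => // s; case: (size p) => [|[]] //= *; lia.
- by move=> r ri rf; apply: key => //; rewrite fE dvdp_mull.
by exists e.+1; rewrite exprS -he.
Qed.

End NormMultiplicative.

(** * Extension of an absolute value to a finite extension *)

Section UltraLimits.
Local Open Scope classical_set_scope.
Variables (R : realType) (k : fieldType) (a : absValue R k).

(** Sequential compactness of bounded sets, phrased with ultrafilters so that
    limits of finitely many sequences are taken at once, without extracting
    subsequences. *)
Definition bounded_compact := forall G : set_system nat, UltraFilter G ->
  forall u : nat -> k, (exists B : R, forall n, a (u n) <= B) ->
  exists l, forall e : R, 0 < e -> G [set n | a (u n - l) < e].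

Variables (G : set_system nat) (GU : UltraFilter G).

Definition ulim (u : nat -> k) (l : k) :=
  forall e : R, 0 < e -> G [set n | a (u n - l) < e].

Lemma ulim_cst (x : k) : ulim (fun=> x) x.
Proof.
move=> e e0; rewrite (_ : mkset _ = setT); first exact: filterT.
by apply/seteqP; split=> // n _; rewrite /= subrr abs0.
Qed.

Lemma ulimD u v x y : ulim u x -> ulim v y -> ulim (fun n => u n + v n) (x + y).
Proof.
move=> hu hv e e0; have e2 : 0 < e / 2 by rewrite divr_gt0.
apply: filterS (filterI (hu _ e2) (hv _ e2)) => n [/= h1 h2].
have -> : u n + v n - (x + y) = (u n - x) + (v n - y) by ring.
by have := absD a (u n - x) (v n - y); lra.
Qed.

Lemma ulimM u v x y : ulim u x -> ulim v y -> ulim (fun n => u n * v n) (x * y).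
Proof.
move=> hu hv e e0.
have X0 := abs_ge0 a x; have Y0 := abs_ge0 a y.
pose d := Num.min 1 (e / (2 * (a x + a y + 1))).
have D0 : 0 < 2 * (a x + a y + 1) by lra.
have d0 : 0 < d by rewrite /d lt_min ltr01 divr_gt0.
have d1 : d <= 1 by rewrite /d ge_min lexx.
have d2 : d * (2 * (a x + a y + 1)) <= e.
  by rewrite -ler_pdivlMr // /d ge_min lexx orbT.
apply: filterS (filterI (hu _ d0) (hv _ d0)) => n [/= h1 h2].
have -> : u n * v n - x * y = (u n - x) * (v n - y) + (u n - x) * y + x * (v n - y) by ring.
have := absD a ((u n - x) * (v n - y) + (u n - x) * y) (x * (v n - y)).
have := absD a ((u n - x) * (v n - y)) ((u n - x) * y).
rewrite !absM.
have := abs_ge0 a (u n - x); have := abs_ge0 a (v n - y).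
move: (a (u n - x)) (a (v n - y)) h1 h2 => s t hs ht t0 s0 H1 H2.
have p1 : s * t <= d by nra.
have p2 : s * a y <= d * a y by nra.
have p3 : a x * t <= a x * d by nra.
nra.
Qed.

Lemma ulim_sum (I : Type) (r : seq I) (P : pred I) (u : I -> nat -> k) (l : I -> k) :
  (forall i, ulim (u i) (l i)) ->
  ulim (fun n => \sum_(i <- r | P i) u i n) (\sum_(i <- r | P i) l i).
Proof.
move=> h; rewrite big_mkcond.
rewrite (_ : (fun n => _) = fun n => \sum_(i <- r) if P i then u i n else 0); last first.
  by apply/funext => n; rewrite big_mkcond.
elim: r => [|i r IH].
  rewrite big_nil (_ : (fun n => _) = fun=> 0); first exact: ulim_cst.
  by apply/funext => n; rewrite big_nil.
rewrite big_cons (_ : (fun n => _) = fun n => (if P i then u i n else 0) +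
    \sum_(i <- r) if P i then u i n else 0); last by apply/funext => n; rewrite big_cons.
by apply: ulimD IH; case: ifP => _; [apply: h | apply: ulim_cst].
Qed.

Lemma ulim_prod (I : Type) (r : seq I) (u : I -> nat -> k) (l : I -> k) :
  (forall i, ulim (u i) (l i)) ->
  ulim (fun n => \prod_(i <- r) u i n) (\prod_(i <- r) l i).
Proof.
move=> h; elim: r => [|i r IH].
  rewrite big_nil (_ : (fun n => _) = fun=> 1); first exact: ulim_cst.
  by apply/funext => n; rewrite big_nil.
rewrite big_cons (_ : (fun n => _) = fun n => u i n * \prod_(i <- r) u i n).
  exact: ulimM.
by apply/funext => n; rewrite big_cons.
Qed.

Lemma ulim_unique u x y : ulim u x -> ulim u y -> x = y.
Proof.
move=> hx hy; apply/eqP; rewrite -subr_eq0; apply/eqP/(abs_eq0P a)/eqP.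
rewrite eq_le abs_ge0 andbT leNgt; apply/negP => e0.
have e2 : 0 < a (x - y) / 2 by rewrite divr_gt0.
have [n [/= h1 h2]] := @filter_ex _ _ _ _ (filterI (hx _ e2) (hy _ e2)).
have := abs_triangle a (u n) x y; rewrite abs_distC in h1; lra.
Qed.

Lemma ulim_det n (A : nat -> 'M[k]_n) (B : 'M[k]_n) :
  (forall i j, ulim (fun t => A t i j) (B i j)) -> ulim (fun t => \det (A t)) (\det B).
Proof.
move=> h; apply: ulim_sum => s; apply: ulimM; first exact: ulim_cst.
by apply: ulim_prod => i; apply: h.
Qed.

Lemma ulim_horner_mx n (C : 'M[k]_n.+1) m (P : nat -> {poly k}) (Q : {poly k}) :
  (forall t, (size (P t) <= m)%N) -> (size Q <= m)%N ->
  (forall i, ulim (fun t => (P t)`_i) Q`_i) ->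
  ulim (fun t => \det (horner_mx C (P t))) (\det (horner_mx C Q)).
Proof.
move=> hP hQ h; have E (p : {poly k}) : (size p <= m)%N -> horner_mx C p = \sum_(i < m) p`_i *: C ^+ i.
  move=> hp; rewrite {1}(_ : p = \sum_(i < m) p`_i *: 'X^i); last first.
    apply/polyP => j; rewrite coef_sum.
    have [jm|mj] := ltnP j m.
      rewrite (bigD1 (Ordinal jm)) //= coefZ coefXn eqxx mulr1 big1 ?addr0 // => i ij.
      by rewrite coefZ coefXn (_ : (j == i) = false) ?mulr0 // eq_sym; apply/negbTE.
    rewrite nth_default ?(leq_trans hp) // big1 // => i _; rewrite coefZ coefXn.
    by rewrite (_ : (j == i) = false) ?mulr0 //; apply/negbTE; rewrite neq_ltn (leq_trans (ltn_ord i) mj) orbT.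
  by rewrite linear_sum; apply: eq_bigr => i _; rewrite linearZ /= rmorphXn /= horner_mx_X.
apply: ulim_det => i j; rewrite (E _ hQ).
rewrite (_ : (fun t => _) = fun t => \sum_(l < m) (P t)`_l * (C ^+ l) i j); last first.
  by apply/funext => t; rewrite E // summxE; apply: eq_bigr => l _; rewrite mxE.
rewrite summxE (eq_bigr (fun l : 'I_m => Q`_l * (C ^+ l) i j)); last by move=> l _; rewrite mxE.
by apply: ulim_sum => l; apply: ulimM => //; apply: ulim_cst.
Qed.

End UltraLimits.

Lemma pos_lower_bound (R : realType) (I : finType) (f : I -> R) :
  (forall i, 0 < f i) -> exists2 c : R, 0 < c & forall i, c <= f i.
Proof.
move=> f0; have S0 : 0 <= \sum_i (f i)^-1.
  by apply: sumr_ge0 => i _; rewrite invr_ge0 ltW.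
exists (1 + \sum_i (f i)^-1)^-1; first by rewrite invr_gt0; lra.
move=> i; rewrite -[leRHS]invrK lef_pV2 ?posrE ?invr_gt0 //; last by lra.
rewrite (bigD1 i) //=.
have : 0 <= \sum_(j | j != i) (f j)^-1.
  by apply: sumr_ge0 => j _; rewrite invr_ge0 ltW.
lra.
Qed.

Lemma powR_invrn (R : realType) (x : R) n : 0 <= x -> (0 < n)%N ->
  (x `^ n%:R^-1) ^+ n = x.
Proof.
move=> x0 n0; rewrite -powR_mulrn ?powR_ge0 // -powRrM mulVf ?powRr1 //.
by rewrite pnatr_eq0 -lt0n.
Qed.

Section ExtendAbs.
Variables (R : realType) (k : fieldType) (a : absValue R k).
Hypothesis BC : bounded_compact a.
Variable g : {poly k}.
Hypotheses (gm : g \is monic) (gi : irreducible_poly g).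
Implicit Types P Q : {poly k}.

Let n := (size g).-1.
Let g1 : (1 < size g)%N := irredp_size gi.
Let n0 : (0 < n)%N. Proof. by rewrite /n; lia. Qed.
Let nE : (size g).-2.+1 = n. Proof. by rewrite /n; lia. Qed.
Let len m : (m < size g)%N -> (m <= n)%N.
Proof. by rewrite /n; case: (size g). Qed.

(** The norm vanishes only at 0 on polynomials of degree less than [n], so by
    compactness it is bounded below on those with bounded coefficients and an
    entry equal to 1. *)
Lemma pnorm_lower_at (i : nat) : exists2 c : R, 0 < c &
  forall P, (size P < size g)%N -> P`_i = 1 -> (forall j, a P`_j <= 1) -> c <= a (pnorm g P).
Proof.
apply: contrapT => H.
have H' t : exists P : {poly k}, [/\ (size P < size g)%N, P`_i = 1, forall j, a P`_j <= 1 &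
    a (pnorm g P) < t.+1%:R^-1].
  apply: contrapT => h; apply: H; exists t.+1%:R^-1; first by rewrite invr_gt0.
  move=> P h1 h2 h3; rewrite leNgt; apply/negP => h4; apply: h.
  by exists P; split.
have [P hP] := choice H'.
have [G [GU tG]] := ultraFilterLemma eventually_filter.
have hl j : exists l, ulim a G (fun t => (P t)`_j) l.
  by apply: BC; exists 1 => t; case: (hP t).
have [l hl'] := choice hl.
pose Q := \poly_(j < n) l j.
have lz j : (n <= j)%N -> l j = 0.
  move=> nj; apply: (ulim_unique GU (hl' j)).
  rewrite (_ : (fun t => _) = fun=> 0); first exact: ulim_cst.
  apply/funext => t; rewrite nth_default //; case: (hP t) => h _ _ _.
  by apply: leq_trans nj; apply: len.
have Ql j : Q`_j = l j by rewrite coef_poly; case: ltnP => // /lz ->.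
have Qi : Q`_i = 1.
  rewrite Ql; apply: (ulim_unique GU (hl' i)).
  rewrite (_ : (fun t => _) = fun=> 1); first exact: ulim_cst.
  by apply/funext => t; case: (hP t).
have sQ : (size Q <= n)%N := size_poly _ _.
have QN : ulim a G (fun t => pnorm g (P t)) (pnorm g Q).
  apply: (@ulim_horner_mx _ _ _ _ GU _ _ n) => // [t|j]; last by rewrite Ql.
  by case: (hP t) => h _ _ _; apply: len.
have Q0 : ulim a G (fun t => pnorm g (P t)) 0.
  move=> e e0.
  have [m hm] : exists m : nat, e^-1 < m%:R.
    by exists (Num.truncn e^-1).+1; apply: truncnS_gt.
  apply: filterS (_ : G [set t | (m <= t)%N]%classic); last first.
    by apply: tG; exists m.
  move=> t /= mt; rewrite subr0; case: (hP t) => _ _ _ h; apply: lt_le_trans h _.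
  rewrite invf_ple ?posrE //; apply: le_trans (ltW hm) _.
  by rewrite ler_nat; lia.
(* The limit of a sequence contradicting the bound is a nonzero multiple of
   [g] of degree less than that of [g]. *)
have /eqP := ulim_unique GU QN Q0; rewrite pnorm_eq0 // => gQ.
have Qn0 : Q != 0 by apply/eqP => Q00; move: Qi; rewrite Q00 coef0 => /eqP; rewrite eq_sym oner_eq0.
have ng : (n < size g)%N by rewrite /n prednK // ltnW.
by have := leq_ltn_trans (leq_trans (dvdp_leq Qn0 gQ) sQ) ng; rewrite ltnn.
Qed.

Lemma pnormZ c P : pnorm g (c *: P) = c ^+ n * pnorm g P.
Proof. by rewrite -mul_polyC pnormM pnormC. Qed.

(** Scaling by the inverse of the largest coefficient reduces to a coefficient
    equal to 1. *)
Lemma pnorm_lower : exists2 c : R, 0 < c &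
  forall P, (size P < size g)%N -> forall i, c * a P`_i ^+ n <= a (pnorm g P).
Proof.
have H (i : 'I_n) : exists c : R, 0 < c /\ forall P : {poly k},
    (size P < size g)%N -> P`_i = 1 -> (forall j, a P`_j <= 1) -> c <= a (pnorm g P).
  by have [c c0 h] := pnorm_lower_at i; exists c.
have [c hc] := choice H.
have [d d0 hd] := pos_lower_bound (fun i => (hc i).1).
exists d => // P sP i.
have [ni|iln] := leqP n i.
  rewrite nth_default ?abs0 ?expr0n; last by apply: leq_trans ni; apply: len.
  by rewrite eqn0Ngt n0 mulr0 abs_ge0.
pose i1 := [arg max_(j > Ordinal iln) a P`_j]%O.
have imax (j : nat) : a P`_j <= a P`_i1.
  have [jn|nj] := ltnP j n.
    rewrite /i1; case: (@Order.TotalTheory.arg_maxP _ _ _ (Ordinal iln) xpredT (fun j => a P`_j)) => // i' _ h.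
    exact: (h (Ordinal jn)).
  rewrite nth_default ?abs0 ?abs_ge0 //; by apply: leq_trans nj; apply: len.
have [z|nz] := eqVneq (P`_i1) 0.
  have : a P`_i <= 0 by have := imax i; rewrite z abs0.
  rewrite le_eqVlt ltNge abs_ge0 orbF => /eqP ->.
  by rewrite expr0n eqn0Ngt n0 mulr0 abs_ge0.
have a0 : 0 < a P`_i1 by rewrite abs_gt0.
have := (hc i1).2 ((P`_i1)^-1 *: P).
rewrite size_scale ?invr_eq0 // coefZ mulVf // => /(_ sP erefl).
have hj j : a ((P`_i1)^-1 *: P)`_j <= 1.
  by rewrite coefZ absM absV mulrC ler_pdivrMr // mul1r.
move=> /(_ hj); rewrite pnormZ absM absX absV => h.
have {}h := le_trans (hd i1) h.
apply: le_trans (_ : d * a P`_i1 ^+ n <= _).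
  by apply: ler_wpM2l; [exact: ltW | apply: lerXn2r => //; rewrite nnegrE ?abs_ge0].
by rewrite exprVn mulrC ler_pdivlMr ?exprn_gt0 // in h.
Qed.

(** The Leibniz formula for the determinant, with each entry bounded in terms
    of the coefficients. *)
Lemma pnorm_upper : exists2 C : R, 0 < C &
  forall P (M : R), (size P < size g)%N -> (forall i, a P`_i <= M) ->
    a (pnorm g P) <= C * M ^+ n.
Proof.
pose Z := cmx g; pose D := \sum_(l < n) \sum_i \sum_j a ((Z ^+ l) i j).
exists (((size g).-2.+1)`!%:R * (1 + D) ^+ n).
  rewrite mulr_gt0 ?ltr0n ?fact_gt0 // exprn_gt0 // ltr_pwDl //.
  by do 3!apply: sumr_ge0 => ? _; apply: abs_ge0.
move=> P M sP hM.
have M0 : 0 <= M by apply: le_trans (hM 0%N); apply: abs_ge0.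
have ent i j : a (horner_mx Z P i j) <= M * (1 + D).
  have -> : horner_mx Z P = \sum_(l < n) P`_l *: Z ^+ l.
    rewrite {1}(_ : P = \poly_(l < n) P`_l); last first.
      apply/polyP => l; rewrite coef_poly; case: ltnP => // nl.
      by rewrite nth_default //; apply: leq_trans nl; apply: len.
    rewrite poly_def linear_sum; apply: eq_bigr => l _.
    by rewrite linearZ /= rmorphXn /= horner_mx_X.
  rewrite summxE; apply: le_trans (abs_sum _ _ _ _) _.
  apply: le_trans (_ : M * D <= _); last by rewrite ler_wpM2l // lerDr.
  rewrite /D mulr_sumr; apply: ler_sum => l _; rewrite mxE absM.
  apply: ler_pM; rewrite ?abs_ge0 //.
  rewrite (bigD1 i) //= (bigD1 j) //= -addrA lerDl addr_ge0 //.
    by apply: sumr_ge0 => ? _; apply: abs_ge0.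
  by do 2!apply: sumr_ge0 => ? _; apply: abs_ge0.
apply: le_trans (abs_sum _ _ _ _) _.
apply: le_trans (_ : \sum_(s : 'S_((size g).-2.+1)) (M * (1 + D)) ^+ n <= _).
  apply: ler_sum => s _; rewrite abs_sign abs_prod.
  apply: le_trans (_ : \prod_(i < (size g).-2.+1) (M * (1 + D)) <= _).
    by apply: ler_prod => i _; rewrite abs_ge0 ent.
  by rewrite prodr_const card_ord nE.
by rewrite sumr_const card_Sn exprMn -[leLHS]mulr_natl -mulrA [(1 + D) ^+ n * _]mulrC.
Qed.

Fact gabs_key : {f : {poly k} -> R | forall P, f P = a (pnorm g P) `^ n%:R^-1}.
Proof. by exists (fun P => a (pnorm g P) `^ n%:R^-1). Qed.

(** The absolute value of [k[X]/(g)], as a seminorm on [k[X]]. *)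
Definition gabs P : R := sval gabs_key P.

Lemma gabsE P : gabs P = a (pnorm g P) `^ n%:R^-1.
Proof. exact: svalP gabs_key P. Qed.

Lemma gabsXn P : gabs P ^+ n = a (pnorm g P).
Proof. by rewrite gabsE powR_invrn ?abs_ge0. Qed.

Lemma gabs_ge0 P : 0 <= gabs P. Proof. by rewrite gabsE powR_ge0. Qed.

Lemma gabsM P Q : gabs (P * Q) = gabs P * gabs Q.
Proof. by rewrite !gabsE pnormM absM powRM ?abs_ge0. Qed.

Lemma gabsC c : gabs c%:P = a c.
Proof.
apply/eqP; rewrite -(@eqrXn2 _ n) ?gabs_ge0 ?abs_ge0 //.
by rewrite gabsXn pnormC // absX.
Qed.

Lemma gabs1 : gabs 1 = 1. Proof. by rewrite gabsC abs1. Qed.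

Lemma gabsX P m : gabs (P ^+ m) = gabs P ^+ m.
Proof. by elim: m => [|m IH]; rewrite ?expr0 ?gabs1 // !exprS gabsM IH. Qed.

Lemma gabs_eqmod P Q : g %| P - Q -> gabs P = gabs Q.
Proof. by move=> h; rewrite !gabsE (pnorm_eqmod gm g1 h). Qed.

Lemma gabs_modp P : gabs (P %% g) = gabs P.
Proof. by rewrite !gabsE pnorm_modp. Qed.

Lemma gabs_eq0 P : (gabs P == 0) = (g %| P).
Proof.
rewrite !gabsE powR_eq0 abs_eq0 pnorm_eq0 // invr_eq0 pnatr_eq0 -lt0n n0.
by rewrite andbT.
Qed.

Lemma gabs_lower : exists2 c : R, 0 < c &
  forall P, (size P < size g)%N -> forall i, c * a P`_i <= gabs P.
Proof.
have [c c0 h] := pnorm_lower; exists (c `^ n%:R^-1); first exact: powR_gt0.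
move=> P sP i; rewrite -(@ler_pXn2r _ n n0) ?nnegrE ?gabs_ge0 //; last first.
  by rewrite mulr_ge0 ?powR_ge0 ?abs_ge0.
by rewrite gabsXn exprMn powR_invrn ?(ltW c0) //; apply: h.
Qed.

Lemma gabs_upper : exists2 C : R, 0 < C &
  forall P (M : R), (size P < size g)%N -> (forall i, a P`_i <= M) -> gabs P <= C * M.
Proof.
have [c c0 h] := pnorm_upper; exists (c `^ n%:R^-1); first exact: powR_gt0.
move=> P M sP hM; have M0 : 0 <= M by apply: le_trans (hM 0%N); apply: abs_ge0.
rewrite -(@ler_pXn2r _ n n0) ?nnegrE ?gabs_ge0 //; last first.
  by rewrite mulr_ge0 ?powR_ge0.
by rewrite gabsXn exprMn powR_invrn ?(ltW c0) //; apply: h.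
Qed.

Lemma size_modg P : (size (P %% g)%R < size g)%N.
Proof. by rewrite ltn_modpN0 ?monic_neq0. Qed.

(** Since [gabs] is multiplicative and comparable to the maximum of the
    coefficients, the binomial formula for a large power gives the triangle
    inequality, the constants being absorbed by taking roots. *)
Lemma gabsD P Q : gabs (P + Q) <= gabs P + gabs Q.
Proof.
have [c c0 hc] := gabs_lower; have [C C0 hC] := gabs_upper.
apply: (@le_of_expr_le _ (C / c)); rewrite ?addr_ge0 ?gabs_ge0 // => m.
rewrite -gabsX -gabs_modp.
set S := gabs P + gabs Q; have S0 : 0 <= S by rewrite addr_ge0 ?gabs_ge0.
apply: le_trans (_ : C * (c^-1 * S ^+ m) <= _); last first.
  rewrite mulrA -[leRHS]mulrA; apply: ler_wpM2l; first by rewrite divr_ge0 // ltW.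
  by rewrite ler_peMl ?exprn_ge0 // ler1n.
apply: hC; first exact: size_modg.
move=> i; rewrite exprDn.
rewrite (big_morph (fun p => p %% g) (fun p q => modpD g p q) (mod0p g)).
rewrite coef_sum; apply: le_trans (abs_sum _ _ _ _) _.
rewrite /S exprDn mulr_sumr; apply: ler_sum => j _.
rewrite -scaler_nat modpZl coefZ absM -[(gabs P ^+ _ * gabs Q ^+ _) *+ _]mulr_natl mulrCA.
apply: ler_pM; rewrite ?abs_ge0 ?abs_nat //.
rewrite ler_pdivlMl //; apply: le_trans (hc _ (size_modg _) i) _.
by rewrite gabs_modp gabsM !gabsX.
Qed.

(** The comparison with the coefficients gives [w <= C * gabs], and powers
    remove [C]. Applied to an inverse of [P] modulo [g], the inequality [w <=
    gabs] gives the converse one at [P]. *)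
Lemma gabs_unique (w : {poly k} -> R) :
  (forall P, 0 <= w P) -> (forall P Q, w (P * Q) = w P * w Q) ->
  (forall P Q, w (P + Q) <= w P + w Q) -> (forall c, w c%:P = a c) ->
  w g = 0 -> forall P, w P = gabs P.
Proof.
move=> w0 wM wD wC wg.
have w00 : w 0 = 0 by rewrite wC abs0.
have wX P m : w (P ^+ m) = w P ^+ m.
  by elim: m => [|m IH]; rewrite ?expr0 ?wC ?abs1 // !exprS wM IH.
have wgM P : w (P * g) = 0 by rewrite wM wg mulr0.
have wmod P : w P <= w (P %% g).
  by rewrite {1}(divp_eq P g); apply: le_trans (wD _ _) _; rewrite wgM add0r.
have [c c0 hc] := gabs_lower.
have wle P : w P <= (c^-1 * \sum_(i < n) w ('X ^+ i)) * gabs P.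
  suff H (Q : {poly k}) : (size Q < size g)%N ->
      w Q <= (c^-1 * \sum_(i < n) w ('X ^+ i)) * gabs Q.
    by apply: le_trans (wmod P) _; rewrite -(gabs_modp P); apply/H/size_modg.
  move=> sQ.
  rewrite {1}(_ : Q = \sum_(i < n) (Q`_i)%:P * 'X^i); last first.
    under eq_bigr do rewrite mul_polyC; rewrite -(poly_def n (fun i => Q`_i)).
    apply/polyP => l; rewrite coef_poly; case: ltnP => // nl.
    by rewrite nth_default //; apply: leq_trans nl; apply: len.
  apply: le_trans (_ : \sum_(i < n) w ((Q`_i)%:P * 'X^i) <= _).
    elim/big_ind2: _ => [|x1 x2 y1 y2 h1 h2|//]; first by rewrite w00.
    by apply: le_trans (wD _ _) _; rewrite lerD.
  rewrite -mulrA [_ * gabs Q]mulrC mulrA mulr_sumr; apply: ler_sum => i _.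
  by rewrite wM wC ler_wpM2r // ler_pdivlMl // hc.
have wle1 P : w P <= gabs P.
  apply: (@le_of_expr_le _ (c^-1 * \sum_(i < n) w ('X ^+ i))); rewrite ?gabs_ge0 // => m.
  rewrite -wX -gabsX; apply: le_trans (wle _) _.
  rewrite -[leRHS]mulrA; apply: ler_wpM2l.
    by rewrite mulr_ge0 ?invr_ge0 ?(ltW c0) ?sumr_ge0.
  by rewrite ler_peMl ?gabs_ge0 // ler1n.
move=> P; apply/eqP; rewrite eq_le wle1 /=.
have [|] := boolP (g %| P); first by rewrite -gabs_eq0 => /eqP ->.
rewrite -irredp_coprime // => /Bezout_eq1_coprimepP [[u v] /= e].
have gv : gabs (v * P) = 1.
  rewrite -gabs1; apply: gabs_eqmod.
  by rewrite -e opprD addrCA subrr addr0 dvdpNr dvdp_mull.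
have wv : 1 <= w (v * P).
  have -> : 1 = w 1 by rewrite wC abs1.
  by rewrite -e; apply: le_trans (wD _ _) _; rewrite wgM add0r.
rewrite wM in wv; rewrite gabsM in gv.
have vp : 0 < gabs v.
  by rewrite lt0r gabs_ge0 andbT; apply/eqP => h; move: gv; rewrite h mul0r => /eqP; rewrite eq_sym oner_eq0.
have := wle1 v; have := w0 P; have := w0 v.
move: (w v) (w P) (gabs v) (gabs P) wv gv vp => x y s t h1 h2 h3 h4 h5 h6.
rewrite -(ler_pM2l h3) h2; apply: le_trans h1 _; exact: ler_wpM2r.
Qed.

(** With [gabs_le_coef], this gives the continuity of the seminorm in the
    coefficients. *)
Lemma gabs_dist P Q : gabs P - gabs Q <= gabs (P - Q).
Proof. by rewrite lerBlDr -{1}[P](subrK Q) gabsD. Qed.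

Lemma gabs_le_coef P (M : R) m : (size P <= m)%N -> (forall i, a P`_i <= M) ->
  gabs P <= M * \sum_(i < m) gabs 'X^i.
Proof.
move=> sP hM.
have -> : P = \sum_(i < m) (P`_i)%:P * 'X^i.
  under eq_bigr do rewrite mul_polyC; rewrite -(poly_def m (fun i => P`_i)).
  apply/polyP => l; rewrite coef_poly; case: ltnP => // nl.
  by rewrite nth_default //; apply: leq_trans nl.
apply: le_trans (_ : \sum_(i < m) gabs ((P`_i)%:P * 'X^i) <= _).
  elim/big_ind2: _ => [|x1 x2 y1 y2 h1 h2|//]; first by rewrite gabsC abs0.
  by apply: le_trans (gabsD _ _) _; rewrite lerD.
rewrite mulr_sumr; apply: ler_sum => i _.
by rewrite gabsM gabsC ler_wpM2r ?gabs_ge0.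
Qed.

End ExtendAbs.

(** * Compactness in completions *)

Definition totally_bounded (R : realType) (F : fieldType) (a : absValue R F) :=
  forall B e : R, 0 < e -> exists s : seq F,
    forall x, a x <= B -> exists2 y, y \in s & a (x - y) < e.

(** An ultrafilter chooses one of finitely many cases. *)
Lemma ultra_has (G : set_system nat) (F : eqType) (s : seq F) (P : F -> nat -> Prop) :
  UltraFilter G -> (forall n, exists2 y, y \in s & P y n) ->
  exists2 y, y \in s & G [set n | P y n]%classic.
Proof.
move=> GU; elim: s => [/(_ 0%N) [] //|y s IH] h.
suff H (A : set nat) : (forall n, A n -> exists2 y, y \in s & P y n) -> G A ->
    exists2 y, y \in s & G [set n | P y n]%classic.
  have [hy|hy] := in_ultra_setVsetC [set n | P y n]%classic GU.
    by exists y => //; apply: mem_head.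
  have [n /= hn|z zs Gz] := H _ _ hy; last by exists z; rewrite // in_cons zs orbT.
  have [z] := h n; rewrite in_cons => /orP [/eqP -> // | zs Pz].
  by exists z.
move=> {IH h}; elim: s A => [|z s IH] A hA GA.
  by have [n /hA [] //] := @filter_ex _ _ _ _ GA.
have [hz|hz] := in_ultra_setVsetC [set n | P z n]%classic GU.
  by exists z => //; apply: mem_head.
have [|w ws Gw] := IH (A `&` ~` [set n | P z n])%classic _ (filterI GA hz); last first.
  by exists w; rewrite // in_cons ws orbT.
by move=> n /= [/hA [w]]; rewrite in_cons => /orP [/eqP -> // | ws Pw] _; exists w.
Qed.

(** An ultrafilter chooses a centre of radius 1/(m+1) for every m; the centres
    form a Cauchy sequence in the base field, whose class is the limit. *)
Lemma completion_bounded_compact (R : realType) (F : fieldType) (a : absValue R F) :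
  totally_bounded a -> bounded_compact (completion_abs a).
Proof.
move=> tb G GU u [B hB]; pose dd (m : nat) : R := m.+1%:R^-1.
have dd0 m : 0 < dd m by rewrite invr_gt0 ltr0n.
have H m : exists y : F, G [set n | completion_abs a (u n - cemb a y) < dd m]%classic.
  have e0 : 0 < dd m / 2 by rewrite divr_gt0.
  have [s hs] := tb (B + dd m / 2) _ e0.
  have [n|y _ Gy] := @ultra_has G F s
      (fun y n => completion_abs a (u n - cemb a y) < dd m) GU; last by exists y.
  have [x hx] := completion_dense (u n) e0.
  have [|y ys hy] := hs x.
    have := absD (completion_abs a) (cemb a x - u n) (u n).
    rewrite subrK completion_abs_emb => h.
    by rewrite abs_distC in hx; have := hB n; lra.
  exists y => //; have := abs_triangle (completion_abs a) (cemb a x) (u n) (cemb a y).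
  by rewrite completion_abs_dist; lra.
have [r hr] := choice H.
have inv_small (e : R) : 0 < e -> exists N : nat, forall m, (N <= m)%N -> dd m < e.
  move=> e0; exists (Num.truncn e^-1).+1 => m hm.
  rewrite /dd invf_plt ?posrE //; apply: lt_le_trans (truncnS_gt _) _.
  by rewrite ler_nat leqW.
have cr : cauchy_for a r.
  move=> e e0; have e2 : 0 < e / 2 by rewrite divr_gt0.
  have [N hN] := inv_small _ e2; exists N => m n hm hn.
  have [t []] := @filter_ex _ _ _ _ (filterI (hr m) (hr n)); rewrite /mkset => h1 h2.
  have := abs_triangle (completion_abs a) (u t) (cemb a (r m)) (cemb a (r n)).
  rewrite completion_abs_dist [completion_abs a (cemb a (r m) - _)]abs_distC.
  by have := hN _ hm; have := hN _ hn; lra.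
exists (cmk a r) => e e0; have e2 : 0 < e / 2 by rewrite divr_gt0.
have [N hN] := inv_small _ e2; have [N' hN'] := completion_lim cr e2.
pose m := maxn N N'; apply: filterS (hr m) => t; rewrite /mkset => ht.
have := abs_triangle (completion_abs a) (cemb a (r m)) (u t) (cmk a r).
have := hN m (leq_maxl _ _); have := hN' m (leq_maxr _ _); lra.
Qed.

(** * Primitive elements *)

(** A presentation of a number field as the quotient of [{poly rat}] by an
    irreducible polynomial. *)
Record primitive_data (K : fieldExtType rat) := PrimitiveData {
  prim : K;
  prim_poly : {poly rat};
  prim_poly_monic : prim_poly \is monic;
  prim_poly_irred : irreducible_poly prim_poly;
  prim_poly_sep : separable_poly prim_poly;
  prim_surj : forall x : K, exists P, x = horner_alg prim P;
  prim_ker : forall P, (horner_alg prim P == 0) = (prim_poly %| P);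
  prim_deg : \dim {:K} = (size prim_poly).-1
}.

Lemma primitive_data_of (K : fieldExtType rat) : primitive_data K.
Proof.
have sepK : separable 1 {:K}.
  apply/separableP => y _; apply: pcharf0_separable => p.
  by rewrite pchar_lalg pchar_num.
have := eq_adjoin_separable_generator sepK (sub1v _).
set z := separable_generator _ _ => Kz.
have /polyOver1P /cid [f fE] := minPolyOver 1 z.
have fm : f \is monic by rewrite -(map_monic (in_alg K)) -fE monic_minPoly.
have sf : size f = (adjoin_degree 1 z).+1 by rewrite -(size_map_poly (in_alg K)) -fE size_minPoly.
have ker P : (horner_alg z P == 0) = (f %| P).
  apply/eqP/idP => [h|/dvdpP [Q ->]].
    rewrite -(dvdp_map (in_alg K)) -fE; apply: minPoly_dvdp.
      by apply/polyOver1P; exists P.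
    exact/rootP.
  rewrite rmorphM /= (_ : horner_alg z f = 0) ?mulr0 //.
  by apply/rootP; rewrite -fE; apply: root_minPoly.
have f1 : (1 < size f)%N by rewrite sf ltnS adjoin_degreeE divn_gt0 ?adim_gt0 ?dimvS ?subv_adjoin.
exists z f => //.
- split=> // q q1 qf.
  have qm : map_poly (in_alg K) q \is a polyOver 1%VS by apply/polyOver1P; exists q.
  have : map_poly (in_alg K) q %| minPoly 1 z by rewrite fE dvdp_map.
  case/(minPoly_irr qm)/orP; first by rewrite fE eqp_map.
  by rewrite -size_poly_eq1 size_map_poly (negPf q1).
- rewrite -(separable_map (in_alg K)) -fE.
  by have /separableP /(_ z (memvf z)) := sepK.
- move=> x; have : x \in <<1; z>>%VS by rewrite -Kz memvf.
  by case/Fadjoin1_polyP => P ->; exists P.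
- by rewrite Kz dim_Fadjoin dimv1 muln1 sf.
Qed.

(** * Places of a number field above a place of the rationals *)

Definition place_above (R : realType) (K : fieldExtType rat) (a : rat -> R) (v : K -> R) :=
  is_absolute_value v /\ forall q : rat, v q%:A = a q.

Definition to_absValue (R : realType) (K : fieldExtType rat) (v : K -> R)
    (hv : is_absolute_value v) : absValue R K :=
  let: And4 h1 h2 h3 h4 := hv in AbsValue h1 h2 h3 h4.

Lemma to_absValueE (R : realType) (K : fieldExtType rat) (v : K -> R)
  (hv : is_absolute_value v) : to_absValue hv = v :> (K -> R).
Proof. by case: hv. Qed.

Section CompletionMap.
Variables (R : realType) (F K : fieldType) (a : absValue R F) (w : absValue R K).
Variable i : {rmorphism F -> K}.
Hypothesis wi : forall x, w (i x) = a x.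

(** The map induced on completions by an embedding of valued fields. *)
Definition cmap (x : completion a) : completion w := cmk w (fun n => i (crep x n)).

Lemma cauchy_map s : cauchy_for a s -> cauchy_for w (fun n => i (s n)).
Proof.
move=> cs e e0; have [n0 h] := cs e e0; exists n0 => m n hm hn.
by rewrite -rmorphB wi; apply: h.
Qed.

Lemma cmap_cmk s : cauchy_for a s -> cmap (cmk a s) = cmk w (fun n => i (s n)).
Proof.
move=> cs; apply/cmkP; do ?[exact: cauchy_map | exact/cauchy_map/crep_cauchy].
move=> e e0; have [n0 h] := nullN (crep_cmk cs) e0; exists n0 => n hn.
by rewrite -rmorphB wi; have := h n hn; rewrite opprB.
Qed.

Lemma cmap_is_zmod : zmod_morphism cmap.
Proof.
move=> x y; have [s cs ->] := cmkW x; have [t ct ->] := cmkW y.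
rewrite -cmkN // -cmkD //; last exact: cauchyN.
rewrite !cmap_cmk //; last by apply: cauchyD => //; apply: cauchyN.
rewrite -cmkN -?cmkD; do ?[exact: cauchy_map | exact/cauchyN/cauchy_map].
by congr cmk; apply/funext => n; rewrite rmorphB.
Qed.

Lemma cmap_is_monoid : monoid_morphism cmap.
Proof.
split=> [|x y].
  by rewrite /= -[1]/(cmk a (fun=> 1)) cmap_cmk ?rmorph1 //; apply: cauchy_cst.
have [s cs ->] := cmkW x; have [t ct ->] := cmkW y.
rewrite -cmkM // !cmap_cmk //; last exact: cauchyM.
rewrite -cmkM; do ?[exact: cauchy_map].
by congr cmk; apply/funext => n; rewrite rmorphM.
Qed.

Definition cmapr : {rmorphism completion a -> completion w} :=
  HB.pack_for {rmorphism completion a -> completion w} cmap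
    (GRing.isZmodMorphism.Build _ _ cmap cmap_is_zmod)
    (GRing.isMonoidMorphism.Build _ _ cmap cmap_is_monoid).

Lemma cmap_emb x : cmapr (cemb a x) = cemb w (i x).
Proof. by rewrite /= cmap_cmk //; apply: cauchy_cst. Qed.

Lemma cmap_abs x : completion_abs w (cmapr x) = completion_abs a x.
Proof.
rewrite !completion_absE; apply: cabs_eq; first exact/cauchy_map/crep_cauchy.
by move=> e e0; have [n0 h] := cabsP x e0; exists n0 => n hn; rewrite wi h.
Qed.

End CompletionMap.

Section Places.
Variables (R : realType) (a : absValue R rat) (K : fieldExtType rat).
Hypothesis tb : totally_bounded a.
Variable D : primitive_data K.

Local Notation k := (completion a).
Local Notation ka := (completion_abs a).
Local Notation emb := (cemb a).
Local Notation th := (prim D).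
Local Notation f0 := (prim_poly D).
Local Notation ev := (horner_alg th).
Local Notation "P ^e" := (map_poly (cemb a) P) (at level 2, format "P ^e").

Let BC : bounded_compact ka := completion_bounded_compact tb.

Lemma ka_emb q : ka (emb q) = a q. Proof. exact: completion_abs_emb. Qed.

(** The factors are distinct because the defining polynomial is separable. *)
Lemma local_factors_exist : exists gs : seq {poly k},
  [/\ forall g, g \in gs -> g \is monic /\ irreducible_poly g, uniq gs
    & f0^e = \prod_(g <- gs) g].
Proof.
have fm : f0^e \is monic by rewrite map_monic prim_poly_monic.
have [gs [hgs fgs]] := monic_irred_factorization fm.
exists gs; split=> //.
have sepf : separable_poly f0^e by rewrite separable_map prim_poly_sep.
have : forall s t, gs = s ++ t -> uniq t.
  move=> s t; elim: t s => [//|g t IH] s gst /=.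
  rewrite (IH (rcons s g)) ?cat_rcons // andbT; apply/negP => gt.
  have [gm gi] : g \is monic /\ irreducible_poly g by apply: hgs; rewrite gst mem_cat mem_head orbT.
  have : ~~ (g ^+ 2 %| f0^e) by rewrite (@separable_nosquare _ _ g 2 sepf) // neq_ltn (irredp_size gi) orbT.
  rewrite fgs gst big_cat big_cons /= (big_rem g gt) /=.
  by move/negP; apply; apply: dvdp_mull; rewrite mulrA -expr2 dvdp_mulr.
by move/(_ [::] gs erefl).
Qed.

(** The factors of the defining polynomial over the completion, which index
    the places above [a]. *)
Definition local_factors : seq {poly k} := sval (cid local_factors_exist).

Lemma local_factorsP : [/\ forall g, g \in local_factors -> g \is monic /\ irreducible_poly g,
  uniq local_factors & f0^e = \prod_(g <- local_factors) g].
Proof. exact: svalP (cid local_factors_exist). Qed.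

Lemma lf_monic g : g \in local_factors -> g \is monic.
Proof. by case: local_factorsP => h _ _ /h []. Qed.

Lemma lf_irred g : g \in local_factors -> irreducible_poly g.
Proof. by case: local_factorsP => h _ _ /h []. Qed.

Lemma lf_dvd g : g \in local_factors -> g %| f0^e.
Proof.
case: local_factorsP => _ _ -> gin.
by rewrite (big_rem g gin) /= dvdp_mulr.
Qed.

Definition polyof (x : K) : {poly rat} := sval (cid (prim_surj D x)).

Lemma polyofK x : ev (polyof x) = x.
Proof. by rewrite /polyof; case: cid => P /= ->. Qed.

(** The element [x] of [K] is sent to the quotient of the polynomials over the
    completion by [g], where [gabs] extends [a]. *)
Definition lplace (g : {poly k}) (x : K) : R := gabs ka g (polyof x)^e.

Lemma lplaceE g P : g \in local_factors -> lplace g (ev P) = gabs ka g P^e.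
Proof.
move=> gin; apply: gabs_eqmod; first exact: lf_monic.
  exact: lf_irred.
apply: dvdp_trans (lf_dvd gin) _; rewrite -rmorphB /= dvdp_map -prim_ker.
by rewrite rmorphB /= polyofK subrr.
Qed.

Lemma lplace_above g : g \in local_factors -> place_above a (lplace g).
Proof.
move=> gin; have gm := lf_monic gin; have gi := lf_irred gin.
have alg q : lplace g q%:A = a q.
  rewrite (_ : q%:A = ev q%:P) ?lplaceE ?horner_algC //.
  by rewrite map_polyC /= gabsC // ka_emb.
split=> //; split=> [x|x|x y|x y].
- exact: gabs_ge0.
- split=> [/eqP|->]; last by rewrite -[0](scale0r 1) alg abs0.
  rewrite gabs_eq0 // => gx; apply: contrapT => /eqP x0.
  have [y xy] : exists y, x * y = 1 by exists x^-1; rewrite divff.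
  have : gabs ka g (polyof x * polyof y)^e = 1.
    rewrite -lplaceE // rmorphM /= !polyofK xy.
    by rewrite -[1](scale1r (1 : K)) alg abs1.
  rewrite rmorphM /= gabsM // => h.
  have /eqP gx0 : gabs ka g (polyof x)^e == 0 by rewrite gabs_eq0.
  by move/eqP: h; rewrite gx0 mul0r eq_sym oner_eq0.
- by rewrite -{1}[x]polyofK -{1}[y]polyofK -rmorphM lplaceE // rmorphM /= gabsM.
- by rewrite -{1}[x]polyofK -{1}[y]polyofK -rmorphD lplaceE // rmorphD /= gabsD.
Qed.

Lemma poly_approx (P : {poly k}) (e : R) : 0 < e -> exists Q : {poly rat},
  (size (P - Q^e)%R <= size P)%N /\ forall i, ka (P - Q^e)`_i <= e.
Proof.
move=> e0; have [q hq] := choice (fun z : k => completion_dense z e0).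
pose Q := \poly_(i < size P) q P`_i; exists Q; split=> [|i].
  apply: leq_trans (size_polyD _ _) _; rewrite size_polyN geq_max leqnn /=.
  by rewrite size_map_poly size_poly.
rewrite coefB coef_map /= coef_poly; case: ltnP => h; first exact/ltW/hq.
have -> : emb 0 = 0 by exact: (rmorph0 (cemb a : {rmorphism rat -> k})).
by rewrite subr0 nth_default // abs0 ltW.
Qed.

(** A rational approximation of [g] is small at the place of [g]; were the
    place of [g'] the same, [g] itself would be small there, so 0, and [g']
    would divide [g]. *)
Lemma lplace_inj g g' : g \in local_factors -> g' \in local_factors ->
  lplace g = lplace g' -> g = g'.
Proof.
move=> gin gin' e.
have [gm gi gm' gi'] := And4 (lf_monic gin) (lf_irred gin) (lf_monic gin') (lf_irred gin').
apply/esym/monic_irredp_eq => //; rewrite -(@gabs_eq0 _ _ ka) //.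
rewrite eq_le gabs_ge0 andbT leNgt; apply/negP => h0.
pose S := \sum_(i < size g) gabs ka g 'X^i + \sum_(i < size g) gabs ka g' 'X^i.
have S0 : 0 <= S by apply: addr_ge0; apply: sumr_ge0 => i _; apply: gabs_ge0.
pose ep := gabs ka g' g / (2 * (S + 1)).
have S2 : 0 < 2 * (S + 1) by lra.
have ep0 : 0 < ep by rewrite divr_gt0.
have epS : ep * (2 * (S + 1)) = gabs ka g' g by rewrite divfK // gt_eqF.
have [Q [sQ hQ]] := poly_approx g ep0.
have h1 := gabs_le_coef BC gm gi sQ hQ; have h2 := gabs_le_coef BC gm' gi' sQ hQ.
have h3 := gabs_dist BC gm' gi' g Q^e.
have h4 := gabs_dist BC gm gi Q^e g.
have gg : gabs ka g g = 0 by apply/eqP; rewrite gabs_eq0.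
have h5 : gabs ka g (Q^e - g) = gabs ka g (g - Q^e).
  by rewrite -opprB -mulN1r gabsM -polyCN gabsC // absN abs1 mul1r.
have h6 : gabs ka g Q^e = gabs ka g' Q^e by rewrite -(@lplaceE g Q gin) -(@lplaceE g' Q gin') e.
have h7 : gabs ka g' g <= ep * S by rewrite /S mulrDr; lra.
have : ep * (2 * (S + 1)) = 2 * (ep * S) + 2 * ep by ring.
have := mulr_ge0 (ltW ep0) S0; lra.
Qed.

(** A place above [a] embeds the completion of the rationals in that of [K],
    where the primitive element is a root of one of the factors [g];
    evaluation at it is a seminorm that kills [g], to which uniqueness
    applies. *)
Lemma lplace_surj (v : K -> R) : place_above a v ->
  exists2 g, g \in local_factors & v = lplace g.
Proof.
move=> [hv va]; pose w := to_absValue hv.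
have wE : w = v :> (K -> R) := to_absValueE hv.
have wa q : w (in_alg K q) = a q by rewrite wE /= va.
pose j := cmapr wa; pose phi P := (map_poly j P).[cemb w th].
have jabs x : completion_abs w (j x) = ka x := cmap_abs wa x.
have jemb q : j (emb q) = cemb w (in_alg K q) := cmap_emb wa q.
have phiE P : phi P^e = cemb w (ev P).
  rewrite /phi -map_poly_comp -horner_map -map_poly_comp.
  by congr horner; apply: eq_map_poly => q /=; rewrite -jemb.
pose om P := completion_abs w (phi P).
have phiM P Q : phi (P * Q) = phi P * phi Q by rewrite /phi rmorphM hornerM.
have phiD P Q : phi (P + Q) = phi P + phi Q by rewrite /phi rmorphD hornerD.
have phiC c : phi c%:P = j c by rewrite /phi map_polyC hornerC.
have [g gin g0] : exists2 g, g \in local_factors & phi g = 0.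
  have : phi (\prod_(g <- local_factors) g) = 0.
    case: local_factorsP => _ _ <-; rewrite phiE (_ : ev f0 = 0) ?rmorph0 //.
    by apply/eqP; rewrite prim_ker.
  have phi1 : phi 1 = 1 by rewrite phiC rmorph1.
  rewrite (big_morph phi phiM phi1) => /eqP; rewrite prodf_seq_eq0.
  by case/hasP => g gin /= /eqP; exists g.
exists g => //; apply/funext => x.
have := @gabs_unique _ _ ka BC g (lf_monic gin) (lf_irred gin) om.
rewrite /om /lplace => <-; first by rewrite phiE polyofK completion_abs_emb wE.
- by move=> P; apply: abs_ge0.
- by move=> P Q; rewrite phiM absM.
- by move=> P Q; rewrite phiD absD.
- by move=> c; rewrite phiC jabs.
- by rewrite g0 abs0.
Qed.

End Places.

(** * Degrees and norms *)

Lemma pnorm_map (k L : fieldType) (f : {rmorphism k -> L}) (g P : {poly k}) :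
  g \is monic -> (1 < size g)%N ->
  pnorm (map_poly f g) (map_poly f P) = f (pnorm g P).
Proof.
move=> gm g1; rewrite /pnorm -det_map_mx map_horner_mx -[RHS]expr1.
apply: det_horner_mx_exp.
by rewrite expr1 -map_char_poly !char_poly_cmx ?map_monic ?size_map_poly.
Qed.

Lemma degree_prod (k : fieldType) (gs : seq {poly k}) :
  (forall g, g \in gs -> g \is monic) ->
  (size (\prod_(g <- gs) g)%R).-1 = (\sum_(g <- gs) (size g).-1)%N.
Proof.
elim: gs => [|g gs IH] h; first by rewrite !big_nil size_poly1.
have hs g' : g' \in gs -> g' \is monic by move=> gin; apply: h; rewrite in_cons gin orbT.
have gm : g \is monic by apply: h; apply: mem_head.
have pm : \prod_(j <- gs) j \is monic by rewrite big_seq; apply: monic_prod => j /hs.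
rewrite !big_cons -IH // size_monicM ?monic_neq0 //.
have := monic_neq0 gm; have := monic_neq0 pm; rewrite -!size_poly_gt0.
by move: (size _) (size _) => x y; lia.
Qed.

Section PlaceDegrees.
Variables (R : realType) (a : absValue R rat) (K : fieldExtType rat).
Hypothesis tb : totally_bounded a.
Variable D : primitive_data K.

Local Notation k := (completion a).
Local Notation ka := (completion_abs a).
Local Notation emb := (cemb a).
Local Notation th := (prim D).
Local Notation f0 := (prim_poly D).
Local Notation ev := (horner_alg th).
Local Notation "P ^e" := (map_poly (cemb a) P) (at level 2, format "P ^e").
Local Notation lf := (local_factors a D).
Let BC : bounded_compact ka := completion_bounded_compact tb.

Lemma lf_size g : g \in lf -> (1 < size g)%N.
Proof. by move=> /lf_irred /irredp_size. Qed.

Lemma lf_ok g : g \in lf -> g \is monic /\ (1 < size g)%N.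
Proof. by move=> gin; split; [exact: lf_monic gin | exact: lf_size gin]. Qed.

Lemma lf_neq_nil : lf != [::].
Proof.
have [_ _ fE] := local_factorsP a D; apply/eqP => h; move: fE; rewrite h big_nil => f1.
have := irredp_size (prim_poly_irred D).
by rewrite -(size_map_poly emb) f1 size_poly1.
Qed.

(** The norm of [x] down to the rationals. *)
Definition qnorm (x : K) : rat := pnorm f0 (polyof D x).

Lemma qnorm_eq0 x : (qnorm x == 0) = (x == 0).
Proof.
rewrite /qnorm pnorm_eq0 ?prim_poly_monic //; last exact: prim_poly_irred.
by rewrite -prim_ker polyofK.
Qed.

(** The absolute value of the norm at the place of [g] is a power of [lplace],
    and norms multiply over the factors of the defining polynomial. *)
Lemma prod_lplace x :
  \prod_(g <- lf) lplace D g x ^+ (size g).-1 = a (qnorm x).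
Proof.
have [_ _ fE] := local_factorsP a D.
rewrite -(ka_emb a) /qnorm -pnorm_map ?prim_poly_monic //; last exact/irredp_size/prim_poly_irred.
rewrite fE pnorm_prod ?lf_neq_nil //; last by move=> g gin; apply: lf_ok gin.
rewrite abs_prod big_seq [RHS]big_seq; apply: eq_bigr => g gin.
by rewrite /lplace gabsXn; do ?[exact: lf_monic gin | exact: lf_irred gin].
Qed.

Lemma sum_lf_degree : (\sum_(g <- lf) (size g).-1)%N = \dim {:K}.
Proof.
have [_ _ fE] := local_factorsP a D.
rewrite (prim_deg D) -degree_prod -?fE ?size_map_poly //.
by move=> g gin; apply: lf_monic gin.
Qed.

(** A spanning family with [n] elements and an independent one with [m]
    elements in the completion: if [n < m], the [m] by [n] matrix of
    coordinates has a nonzero kernel vector, whose entries are represented by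
    Cauchy sequences [r] that contradict independence. *)
Lemma local_basis_le (v : K -> R) n m (b : 'I_n -> nat -> K) (b' : 'I_m -> nat -> K) :
  place_above a v -> local_basis v b -> local_basis v b' -> (m <= n)%N.
Proof.
move=> [hv va] [cb sb _] [cb' _ ib']; rewrite leqNgt; apply/negP => nm.
pose w := to_absValue hv; have wE : w = v :> (K -> R) := to_absValueE hv.
have restr : restr_rat v = a by apply/funext => q; rewrite /restr_rat va.
have H j : exists c : 'I_n -> nat -> rat, (forall i, cauchy_for a (c i)) /\
    null_for v (fun t => b' j t - \sum_i c i t *: b i t).
  by have [c hc nc] := sb _ (cb' j); exists c; split=> // i; rewrite -restr.
have [c hc] := choice H.
pose M : 'M[k]_(m, n) := \matrix_(j, i) cmk a (c j i).
have kn : kermx M != 0.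
  rewrite -mxrank_eq0 mxrank_ker subn_eq0 -ltnNge.
  by apply: leq_ltn_trans (rank_leq_col M) nm.
have [l l0 lM] : exists2 l : 'rV[k]_m, l != 0 & l *m M = 0.
  have /rowV0Pn [l lK l0] := kn; exists l => //.
  by apply/eqP; rewrite -sub_kermx.
pose r j := crep (l 0 j).
have cr j : cauchy_for a (r j) := crep_cauchy _.
have cmk_sumE (I : Type) (s : seq I) (u : I -> nat -> rat) :
    (forall i, cauchy_for a (u i)) ->
    cmk a (fun t => \sum_(i <- s) u i t) = \sum_(i <- s) cmk a (u i).
  move=> hu; elim: s => [|i s IH].
    by rewrite big_nil; congr cmk; apply/funext => t; rewrite big_nil.
  rewrite big_cons -IH -cmkD ?hu //; last exact: cauchy_sum.
  by congr cmk; apply/funext => t; rewrite big_cons.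
have ncoef i : null_for a (fun t => \sum_j r j t * c j i t).
  have cc : cauchy_for a (fun t => \sum_j r j t * c j i t).
    by apply: cauchy_sum => j; apply: cauchyM => //; case: (hc j).
  apply/(cmk_eq0 cc); rewrite cmk_sumE; last first.
    by move=> j; apply: cauchyM => //; case: (hc j).
  transitivity ((l *m M) 0 i); last by rewrite lM mxE.
  rewrite mxE.
  apply: eq_bigr => j _.
  by rewrite mxE cmkM ?cmkK //; case: (hc j).
have calg s : cauchy_for a s -> cauchy_for w (fun t => (s t)%:A).
  move=> cs e e0; have [n0 h] := cs e e0; exists n0 => x y hx hy.
  by rewrite -scalerBl wE va; apply: h.
have nalg s : null_for a s -> null_for w (fun t => (s t)%:A).
  move=> ns e e0; have [n0 h] := ns e e0; exists n0 => x hx.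
  by rewrite wE va; apply: h.
have key : null_for v (fun t => \sum_j r j t *: b' j t).
  have n1 : null_for w (fun t => \sum_j (r j t)%:A * (b' j t - \sum_i c j i t *: b i t)).
    apply: null_sum => j; apply: nullM; first exact: calg.
    by rewrite wE; case: (hc j).
  have n2 : null_for w (fun t => \sum_i b i t * (\sum_j r j t * c j i t)%:A).
    apply: null_sum => i; apply: nullM; first by rewrite wE.
    exact: nalg.
  have := nullD n1 n2; rewrite wE; congr null_for; apply/funext => t.
  have -> : \sum_i b i t * (\sum_j r j t * c j i t)%:A =
            \sum_j r j t *: \sum_i c j i t *: b i t.
    under eq_bigr => i _ do rewrite scaler_suml mulr_sumr.
    rewrite exchange_big; apply: eq_bigr => j _; rewrite scaler_sumr.
    by apply: eq_bigr => i _; rewrite mulr_algr scalerA.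
  rewrite -big_split; apply: eq_bigr => j _ /=.
  by rewrite mulr_algl scalerBr subrK.
have := ib' r; rewrite restr => /(_ cr key) hr.
move/eqP: l0; apply; apply/rowP => j; rewrite mxE -[LHS]cmkK.
by apply/(cmk_eq0 (cr j)).
Qed.

(** The powers of the primitive element are a basis of [k[X]/(g)] over [k],
    and the comparison of [gabs] with coefficients turns Cauchy and null
    sequences into coefficientwise ones. Coefficients in [k] are approximated
    by rationals. *)
Lemma lplace_local_basis g : g \in lf ->
  local_basis (lplace D g) (fun (i : 'I_(size g).-1) (_ : nat) => th ^+ i).
Proof.
move=> gin; have gm := lf_monic gin; have gi := lf_irred gin; have g1 := lf_size gin.
have [va0 va] := lplace_above tb gin; pose w := to_absValue va0.
have wE : w = lplace D g :> (K -> R) := to_absValueE va0.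
have restr : restr_rat (lplace D g) = a by apply/funext => q; rewrite /restr_rat va.
set n := (size g).-1.
have ng : (n < size g)%N by rewrite /n prednK // ltnW.
have [c c0 hc] := gabs_lower BC gm gi; have [C C0 hC] := gabs_upper ka gm gi.
have comb (q : 'I_n -> rat) : lplace D g (\sum_i q i *: th ^+ i) =
    gabs ka g (\sum_i emb (q i) *: 'X^i).
  have -> : \sum_i q i *: th ^+ i = ev (\sum_i q i *: 'X^i).
    by rewrite rmorph_sum; apply: eq_bigr => i _; rewrite -mul_polyC rmorphM /= horner_algC rmorphXn /= horner_algX mulr_algl.
  rewrite lplaceE // rmorph_sum; congr gabs; apply: eq_bigr => i _.
  by rewrite /= map_polyZ /= map_polyXn.
have sumX (z : 'I_n -> k) (i : 'I_n) : (\sum_i z i *: 'X^i)`_i = z i.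
  rewrite coef_sum (bigD1 i) //= coefZ coefXn eqxx mulr1 big1 ?addr0 // => j ji.
  by rewrite coefZ coefXn eq_sym (_ : (_ == _) = false) ?mulr0 //; apply/negbTE.
have sumXs (z : 'I_n -> k) : (size (\sum_i z i *: 'X^i)%R < size g)%N.
  apply: leq_ltn_trans ng; apply: leq_trans (size_sum _ _ _) _.
  apply/bigmax_leqP => i _; apply: leq_trans (size_scale_leq _ _) _.
  by rewrite size_polyXn ltn_ord.
split=> [i|s cs|q cq nq i].
- by rewrite -wE; apply: cauchy_cst.
- pose p t : {poly k} := (polyof D (s t))^e %% g.
  have pdist x y i : c * ka ((p x)`_i - (p y)`_i) <= lplace D g (s x - s y).
    rewrite -coefB; have -> : p x - p y = (polyof D (s x) - polyof D (s y))^e %% g.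
      by rewrite rmorphB /= modpD modpN.
    apply: le_trans (hc _ (size_modg gm _) i) _.
    by rewrite gabs_modp // -(lplaceE _ gin) rmorphB /= !polyofK.
  have dd0 t : 0 < t.+1%:R^-1 :> R by rewrite invr_gt0 ltr0n.
  have H (it : 'I_n * nat) := completion_dense (p it.2)`_it.1 (dd0 it.2).
  have [q hq] := choice H.
  have small (e : R) : 0 < e -> exists N : nat, forall m, (N <= m)%N -> m.+1%:R^-1 < e.
    move=> e0; exists (Num.truncn e^-1).+1 => m hm.
    rewrite invf_plt ?posrE //; apply: lt_le_trans (truncnS_gt _) _.
    by rewrite ler_nat leqW.
  exists (fun i t => q (i, t)).
    move=> i; rewrite restr => e e0; have e4 : 0 < e / 4 by rewrite divr_gt0.
    have [N hN] := small _ e4.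
    have ec : 0 < c * (e / 4) by rewrite mulr_gt0.
    have [N' hN'] := cs _ ec.
    exists (maxn N N') => x y; rewrite !geq_max => /andP [x1 x2] /andP [y1 y2].
    rewrite -ka_emb rmorphB.
    have h1 := pdist x y i; have h2 := hN' _ _ x2 y2.
    have h3 : ka ((p x)`_i - (p y)`_i) < e / 4.
      by rewrite -(ltr_pM2l c0); apply: le_lt_trans h1 h2.
    have h4 := hq (i, x); have h5 := hq (i, y); have h6 := hN _ x1; have h7 := hN _ y1.
    rewrite abs_distC /= in h4.
    have h8 := abs_triangle ka (p x)`_i (emb (q (i, x))) (emb (q (i, y))).
    have h9 := abs_triangle ka (p y)`_i (p x)`_i (emb (q (i, y))).
    rewrite /= in h5; move: h3 h4 h5 h6 h7 h8 h9.
    move: x.+1%:R^-1 y.+1%:R^-1 => dx dy; lra.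
  move=> e e0; have eC : 0 < e / C by rewrite divr_gt0.
  have [N hN] := small _ eC; exists N => t ht.
  have sE : s t - \sum_i q (i, t) *: th ^+ i = ev (polyof D (s t) - \sum_(i < n) q (i, t) *: 'X^i).
    rewrite rmorphB /= polyofK rmorph_sum; congr (_ - _).
    by apply: eq_bigr => i _; rewrite -mul_polyC rmorphM /= horner_algC rmorphXn /= horner_algX mulr_algl.
  rewrite sE lplaceE // rmorphB /= -(gabs_modp ka gm gi) modpD modpN -/(p t).
  have -> : (\sum_(i < n) q (i, t) *: 'X^i)^e = \sum_(i < n) emb (q (i, t)) *: 'X^i.
    by rewrite rmorph_sum; apply: eq_bigr => i _; rewrite /= map_polyZ /= map_polyXn.
  rewrite (modp_small (sumXs _)).
  have sP : (size (p t - \sum_(i < n) emb (q (i, t)) *: 'X^i)%R < size g)%N.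
    by apply: leq_ltn_trans (size_polyD _ _) _; rewrite size_polyN gtn_max size_modg ?sumXs.
  apply: (@le_lt_trans _ _ (C * t.+1%:R^-1)); last by rewrite mulrC -ltr_pdivlMr // hN.
  apply: (hC _ _ sP) => i; have [ni|iln] := ltnP i n; last first.
    rewrite nth_default ?abs0 ?ltW //; apply: leq_trans iln.
    by move: sP; rewrite -(prednK (ltnW g1)) ltnS.
  by rewrite coefB -[i]/(val (Ordinal ni)) sumX; apply/ltW/(hq (Ordinal ni, t)).
- rewrite restr => e e0; have ec : 0 < c * e by rewrite mulr_gt0.
  have [N hN] := nq _ ec; exists N => t ht.
  have h1 := hN t ht; rewrite comb in h1.
  have h2 := hc _ (sumXs (fun i => emb (q i t))) i; rewrite sumX ka_emb in h2.
  by rewrite -(ltr_pM2l c0); apply: le_lt_trans h2 h1.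
Qed.

Lemma local_degree_lplace g : g \in lf -> local_degree (lplace D g) = (size g).-1.
Proof.
move=> gin; have hb := lplace_local_basis gin; have hv := lplace_above tb gin.
apply: xget_unique; first by exists (fun i _ => th ^+ i).
move=> m [b hb']; apply/eqP; rewrite eqn_leq.
by rewrite (local_basis_le hv hb hb') (local_basis_le hv hb' hb).
Qed.

End PlaceDegrees.

(** * Places in extensions of number fields *)

Section ExtensionPlaces.
Variables (R : realType) (a : absValue R rat).
Hypothesis tb : totally_bounded a.
Variables (K K' : fieldExtType rat) (D : primitive_data K) (D' : primitive_data K').
Variable sigma : {rmorphism K -> K'}.

Local Notation k := (completion a).
Local Notation ka := (completion_abs a).
Local Notation emb := (cemb a).
Local Notation "P ^e" := (map_poly (cemb a) P) (at level 2, format "P ^e").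
Local Notation lf := (local_factors a D).
Local Notation lf' := (local_factors a D').
Let BC : bounded_compact ka := completion_bounded_compact tb.

Let S : {poly rat} := polyof D' (sigma (prim D)).

Lemma rmorph_in_alg (q : rat) : sigma q%:A = q%:A.
Proof.
have h1 := fmorph_eq_rat (sigma \o in_alg K : {rmorphism rat -> K'}) q.
by have h2 := fmorph_eq_rat (in_alg K' : {rmorphism rat -> K'}) q; rewrite /= in h1 h2; rewrite h1 h2.
Qed.

Lemma sigma_ev P : sigma (horner_alg (prim D) P) = horner_alg (prim D') (P \Po S).
Proof.
elim/poly_ind: P => [|P c IH]; first by rewrite comp_poly0 !rmorph0.
rewrite comp_polyD comp_polyM comp_polyX comp_polyC !rmorphD !rmorphM /= IH.
by rewrite horner_algX !horner_algC rmorph_in_alg polyofK.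
Qed.

Lemma factor_above h' : h' \in lf' -> exists2 h, h \in lf & h' %| h \Po S^e.
Proof.
move=> hin; have [_ _ fE] := local_factorsP a D.
have : h' %| (prim_poly D)^e \Po S^e.
  apply: dvdp_trans (lf_dvd hin) _; rewrite -map_comp_poly dvdp_map -prim_ker.
  by rewrite -sigma_ev (_ : horner_alg _ _ = 0) ?rmorph0 //; apply/eqP; rewrite prim_ker.
rewrite fE rmorph_prod => /(irredp_dvd_prod (lf_irred hin)) [h hlf hh].
by exists h.
Qed.

(** Composition with [S], which represents the image of the primitive element,
    sends the seminorm of [h'] to one that kills [h]. *)
Lemma lplace_restrict h' h : h' \in lf' -> h \in lf -> h' %| h \Po S^e ->
  lplace D' h' \o sigma = lplace D h.
Proof.
move=> hin' hin hh; have [hm' hi'] := (lf_monic hin', lf_irred hin').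
apply/funext => x /=.
have := @gabs_unique _ _ ka BC h (lf_monic hin) (lf_irred hin) (fun P => gabs ka h' (P \Po S^e)).
rewrite {2}/lplace => <-.
- by rewrite -{1}[x](polyofK D) sigma_ev lplaceE // map_comp_poly.
- by move=> P; apply: gabs_ge0.
- by move=> P Q; rewrite comp_polyM gabsM.
- by move=> P Q; rewrite comp_polyD gabsD.
- by move=> c; rewrite comp_polyC gabsC.
- by apply/eqP; rewrite gabs_eq0.
Qed.

Lemma lplace_restrictE h' g : h' \in lf' -> g \in lf ->
  (lplace D' h' \o sigma == lplace D g) = (h' %| g \Po S^e).
Proof.
move=> hin' gin; apply/eqP/idP => [e|]; last exact: lplace_restrict.
have [h hin hh] := factor_above hin'.
by rewrite -(lplace_inj tb hin gin) // -e (lplace_restrict hin' hin hh).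
Qed.

Lemma char_poly_S : exists e, char_poly (horner_mx (cmx (prim_poly D')) S) = prim_poly D ^+ e.
Proof.
apply: char_poly_irred_annihilator; first exact: prim_poly_monic.
  exact: prim_poly_irred.
have -> : horner_mx (horner_mx (cmx (prim_poly D')) S) (prim_poly D) =
          horner_mx (cmx (prim_poly D')) (prim_poly D \Po S).
  elim/poly_ind: (prim_poly D) => [|P c IH]; first by rewrite comp_poly0 !rmorph0.
  rewrite comp_polyD comp_polyM comp_polyX comp_polyC !rmorphD !rmorphM /= IH.
  by rewrite horner_mx_X !horner_mx_C.
have /dvdpP [Q ->] : prim_poly D' %| prim_poly D \Po S.
  by rewrite -prim_ker -sigma_ev (_ : horner_alg _ _ = 0) ?rmorph0 //; apply/eqP; rewrite prim_ker.
rewrite rmorphM /=.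
have := Cayley_Hamilton (cmx (prim_poly D')).
rewrite char_poly_cmx ?prim_poly_monic //; last exact/irredp_size/prim_poly_irred.
by move=> ->; rewrite mulr0.
Qed.

(** The degrees above a place are compared by taking norms of a polynomial
    that is 2 modulo one local factor and 1 modulo the other ones: both sides
    are powers of 2, with the degrees as exponents. *)
Lemma extension_degrees : exists e : nat, [/\ (0 < e)%N, (\dim {:K'} = e * \dim {:K})%N &
  forall g, g \in lf -> (\sum_(h' <- lf' | lplace D' h' \o sigma == lplace D g) (size h').-1
                         = e * (size g).-1)%N].
Proof.
have [e he] := char_poly_S.
have s1 := irredp_size (prim_poly_irred D); have s1' := irredp_size (prim_poly_irred D').
have deg : (\dim {:K'} = e * \dim {:K})%N.
  rewrite (prim_deg D) (prim_deg D').
  have := congr1 (fun p : {poly rat} => (size p).-1) he.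
  rewrite /= size_char_poly size_exp mulnC /= => <-.
  by move: s1'; case: (size _) => [|[]].
exists e; split=> //; first by rewrite lt0n; apply/eqP => e0; move: deg; rewrite e0 mul0n (prim_deg D'); move: s1'; case: (size _) => [|[]].
move=> g gin.
have normS Q : pnorm (prim_poly D')^e (Q \Po S^e) = pnorm (prim_poly D)^e Q ^+ e.
  set A := map_mx emb (cmx (prim_poly D')).
  have -> : pnorm (prim_poly D')^e (Q \Po S^e) = \det (horner_mx A (Q \Po S^e)).
    rewrite /pnorm -[RHS]expr1; apply: det_horner_mx_exp.
    rewrite expr1 -map_char_poly !char_poly_cmx ?map_monic ?size_map_poly //; exact: prim_poly_monic.
  have -> : horner_mx A (Q \Po S^e) = horner_mx (horner_mx A S^e) Q.
    elim/poly_ind: Q => [|P c IH]; first by rewrite comp_poly0 !rmorph0.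
    rewrite comp_polyD comp_polyM comp_polyX comp_polyC !rmorphD !rmorphM /= IH.
    by rewrite horner_mx_X !horner_mx_C.
  apply: det_horner_mx_exp; rewrite -map_horner_mx -map_char_poly he rmorphXn /=.
  by rewrite char_poly_cmx ?map_monic ?size_map_poly // prim_poly_monic.
have [_ lfu fE] := local_factorsP a D; have [_ _ fE'] := local_factorsP a D'.
pose G := \prod_(h <- rem g lf) h.
have gG : coprimep g G.
  rewrite irredp_coprime; last exact: lf_irred gin.
  apply/negP => /(irredp_dvd_prod (lf_irred gin)) [h].
  rewrite mem_rem_uniq // !inE => /andP [hg hin] gh.
  have := monic_irredp_eq (lf_monic gin) (lf_monic hin) (lf_irred gin) (lf_irred hin) gh.
  by move=> gE; rewrite gE eqxx in hg.
have [[v u] /= uv] := Bezout_eq1_coprimepP _ _ gG.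
have [two two2] : exists t : rat, t = 2 by exists 2.
(* By the Chinese remainder theorem, [Q] is 2 modulo [g] and 1 modulo the
   other factors. *)
pose c : k := emb two; pose Q : {poly k} := 1 + (c - 1) *: (u * G).
have Qg : Q - c%:P = - (c - 1) *: v * g.
  rewrite /Q; have -> : u * G = 1 - v * g by rewrite -uv addrC addKr.
  rewrite -!mul_polyC !rmorphN !rmorphB /= !rmorph1; ring.
have Q1 : Q - 1 = ((c - 1) *: u) * G by rewrite /Q addrC addKr -scalerAl.
have normQ : pnorm (prim_poly D)^e Q = c ^+ (size g).-1.
  rewrite fE pnorm_prod ?lf_neq_nil //; last by move=> h hin; apply: lf_ok hin.
  rewrite (big_rem g gin) /= [X in _ * X]big1_seq ?mulr1; last first.
    move=> h /= hin; rewrite -(pnorm1 h).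
    have hlf : h \in lf by apply: mem_rem hin.
    apply: pnorm_eqmod; [by case: (lf_ok hlf) | by case: (lf_ok hlf) | ].
    by rewrite Q1 dvdp_mull // /G (big_rem h hin) /= dvdp_mulr.
  rewrite -(pnormC _ (lf_size gin)); apply: pnorm_eqmod; [by case: (lf_ok gin) | by case: (lf_ok gin) | ].
  by rewrite Qg dvdp_mull.
have := normS Q; rewrite normQ fE' pnorm_prod ?lf_neq_nil //; last first.
  by move=> h hin; apply: lf_ok hin.
have -> : \prod_(h' <- lf') pnorm h' (Q \Po S^e) =
    \prod_(h' <- lf') (if lplace D' h' \o sigma == lplace D g then c ^+ (size h').-1 else 1).
  rewrite big_seq [RHS]big_seq; apply: eq_bigr => h' hin'.
  rewrite lplace_restrictE //; case: ifPn => hh.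
    rewrite -(pnormC _ (lf_size hin')); apply: pnorm_eqmod; [by case: (lf_ok hin') | by case: (lf_ok hin') | ].
    rewrite -(comp_polyC c S^e) -comp_polyB Qg comp_polyM.
    exact: dvdp_mull.
  have [h hin hh'] := factor_above hin'.
  have hg : h != g by apply: contraNneq hh => <-.
  rewrite -(pnorm1 h'); apply: pnorm_eqmod; [by case: (lf_ok hin') | by case: (lf_ok hin') | ].
  have -> : Q \Po S^e - 1 = (Q - 1) \Po S^e.
    by rewrite comp_polyB -[1]/(1%:P) comp_polyC.
  rewrite Q1 comp_polyM; apply: dvdp_mull.
  have hr : h \in rem g lf by rewrite mem_rem_uniq // !inE hg.
  by rewrite /G (big_rem h hr) /= comp_polyM dvdp_mulr.
rewrite -big_mkcond /= -expr_sum -exprM mulnC.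
rewrite -!rmorphXn => /fmorph_inj; move=> h.
by apply: (ieexprIn _ _ h); rewrite two2.
Qed.

End ExtensionPlaces.

(** * The absolute values of the rationals *)

Section RationalAbs.
Variable R : realType.

Lemma arch_eq0P (q : rat) : ratr `|q| = 0 :> R <-> q = 0.
Proof.
split=> [/eqP|->]; last by rewrite normr0 rmorph0.
by rewrite fmorph_eq0 normr_eq0 => /eqP.
Qed.

Lemma arch_ge0 (q : rat) : 0 <= ratr `|q| :> R. Proof. by rewrite ler0q. Qed.

Lemma archM (x y : rat) : ratr `|x * y| = ratr `|x| * ratr `|y| :> R.
Proof. by rewrite normrM rmorphM. Qed.

Lemma archD (x y : rat) : ratr `|x + y| <= ratr `|x| + ratr `|y| :> R.
Proof. by rewrite -rmorphD ler_rat ler_normD. Qed.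

Definition arch_abs : absValue R rat := AbsValue arch_ge0 arch_eq0P archM archD.

(** Fractions with a fixed denominator n > 1/e and bounded numerators. *)
Lemma arch_totally_bounded : totally_bounded arch_abs.
Proof.
move=> B e e0.
have [n nP] : exists n : nat, e^-1 < n%:R by exists (Num.truncn e^-1).+1; apply: truncnS_gt.
have n0 : (0 < n)%N by rewrite -(ltr_nat R); apply: lt_trans nP; rewrite invr_gt0.
have [M MP] : exists M : nat, B < M%:R by exists (Num.truncn B).+1; apply: truncnS_gt.
exists [seq (i%:Z - (M * n + 1)%N%:Z)%:~R / n%:R | i <- iota 0 (2 * (M * n + 1)).+1] => x xB.
have xM : `|x| < M%:R.
  by rewrite -(ltr_rat R) ratr_nat; apply: le_lt_trans MP.
have nq : 0 < n%:R :> rat by rewrite ltr0n.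
pose z := Num.floor (x * n%:R).
have /andP [z1 z2] : z%:~R <= x * n%:R < (z + 1)%:~R by apply: floor_itv.
have /andP [x1 x2] : - (M * n)%:R < x * n%:R < (M * n)%:R.
  rewrite ltr_norml in xM; case/andP: xM => h1 h2.
  by rewrite natrM -mulNr !ltr_pM2r // h1 h2.
have [i iE] : exists i : nat, i%:Z = z + (M * n + 1)%N%:Z.
  have : 0 <= z + (M * n + 1)%N%:Z.
    have : - (M * n)%N%:Z < z + 1.
      rewrite -(ltr_int rat) rmorphN /=; apply: lt_trans z2; exact: x1.
    by lia.
  by case: (z + _) => // i _; exists i.
exists (z%:~R / n%:R).
  apply/mapP; exists i; last by rewrite iE addrK.
  have : z < (M * n)%N%:Z.
    by rewrite -(ltr_int rat); apply: le_lt_trans z1 _.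
  rewrite mem_iota /=; lia.
rewrite /= -(mulfK (lt0r_neq0 nq) x) -mulrBl normrM normfV (ger0_norm (ltW nq)).
have h : `|x * n%:R - z%:~R| <= 1.
  by rewrite ger0_norm ?subr_ge0 // lerBlDl -[1]/(1%:~R) -rmorphD ltW.
have : `|x * n%:R - z%:~R| / n%:R <= n%:R^-1.
  by rewrite ler_pdivrMr // mulVf // lt0r_neq0.
rewrite -(ler_rat R) => h1; apply: le_lt_trans h1 _.
rewrite fmorphV /= ratr_nat invf_plt ?posrE //.
by rewrite ltr0n.
Qed.

Section Padic.
Variables (p : nat) (pp : prime p).

Local Notation pa := (padic_abs R p).

Let p0 : 0 < p%:R :> R. Proof. by rewrite ltr0n prime_gt0. Qed.
Let p1 : 1 < p%:R :> R. Proof. by rewrite ltr1n prime_gt1. Qed.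
Let pX n : 0 < p%:R ^+ n :> R. Proof. by rewrite exprn_gt0. Qed.
Let pXn0 n : p%:R ^+ n != 0 :> R. Proof. by rewrite gt_eqF. Qed.

Lemma padic_frac (m n : int) : m != 0 -> n != 0 ->
  pa (m%:~R / n%:~R) = p%:R ^+ logn p `|n|%N / p%:R ^+ logn p `|m|%N.
Proof.
move=> m0 n0; set q : rat := _ / _.
have nq : (n%:~R : rat) != 0 by rewrite intr_eq0.
have q0 : q != 0 by rewrite /q mulf_neq0 ?invr_eq0 ?intr_eq0.
rewrite /padic_abs (negPf q0).
have e : m * denq q = numq q * n.
  apply/eqP; rewrite -(eqr_int rat) !rmorphM /=.
  have := divq_num_den q; have d0 : (denq q)%:~R != 0 :> rat by rewrite intr_eq0 denq_neq0.
  move=> h; have : (numq q)%:~R = q * (denq q)%:~R by rewrite -{2}h divfK.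
  by move=> ->; rewrite mulrAC /q divfK.
have nn0 : numq q != 0 by rewrite numq_eq0.
have : (logn p `|m| + logn p `|denq q| = logn p `|numq q| + logn p `|n|)%N.
  by rewrite -!lognM ?absz_gt0 ?denq_neq0 // -!abszM e.
move=> E; apply/eqP; rewrite eqr_div ?pXn0 //.
by rewrite -!exprD addnC E addnC.
Qed.

Lemma padic_neq0 q : q != 0 -> 0 < pa q.
Proof. by move=> q0; rewrite /padic_abs (negPf q0) divr_gt0. Qed.

Lemma padic_ge0 q : 0 <= pa q.
Proof. by have [->|/padic_neq0/ltW//] := eqVneq q 0; rewrite /padic_abs eqxx. Qed.

Lemma padic_eq0P q : pa q = 0 <-> q = 0.
Proof.
split=> [h|->]; last by rewrite /padic_abs eqxx.
by apply/eqP; apply: contraTT isT => /padic_neq0; rewrite h ltxx.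
Qed.

Lemma padicM x y : pa (x * y) = pa x * pa y.
Proof.
have [->|x0] := eqVneq x 0; first by rewrite mul0r /padic_abs eqxx mul0r.
have [->|y0] := eqVneq y 0; first by rewrite mulr0 /padic_abs eqxx mulr0.
rewrite -{1}(divq_num_den x) -{1}(divq_num_den y) mulf_div -!rmorphM /=.
rewrite padic_frac ?mulf_neq0 ?denq_neq0 ?numq_eq0 //.
rewrite /padic_abs (negPf x0) (negPf y0) !abszM !lognM ?absz_gt0 ?denq_neq0 ?numq_eq0 //.
by rewrite !exprD mulf_div.
Qed.

Lemma padic_int (m : int) (e : nat) : (p ^ e %| `|m|)%N -> pa m%:~R <= (p%:R ^+ e)^-1.
Proof.
move=> h; have [->|m0] := eqVneq m 0.
  by rewrite /padic_abs eqxx invr_ge0 ltW.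
have -> : m%:~R = m%:~R / 1%:~R :> rat by rewrite divr1.
rewrite padic_frac // logn1 expr0 div1r lef_pV2 ?posrE // ler_weXn2l ?ltW //.
by rewrite -pfactor_dvdn // absz_gt0.
Qed.

Lemma padic_int_le1 (m : int) : pa m%:~R <= 1.
Proof. by have := @padic_int m 0; rewrite expr0 invr1; apply; rewrite expn0 dvd1n. Qed.

Lemma padic_ultra x y : pa (x + y) <= Num.max (pa x) (pa y).
Proof.
have [->|x0] := eqVneq x 0; first by rewrite add0r le_max lexx orbT.
have [->|y0] := eqVneq y 0; first by rewrite addr0 le_max lexx.
have [->|xy0] := eqVneq (x + y) 0.
  by rewrite {1}/padic_abs eqxx le_max padic_ge0.
pose d : int := denq x * denq y.
pose m : int := numq x * denq y; pose n : int := numq y * denq x.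
have d0 : d != 0 by rewrite mulf_neq0 ?denq_neq0.
have dx : (denq x)%:~R != 0 :> rat by rewrite intr_eq0 denq_neq0.
have dy : (denq y)%:~R != 0 :> rat by rewrite intr_eq0 denq_neq0.
have xE : x = m%:~R / d%:~R.
  by rewrite /m /d !rmorphM /= -mulf_div divff // mulr1 divq_num_den.
have yE : y = n%:~R / d%:~R.
  by rewrite /n /d !rmorphM /= [(denq x)%:~R * _]mulrC -mulf_div divff // mulr1 divq_num_den.
have m0 : m != 0 by rewrite mulf_neq0 ?denq_neq0 ?numq_eq0.
have n0 : n != 0 by rewrite mulf_neq0 ?denq_neq0 ?numq_eq0.
have mn0 : m + n != 0.
  by apply: contraNneq xy0 => h; rewrite xE yE -mulrDl -rmorphD h mul0r.
have -> : x + y = (m + n)%:~R / d%:~R by rewrite xE yE -mulrDl -rmorphD.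
rewrite {1}xE {1}yE !padic_frac //.
set e := minn (logn p `|m|) (logn p `|n|).
have he : (e <= logn p `|(m + n)%R|)%N.
  have hm : ((p ^ e)%N%:Z %| m)%Z by rewrite dvdzE /= pfactor_dvdn ?absz_gt0 // geq_minl.
  have hn : ((p ^ e)%N%:Z %| n)%Z by rewrite dvdzE /= pfactor_dvdn ?absz_gt0 // geq_minr.
  have := rpredD hm hn; rewrite dvdzE /= pfactor_dvdn ?absz_gt0 //.
have key j : (j <= logn p `|(m + n)%R|)%N ->
   p%:R ^+ logn p `|d| / p%:R ^+ logn p `|(m + n)%R| <= p%:R ^+ logn p `|d| / p%:R ^+ j :> R.
  by move=> hj; rewrite ler_pM2l // lef_pV2 ?posrE // ler_weXn2l // ltW.
rewrite le_max; move: he; rewrite /e /minn; case: ifP => _ /key -> //.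
by rewrite orbT.
Qed.

Lemma padicD x y : pa (x + y) <= pa x + pa y.
Proof.
apply: le_trans (padic_ultra _ _) _; rewrite ge_max lerDl lerDr.
by rewrite !padic_ge0.
Qed.

Definition padic_absV : absValue R rat := AbsValue padic_ge0 padic_eq0P padicM padicD.

Lemma padic_p : pa p%:R = p%:R^-1.
Proof.
have -> : p%:R = p%:Z%:~R / 1%:~R :> rat by rewrite divr1.
have pz : p%:Z != 0 by rewrite eqz_nat -lt0n prime_gt0.
rewrite padic_frac // logn1 expr0 div1r /=.
by rewrite -[X in logn p X]expn1 pfactorK // expr1.
Qed.

(** Bezout inverts the denominator modulo [p ^ l]. *)
Lemma padic_residue (r : rat) (l : nat) : pa r <= 1 ->
  exists2 i : nat, (i < p ^ l)%N & pa (r - i%:R) <= (p%:R ^+ l)^-1.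
Proof.
move=> r1; have [->|r0] := eqVneq r 0.
  exists 0%N; first by rewrite expn_gt0 prime_gt0.
  by rewrite subr0 /padic_abs eqxx invr_ge0 ltW.
have d0 := denq_neq0 r.
have pd : ~~ (p %| `|denq r|)%N.
  apply/negP => h; move: r1; rewrite /padic_abs (negPf r0) leNgt; apply/negP/negPn.
  have pn : ~~ (p %| `|numq r|)%N.
    apply/negP => h'; have := coprime_num_den r; rewrite /coprime => /eqP g1.
    have : (p %| 1)%N by rewrite -g1 dvdn_gcd h' h.
    by rewrite dvdn1 => /eqP p_1; move: pp; rewrite p_1.
  have -> : logn p `|numq r| = 0%N.
    by apply/eqP; rewrite -leqn0 leqNgt logn_gt0 mem_primes pp absz_gt0 numq_eq0 r0 /=.
  rewrite expr0 divr1 exprn_egt1 // -lt0n logn_gt0 mem_primes pp absz_gt0 d0 /=.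
  exact: h.
have cop : coprimez (p ^ l)%N%:Z (denq r).
  rewrite coprimezE /=; apply: coprimeXl; by rewrite prime_coprime.
have [u [v uv]] := Bezoutz (p ^ l)%N%:Z (denq r).
rewrite (eqP (_ : gcdz (p ^ l)%N (denq r) == 1)) in uv; last exact: cop.
have pl0 : (p ^ l)%N%:Z != 0 by rewrite eqz_nat -lt0n expn_gt0 prime_gt0.
pose j : int := ((numq r * v) %% (p ^ l)%N)%Z.
have j0 : 0 <= j by apply: modz_ge0.
have jl : j < (p ^ l)%N%:Z by apply: ltz_pmod; rewrite ltz_nat expn_gt0 prime_gt0.
have [i iE] : exists i : nat, i%:Z = j by case: (j) j0 => // i _; exists i.
exists i; first by rewrite -ltz_nat iE.
have -> : r - i%:R = (numq r - j * denq r)%:~R / (denq r)%:~R.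
  by rewrite intrB intrM mulrBl mulfK ?intr_eq0 // divq_num_den -iE.
have div : ((p ^ l)%N %| numq r - j * denq r)%Z.
  have -> : numq r - j * denq r = (numq r * u) * (p ^ l)%N%:Z + (numq r * v - j) * denq r.
    have -> : numq r - j * denq r = numq r * (u * (p ^ l)%N%:Z + v * denq r) - j * denq r.
      by rewrite uv mulr1.
    ring.
  apply: rpredD; first exact: dvdz_mull.
  by apply: dvdz_mulr; rewrite -eqz_mod_dvd modz_mod.
rewrite padicM (_ : pa _^-1 = 1) ?mulr1; first exact: padic_int.
have := padic_frac (m := 1) (isT : 1 != 0 :> int) d0.
rewrite div1r /= logn1 expr0 divr1 => ->.
by rewrite (_ : logn p _ = 0%N) ?expr0 //; apply/eqP; rewrite -leqn0 leqNgt logn_gt0 mem_primes (negPf pd) !andbF.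
Qed.

(** Multiplication by a power of [p] moves a ball into the [p]-integers, where
    the residues modulo [p ^ l] suffice. *)
Lemma padic_totally_bounded : totally_bounded padic_absV.
Proof.
move=> B e e0.
have expn_unbounded (x : R) : exists m : nat, x < p%:R ^+ m.
  exists (Num.truncn x).+1; apply: lt_trans (truncnS_gt x) _.
  by rewrite -natrX ltr_nat ltn_expl // prime_gt1.
have [m hm] := expn_unbounded B.
have [l hl] := expn_unbounded (p%:R ^+ m / e).
have pq : (p%:R : rat) != 0 by rewrite pnatr_eq0 -lt0n prime_gt0.
have pam : pa (p%:R ^+ m) = (p%:R ^+ m)^-1.
  by rewrite -[pa _]/(padic_absV _) absX /= padic_p exprVn.
exists [seq i%:R / p%:R ^+ m | i <- iota 0 (p ^ l)] => x xB.
have [|i il hi] := @padic_residue (p%:R ^+ m * x) l.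
  by rewrite padicM pam mulrC ler_pdivrMr // mul1r ltW //; apply: le_lt_trans hm.
exists (i%:R / p%:R ^+ m).
  by apply/mapP; exists i; rewrite // mem_iota.
have pmq : (p%:R ^+ m : rat) != 0 by rewrite expf_neq0.
have -> : x - i%:R / p%:R ^+ m = (p%:R ^+ m * x - i%:R) / p%:R ^+ m.
  by rewrite mulrBl mulrAC divff // mul1r.
rewrite absM absV /= pam invrK.
apply: le_lt_trans (ler_wpM2r (ltW (pX m)) hi) _.
by rewrite mulrC ltr_pdivrMr // mulrC -ltr_pdivrMr.
Qed.

End Padic.

(** The places of the rationals are indexed by 0 (the archimedean one) and by
    the primes. *)
Definition isbase (b : nat) := (b == 0%N) || prime b.

Definition base_abs (b : nat) : absValue R rat :=
  match @idP (prime b) with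
  | ReflectT pb => padic_absV pb
  | ReflectF _ => arch_abs
  end.

Lemma base_abs_prime p q : prime p -> base_abs p q = padic_abs R p q.
Proof. by move=> pp; rewrite /base_abs; case: {-}_ / idP => // [[]]. Qed.

Lemma base_abs0 q : base_abs 0 q = ratr `|q|.
Proof. by rewrite /base_abs; case: {-}_ / idP. Qed.

Lemma base_abs_totally_bounded b : totally_bounded (base_abs b).
Proof.
rewrite /base_abs; case: {-}_ / idP => [pb|_]; first exact: padic_totally_bounded.
exact: arch_totally_bounded.
Qed.

Lemma prod_primes_expn n N : (0 < n)%N -> (n < N)%N ->
  (\prod_(0 <= p < N | prime p) p ^ logn p n)%N = n.
Proof.
move=> n0 nN; rewrite -[RHS](partnT n0) /partn.
rewrite big_mkcond [RHS](big_nat_widen _ _ N) //= [RHS]big_mkcond /=.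
apply: eq_bigr => p _; rewrite /=.
case: (boolP (prime p)) => pp.
  case: ltnP => // np; apply/eqP; rewrite (_ : logn p n = 0%N) //.
  apply/eqP; rewrite -leqn0 leqNgt logn_gt0 mem_primes; apply/negP => /and3P [_ _ /(dvdn_leq n0)].
  by rewrite leqNgt np.
by case: ltnP => // _; rewrite lognE (negPf pp).
Qed.

(** The product formula over the rationals is the factorisation of the
    numerator and of the denominator. *)
Lemma base_product (q : rat) : q != 0 -> exists N0, forall N, (N0 <= N)%N ->
  \prod_(0 <= b < N | isbase b) base_abs b q = 1.
Proof.
move=> q0; exists (`|numq q| + `|denq q|).+1%N => N hN.
have N0 : (0 < N)%N by apply: leq_trans hN.
have n0 : (0 < `|numq q|)%N by rewrite absz_gt0 numq_eq0.
have d0 : (0 < `|denq q|)%N by rewrite absz_gt0 denq_neq0.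
have -> : \prod_(0 <= b < N | isbase b) base_abs b q =
    ratr `|q| * \prod_(0 <= p < N | prime p) padic_abs R p q.
  rewrite [LHS]big_ltn_cond // [in RHS]big_ltn_cond //= base_abs0; congr (_ * _).
  rewrite [RHS]big_mkcond [LHS]big_mkcond; apply: eq_big_nat => b /andP [b0 _].
  rewrite /isbase eqn0Ngt b0 /=; case: ifP => // pb; exact: base_abs_prime.
rewrite /padic_abs (negPf q0) prodf_div.
have E n : (0 < n)%N -> (n < N)%N ->
    \prod_(0 <= p < N | prime p) p%:R ^+ logn p n = n%:R :> R.
  move=> n1 nN; rewrite -{2}(prod_primes_expn n1 nN) natr_prod.
  by apply: eq_bigr => p _; rewrite natrX.
rewrite !E //; do ?[by apply: leq_trans hN; lia].
rewrite -{1}(divq_num_den q) normrM normfV rmorphM fmorphV /= -!intr_norm /=.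
rewrite !ratr_int -!abszE mulf_div [_ * `|denq q|%:R]mulrC.
by apply: divff; rewrite mulf_neq0 // pnatr_eq0 -lt0n.
Qed.

End RationalAbs.

(** * Products over the places of a number field *)

Definition ultrametric (R : realType) (K : fieldType) (w : absValue R K) :=
  forall x y, w (x + y) <= Num.max (w x) (w y).

(** The binomial formula for a large power has coefficients bounded by 1, and
    its number of terms is absorbed by taking roots. *)
Lemma ultrametric_of_nat (R : realType) (K : fieldType) (w : absValue R K) :
  (forall n : nat, w n%:R <= 1) -> ultrametric w.
Proof.
move=> wn x y; set M := Num.max _ _.
have [xM yM] : w x <= M /\ w y <= M by rewrite /M !le_max !lexx orbT.
have M0 : 0 <= M by apply: le_trans xM; apply: abs_ge0.
apply: (@le_of_expr_le _ 1) => //; first exact: abs_ge0.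
move=> m; rewrite -absX exprDn; apply: le_trans (abs_sum _ _ _ _) _.
apply: le_trans (_ : \sum_(i < m.+1) M ^+ m <= _); last first.
  by rewrite sumr_const card_ord mul1r mulr_natl.
apply: ler_sum => i _; rewrite -mulr_natl absM -[leRHS]mul1r.
apply: ler_pM; rewrite ?abs_ge0 // absM !absX.
have -> : M ^+ m = M ^+ (m - i) * M ^+ i by rewrite -exprD subnK // -ltnS.
by apply: ler_pM; rewrite ?exprn_ge0 ?abs_ge0 //; apply: lerXn2r; rewrite ?nnegrE ?abs_ge0.
Qed.

Section MaxNorm.
Variables (R : realType) (K : Type) (I : finType).

Definition maxnorm (v : K -> R) (x : I -> K) : R := \big[Num.max/0]_i v (x i).

Lemma maxnorm_ge0 v x : (forall y, 0 <= v y) -> 0 <= maxnorm v x.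
Proof.
by move=> v0; rewrite /maxnorm; elim/big_ind: _ => // a b ha hb; rewrite le_max ha.
Qed.

Lemma maxnorm_ge v x i : v (x i) <= maxnorm v x.
Proof. by rewrite /maxnorm (bigD1 i) //= le_max lexx. Qed.

Lemma maxnorm_le v x M : 0 <= M -> (forall i, v (x i) <= M) -> maxnorm v x <= M.
Proof.
move=> M0 h; rewrite /maxnorm; elim/big_ind: _ => // a b ha hb.
by rewrite ge_max ha hb.
Qed.

End MaxNorm.

Lemma local_heightE (R : realType) (K : fieldExtType rat) (I : finType) (v : K -> R)
    (x : I -> K) : (forall y, 0 <= v y) -> (0 < local_degree v)%N ->
  local_height v x = maxnorm v x ^+ local_degree v.
Proof.
move=> v0 d0; apply/eqP; rewrite eq_le; apply/andP; split.
  rewrite /local_height; elim/big_ind: _ => [|a b ha hb|i _].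
  - by rewrite exprn_ge0 // maxnorm_ge0.
  - by rewrite ge_max ha hb.
  - by apply: lerXn2r; rewrite ?nnegrE ?maxnorm_ge0 // maxnorm_ge.
rewrite /maxnorm.
suff : 0 <= \big[Num.max/0]_i v (x i) /\
    (\big[Num.max/0]_i v (x i)) ^+ local_degree v <= local_height v x by case.
elim/big_ind: _ => [|a b [a0 ha] [b0 hb]|i _].
- split=> //; rewrite expr0n eqn0Ngt d0 /=.
  rewrite /local_height; elim/big_ind: _ => // [a b ha hb|i _]; first by rewrite le_max ha.
  by rewrite exprn_ge0.
- by rewrite maxEle; case: ifP.
- split=> //; by rewrite /local_height (bigD1 i) //= le_max lexx.
Qed.

Section PlaceProducts.
Variables (R : realType) (K : fieldExtType rat) (D : primitive_data K).

Local Notation lf b := (local_factors (base_abs R b) D).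
Local Notation above b v := (@place_above R K (base_abs R b) v).
Let tb b := @base_abs_totally_bounded R b.

Definition places_in (P : pred nat) : set (K -> R) :=
  [set v | exists2 b, isbase b && P b & above b v]%classic.

Lemma infinite_placesE : @infinite_places R K = places_in (pred1 0%N).
Proof.
apply/seteqP; split=> v /= => [[h1 h2]|[b /andP [_ /eqP ->] [h1 h2]]].
  by exists 0%N => //; split=> // q; rewrite base_abs0.
by split=> // q; rewrite h2 base_abs0.
Qed.

Lemma finite_placesE : @finite_places R K = places_in (predC1 0%N).
Proof.
apply/seteqP; split=> v /= => [[h1 [p pp h2]]|[b /andP [bb /= b0] [h1 h2]]].
  exists p; first by rewrite /isbase pp orbT /= -lt0n prime_gt0.
  by split=> // q; rewrite base_abs_prime.
split=> //; move: bb; rewrite /isbase (negPf b0) /= => pb.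
by exists b => // q; rewrite h2 base_abs_prime.
Qed.

Lemma placesE : @places R K = places_in predT.
Proof.
rewrite /places infinite_placesE finite_placesE; apply/seteqP; split=> v /=.
  by case=> -[b /andP [bb _] h]; exists b; rewrite ?bb.
case=> b /andP [bb _] h; have [b0|b0] := eqVneq b 0%N; [left|right];
  by exists b; rewrite // bb /= b0.
Qed.

Lemma base_abs_le_lt1 b b' : prime b -> isbase b' -> b' != b -> 1 <= base_abs R b' b%:R.
Proof.
move=> pb; rewrite /isbase => /orP [/eqP -> _|pb' bb].
  by rewrite base_abs0 normr_nat ratr_nat ler1n prime_gt0.
rewrite base_abs_prime //.
have -> : b%:R = b%:Z%:~R / 1%:~R :> rat by rewrite divr1.
rewrite padic_frac // ?eqz_nat -?lt0n ?prime_gt0 // logn1 expr0 div1r /=.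
rewrite (_ : logn b' b = 0%N) ?expr0 ?invr1 //.
apply/eqP; rewrite -leqn0 leqNgt logn_gt0 mem_primes; apply/negP => /and3P [_ _].
by rewrite dvdn_prime2 // (negPf bb).
Qed.

(** The absolute value of a prime is less than 1 at that prime and at no other
    place. *)
Lemma above_unique b b' v : isbase b -> isbase b' -> above b v -> above b' v -> b = b'.
Proof.
move=> hb hb' [_ h] [_ h']; apply/eqP; apply: contraT => bb'.
have E q : base_abs R b q = base_abs R b' q by rewrite -h h'.
have lt1 p : prime p -> base_abs R p p%:R < 1.
  by move=> pp; rewrite base_abs_prime // padic_p // invf_lt1 ?ltr0n ?ltr1n ?prime_gt1 ?prime_gt0.
move: hb hb'; rewrite {1}/isbase => /orP [/eqP b0|pb] hb'.
  move: (hb'); rewrite /isbase => /orP [/eqP b0'|pb'].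
    by rewrite b0 b0' eqxx in bb'.
  have := @base_abs_le_lt1 b' b pb'; rewrite E leNgt lt1 // => h0.
  by apply: h0; rewrite // /isbase b0.
have := @base_abs_le_lt1 b b' pb hb'; rewrite -E leNgt lt1 // eq_sym => h0.
exact: h0.
Qed.

(** The places above a base place are listed without repetition by its local
    factors, and distinct base places have disjoint sets of places above them.
    *)
Lemma prod_places (P : pred nat) (phi : (K -> R) -> R) (N : nat) :
  (forall b, (N <= b)%N -> isbase b && P b -> forall v, above b v -> phi v = 1) ->
  \big[*%R/1]_(v \in places_in P) phi v =
  \prod_(0 <= b < N | isbase b && P b) \prod_(g <- lf b) phi (lplace D g).
Proof.
move=> hN; pose r := [seq b <- index_iota 0 N | isbase b && P b].
pose s := [seq lplace D g | b <- r, g <- lf b].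
have rP b : b \in r -> isbase b && P b by rewrite mem_filter => /andP [].
have sP v : v \in s -> exists2 b, b \in r & above b v.
  by case/allpairsPdep => b [g [br gin ->]]; exists b => //; apply: lplace_above.
have us : uniq s.
  apply: allpairs_uniq_dep.
  - by rewrite filter_uniq // iota_uniq.
  - by move=> b _; case: (local_factorsP (base_abs R b) D).
  - move=> _ _ /allpairsPdep [b [g [hb hg ->]]] /allpairsPdep [b' [g' [hb' hg' ->]]] /= e.
    have bb' : b = b'.
      have /andP [ib _] := rP _ hb; have /andP [ib' _] := rP _ hb'.
      apply: (above_unique ib ib' (lplace_above (@tb b) hg)).
      by rewrite e; apply: lplace_above hg'.
    subst b'; congr Tagged; exact: (lplace_inj (@tb b) hg hg' e).
have -> : \prod_(0 <= b < N | isbase b && P b) \prod_(g <- lf b) phi (lplace D g) =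
          \prod_(v <- s) phi v.
  by rewrite big_allpairs_dep big_filter.
rewrite [RHS]fsbig_seq //; apply/esym/fsbig_widen.
  by move=> v /= /sP [b br av]; exists b => //; apply: rP.
move=> v /= [[b bP av] vs].
have [bN|Nb] := ltnP b N; last exact: hN Nb bP v av.
case: vs; have [g gin ->] := lplace_surj (@tb b) D av.
by apply: allpairs_f_dep; rewrite // mem_filter bP mem_index_iota.
Qed.

Lemma above_ultrametric b (w : absValue R K) : isbase b -> b != 0%N -> above b w ->
  ultrametric w.
Proof.
move=> bb b0 [_ hw]; apply: ultrametric_of_nat => n.
have pb : prime b by move: bb; rewrite /isbase (negPf b0).
by rewrite -scaler_nat hw base_abs_prime // (padic_int_le1 R pb n%:Z).
Qed.

(** For almost all primes the coefficients of the defining polynomial and of a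
    polynomial representing [x] are integral; then so is the primitive
    element, by its monic equation, and so is [x]. *)
Lemma abs_le1_almost (x : K) : exists N0, forall b, (N0 <= b)%N -> isbase b ->
  forall v, above b v -> v x <= 1.
Proof.
pose S (P : {poly rat}) := (\sum_(i < size P) `|denq P`_i|)%N.
have coefle (P : {poly rat}) b i : (S P < b)%N -> isbase b -> base_abs R b P`_i <= 1.
  move=> hb bb; have pb : prime b.
    by move: bb; rewrite /isbase => /orP [/eqP b0|//]; rewrite b0 in hb.
  rewrite base_abs_prime // /padic_abs; case: eqP => // ne0.
  rewrite (_ : logn b `|denq P`_i| = 0%N); last first.
    apply/eqP; rewrite -leqn0 leqNgt logn_gt0 mem_primes; apply/negP => /and3P [_ d0].
    move/(dvdn_leq d0); rewrite leqNgt => /negP; apply; apply: leq_ltn_trans hb.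
    have [hi|hi] := ltnP i (size P); first by rewrite /S (bigD1 (Ordinal hi)) //= leq_addr.
    by case: ne0; rewrite nth_default.
  by rewrite expr0 div1r invf_le1 ?exprn_gt0 ?ltr0n ?prime_gt0 // exprn_ege1 // ler1n prime_gt0.
pose f := prim_poly D; pose th := prim D; pose P := polyof D x.
exists (S f + S P).+1%N => b hb bb v [hv va].
have b0 : b != 0%N by rewrite -lt0n; apply: leq_trans hb.
pose w := to_absValue hv; have wE : w = v :> (K -> R) := to_absValueE hv.
have wu : ultrametric w by apply: (above_ultrametric bb b0); rewrite wE; split.
have wa q : w q%:A = base_abs R b q by rewrite wE.
have usum (I : Type) (r : seq I) (u : I -> K) (M : R) : 0 <= M ->
    (forall i, w (u i) <= M) -> w (\sum_(i <- r) u i) <= M.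
  move=> M0 hu; elim: r => [|i r IH]; first by rewrite big_nil abs0.
  by rewrite big_cons; apply: le_trans (wu _ _) _; rewrite ge_max hu IH.
have evE (Q : {poly rat}) : horner_alg th Q = \sum_(i < size Q) (Q`_i)%:A * th ^+ i.
  rewrite -{1}[Q]coefK poly_def rmorph_sum; apply: eq_bigr => i _.
  by rewrite -mul_polyC rmorphM /= horner_algC rmorphXn /= horner_algX.
have th1 : w th <= 1.
  rewrite leNgt; apply/negP => th1.
  have /eqP f0 : horner_alg th f == 0 by rewrite prim_ker.
  have f1 := irredp_size (prim_poly_irred D); rewrite -/f in f1.
  pose n := (size f).-1; have nE : size f = n.+1 by rewrite /n prednK // ltnW.
  have : th ^+ n = - \sum_(i < n) (f`_i)%:A * th ^+ i.
    have fn : f`_n = 1 by have := monicP (prim_poly_monic D); rewrite /lead_coef -/f nE.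
    move: f0; rewrite evE nE big_ord_recr /= fn scale1r mul1r => /eqP.
    by rewrite addrC addr_eq0 => /eqP.
  have n0 : (0 < n)%N by move: f1; rewrite nE.
  move/(congr1 w); rewrite absN absX => E.
  have : w th ^+ n <= w th ^+ n.-1.
    rewrite E; apply: usum => [|i]; first by rewrite exprn_ge0 ?abs_ge0.
    rewrite absM wa absX -[leRHS]mul1r; apply: ler_pM; rewrite ?abs_ge0 ?exprn_ge0 ?abs_ge0 //.
      by apply: coefle => //; apply: leq_ltn_trans hb; apply: leq_addr.
    by rewrite ler_weXn2l ?(ltW th1) // -ltnS prednK.
  rewrite leNgt => /negP; apply; rewrite ltr_eXn2l //.
  by rewrite prednK.
rewrite -wE -(polyofK D x) evE; apply: usum => // i.
rewrite absM wa absX; apply: mulr_ile1; rewrite ?abs_ge0 ?exprn_ge0 ?abs_ge0 ?exprn_ile1 ?abs_ge0 //.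
by apply: coefle => //; apply: leq_ltn_trans hb; apply: leq_addl.
Qed.

Lemma abs_eq1_almost (x : K) : x != 0 -> exists N0, forall b, (N0 <= b)%N -> isbase b ->
  forall v, above b v -> v x = 1.
Proof.
move=> x0; have [N1 h1] := abs_le1_almost x; have [N2 h2] := abs_le1_almost x^-1.
exists (maxn N1 N2) => b; rewrite geq_max => /andP [b1 b2] bb v hv.
have := h1 b b1 bb v hv; have := h2 b b2 bb v hv; case: hv => hv _.
pose w := to_absValue hv; have wE : w = v :> (K -> R) := to_absValueE hv.
rewrite -wE absV => h3 h4; apply/eqP; rewrite eq_le h4 /=.
by rewrite invf_le1 ?abs_gt0 // in h3.
Qed.

Variable I : finType.
Implicit Type x : I -> K.

Lemma maxnorm_eq1_almost x : (exists i, x i != 0) -> exists N0, forall b, (N0 <= b)%N ->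
  isbase b -> forall v, above b v -> maxnorm v x = 1.
Proof.
move=> [i0 xi0].
have H i : exists N0, forall b, (N0 <= b)%N -> isbase b ->
    forall v, above b v -> v (x i) <= 1 := abs_le1_almost (x i).
have [N0 hN0] := choice H; have [N1 hN1] := abs_eq1_almost xi0.
exists (N1 + \sum_i N0 i)%N => b hb bb v hv; apply/eqP; rewrite eq_le; apply/andP; split.
  apply: maxnorm_le => // i; apply: (hN0 i b) => //.
  by apply: leq_trans hb; rewrite (bigD1 i) //= addnCA leq_addr.
have <- : v (x i0) = 1 by apply: (hN1 b) => //; apply: leq_trans hb; apply: leq_addr.
exact: maxnorm_ge.
Qed.

(** The height before taking the root of order the degree, over base places
    less than [N]. *)
Definition partial_height (N : nat) x : R :=
  \prod_(0 <= b < N | isbase b) \prod_(g <- lf b) maxnorm (lplace D g) x ^+ (size g).-1.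

Lemma lplace_ge0 b g : g \in lf b -> forall y, 0 <= lplace D g y.
Proof. by move=> gin; case: (lplace_above (@tb b) gin) => -[]. Qed.

Lemma local_height_lplace b g x : g \in lf b ->
  local_height (lplace D g) x = maxnorm (lplace D g) x ^+ (size g).-1.
Proof.
move=> gin; have dE := local_degree_lplace (@tb b) gin.
have d0 : (0 < local_degree (lplace D g))%N.
  by rewrite dE; have := lf_size gin; case: (size g) => [|[]].
by rewrite (local_heightE x (lplace_ge0 gin) d0) dE.
Qed.

Lemma local_height_eq1_almost x : (exists i, x i != 0) -> exists N0, forall b, (N0 <= b)%N ->
  isbase b -> forall v, above b v -> local_height v x = 1.
Proof.
move=> /maxnorm_eq1_almost [N0 h]; exists N0 => b hb bb v hv.
have := h b hb bb v hv.
have [g gin ->] := lplace_surj (@tb b) D hv.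
by rewrite (local_height_lplace _ gin) => ->; rewrite expr1n.
Qed.

Lemma field_height_partial x : (exists i, x i != 0) -> exists N0, forall N, (N0 <= N)%N ->
  field_height R x = partial_height N x `^ (\dim {:K})%:R^-1.
Proof.
move=> /local_height_eq1_almost [N0 h]; exists N0 => N hN.
rewrite /field_height placesE (@prod_places predT (fun v => local_height v x) N); last first.
  by move=> b hb /andP [bb _]; apply: h bb; apply: leq_trans hb.
congr (_ `^ _); rewrite /partial_height; under eq_bigl do rewrite andbT.
apply: eq_bigr => b bb; rewrite big_seq [RHS]big_seq; apply: eq_bigr => g gin.
exact: local_height_lplace gin.
Qed.

Lemma partial_height_ge0 N x : 0 <= partial_height N x.
Proof.
rewrite /partial_height; apply: prodr_ge0 => b _; rewrite big_seq; apply: prodr_ge0 => g gin.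
by rewrite exprn_ge0 // maxnorm_ge0 //; apply: lplace_ge0 gin.
Qed.

End PlaceProducts.

(** * Heights over a number field *)

Lemma prod_powR (R : realType) (J : Type) (s : seq J) (f : J -> R) (r : R) :
  (forall j, 0 <= f j) -> \prod_(j <- s) f j `^ r = (\prod_(j <- s) f j) `^ r.
Proof.
move=> f0; elim: s => [|j s IH]; first by rewrite !big_nil powR1.
by rewrite !big_cons IH powRM // prodr_ge0.
Qed.

Section FieldHeights.
Variables (R : realType) (K : fieldExtType rat) (D : primitive_data K).

Local Notation lf b := (local_factors (base_abs R b) D).
Let tb b := @base_abs_totally_bounded R b.
Let d := \dim {:K}.

Let d0 : (0 < d)%N. Proof. exact: adim_gt0. Qed.

Lemma expn_root (x : R) : 0 <= x -> (x ^+ d) `^ d%:R^-1 = x.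
Proof.
by move=> x0; rewrite -powR_mulrn // -powRrM mulfV ?powRr1 // pnatr_eq0 -lt0n.
Qed.

Lemma maxnorm_scale (I : finType) (w : absValue R K) (c : K) (x : I -> K) :
  maxnorm w (fun i => c * x i) = w c * maxnorm w x.
Proof.
rewrite /maxnorm (big_morph (fun y => w c * y) (id1 := 0) (op1 := Num.max)) ?mulr0 //.
  by apply: eq_bigr => i _; rewrite absM.
by move=> y z; rewrite maxr_pMr ?abs_ge0.
Qed.

(** The product formula for the scaling factor, which [prod_lplace] reduces to
    that of its norm. *)
Lemma field_height_scale (I : finType) (c : K) (x : I -> K) : c != 0 ->
  (exists i, x i != 0) -> field_height R (fun i => c * x i) = field_height R x.
Proof.
move=> c0 x0.
have cx0 : exists i, c * x i != 0 by case: x0 => i xi; exists i; rewrite mulf_neq0.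
have [N1 h1] := field_height_partial R D x0.
have [N2 h2] := field_height_partial R D cx0.
have qc : qnorm D c != 0 by rewrite qnorm_eq0.
have [N3 h3] := base_product R qc.
pose N := maxn N1 (maxn N2 N3).
rewrite (h1 N) ?(h2 N); try by rewrite /N; lia.
congr (_ `^ _).
have -> : partial_height R D N x = \prod_(0 <= b < N | isbase b) base_abs R b (qnorm D c) *
    partial_height R D N x by rewrite h3 ?mul1r // /N; lia.
rewrite /partial_height.
rewrite -big_split; apply: eq_bigr => b bb /=.
rewrite -(prod_lplace _ D) -big_split /= big_seq [RHS]big_seq; apply: eq_bigr => g gin.
have [hv _] := lplace_above (@tb b) gin.
by rewrite -exprMn -(to_absValueE hv) maxnorm_scale.
Qed.

Lemma field_height_ge1 (I : finType) (x : I -> K) i : x i = 1 -> 1 <= field_height R x.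
Proof.
move=> xi; have x0 : exists i, x i != 0 by exists i; rewrite xi oner_neq0.
have [N1 h1] := field_height_partial R D x0; rewrite (h1 N1) //.
apply: le_trans (_ : 1 `^ d%:R^-1 <= _); first by rewrite powR1.
apply: ge0_ler_powR; rewrite ?invr_ge0 ?ler0n ?nnegrE ?partial_height_ge0 //.
rewrite /partial_height; elim/big_ind: _ => // [y z|b _]; first exact: mulr_ege1.
rewrite big_seq; elim/big_ind: _ => // [y z|g gin]; first exact: mulr_ege1.
have [hv _] := lplace_above (@tb b) gin.
apply: exprn_ege1; have <- : lplace D g (x i) = 1 by rewrite xi -(to_absValueE hv) abs1.
exact: maxnorm_ge.
Qed.

(** The local bounds are multiplied together. The constant [C] enters at
    archimedean places only, to the power of the local degree, and these
    degrees add up to the degree of the field. *)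
Lemma field_height_dom (I J : finType) (Jf : J -> finType) (x : I -> K)
    (y : forall j, Jf j -> K) (C : R) : 0 <= C ->
  (exists i, x i != 0) -> (forall j, exists t, y j t != 0) ->
  (forall w : absValue R K, maxnorm w x <= C * \prod_j maxnorm w (y j)) ->
  (forall w : absValue R K, ultrametric w -> maxnorm w x <= \prod_j maxnorm w (y j)) ->
  field_height R x <= C * \prod_j field_height R (y j).
Proof.
move=> C0 x0 y0 hC hu.
have [N1 h1] := field_height_partial R D x0.
have H j : exists N0, forall N, (N0 <= N)%N ->
    field_height R (y j) = partial_height R D N (y j) `^ (\dim {:K})%:R^-1.
  exact: field_height_partial.
have [N2 h2] := choice H.
pose N := (N1 + \sum_j N2 j).+1%N.
have -> : field_height R x = partial_height R D N x `^ d%:R^-1 by apply: h1; rewrite /N; lia.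
have -> : \prod_j field_height R (y j) = (\prod_j partial_height R D N (y j)) `^ d%:R^-1.
  rewrite -prod_powR; last by move=> j; apply: partial_height_ge0.
  by apply: eq_bigr => j _; apply: (h2 j); rewrite /N (bigD1 j) //=; lia.
rewrite -{1}(expn_root C0) -powRM ?exprn_ge0 //; last by apply: prodr_ge0 => j _; apply: partial_height_ge0.
apply: ge0_ler_powR; rewrite ?invr_ge0 ?nnegrE ?partial_height_ge0 ?mulr_ge0 ?exprn_ge0 //.
  by apply: prodr_ge0 => j _; apply: partial_height_ge0.
pose Cb (b : nat) : R := if b == 0%N then C else 1.
have -> : C ^+ d = \prod_(0 <= b < N | isbase b) \prod_(g <- lf b) Cb b ^+ (size g).-1.
  rewrite big_ltn_cond //= -expr_sum (sum_lf_degree (base_abs R 0) D).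
  rewrite [X in _ * X]big1_seq ?mulr1 // => b /andP [_].
  rewrite mem_index_iota => /andP [b0 _]; rewrite /Cb eqn0Ngt b0 /=.
  by apply: big1 => g _; rewrite expr1n.
have -> : \prod_j partial_height R D N (y j) = \prod_(0 <= b < N | isbase b)
    \prod_(g <- lf b) (\prod_j maxnorm (lplace D g) (y j)) ^+ (size g).-1.
  rewrite /partial_height exchange_big; apply: eq_bigr => b _ /=.
  rewrite exchange_big; apply: eq_bigr => g _ /=.
  by rewrite prodrXl.
rewrite -big_split /=; apply: ler_prod => b bb; rewrite -big_split /=.
rewrite big_seq prodr_ge0 /=; last first.
  by move=> g gin; rewrite exprn_ge0 // maxnorm_ge0 //; apply: lplace_ge0 gin.
rewrite [leRHS]big_seq; apply: ler_prod => g gin.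
have va := lplace_above (@tb b) gin; have [hv hva] := va.
have wE := to_absValueE hv.
rewrite exprn_ge0 /=; last by rewrite maxnorm_ge0 //; apply: lplace_ge0 gin.
rewrite -exprMn; apply: lerXn2r; rewrite ?nnegrE.
- by rewrite maxnorm_ge0 //; apply: lplace_ge0 gin.
- rewrite mulr_ge0 //; first by rewrite /Cb; case: ifP.
  by apply: prodr_ge0 => j _; rewrite maxnorm_ge0 //; apply: lplace_ge0 gin.
rewrite /Cb; have [b0|b0] := eqVneq b 0%N; first by rewrite -wE; apply: hC.
rewrite mul1r -wE; apply: hu; apply: (above_ultrametric bb b0); by rewrite wE.
Qed.

Lemma field_height_le_l2 (I : finType) (x : I -> K) : (exists i, x i != 0) ->
  field_height R x <= field_l2_height R x.
Proof.
move=> x0; have [N0 h0] := local_height_eq1_almost R D x0.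
pose N := N0.+1; have hN (P : pred nat) b : (N <= b)%N -> isbase b && P b -> forall v : K -> R,
    place_above (base_abs R b) v -> local_height v x = 1.
  by move=> hb /andP [bb _]; apply: h0 bb; apply: leq_trans hb.
have lh0 v : 0 <= local_height v x :> R.
  rewrite /local_height; elim: (index_enum I) => [|i s IH]; first by rewrite big_nil.
  by rewrite big_cons le_max IH orbT.
rewrite /field_height /field_l2_height placesE finite_placesE infinite_placesE.
rewrite (@prod_places _ _ D predT (fun v => local_height v x) N) //; last exact: hN.
rewrite (@prod_places _ _ D (predC1 0%N) (fun v => local_height v x) N) //; last exact: hN.
rewrite (@prod_places _ _ D (pred1 0%N) (fun v => local_l2_height v x) 1); last first.
  by move=> b b1 /andP [_ /eqP b0]; rewrite b0 in b1.
have l20 v : 0 <= local_l2_height v x :> R by apply: powR_ge0.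
have finE : \prod_(0 <= b < N | isbase b && predC1 0%N b) \prod_(g <- lf b) local_height (lplace D g) x =
    \prod_(1 <= b < N | isbase b) \prod_(g <- lf b) local_height (lplace D g) x.
  rewrite big_ltn_cond //= [LHS]big_mkcond [RHS]big_mkcond.
  by apply: eq_big_nat => b /andP [b0 _] /=; rewrite -lt0n b0 andbT.
have infE : \prod_(0 <= b < 1 | isbase b && pred1 0%N b) \prod_(g <- lf b) local_l2_height (lplace D g) x =
    \prod_(g <- lf 0) local_l2_height (lplace D g) x.
  by rewrite big_ltn_cond //= big_geq ?mulr1.
rewrite finE infE.
have -> : \prod_(0 <= b < N | isbase b && predT b) \prod_(g <- lf b) local_height (lplace D g) x =
    (\prod_(1 <= b < N | isbase b) \prod_(g <- lf b) local_height (lplace D g) x) *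
    \prod_(g <- lf 0) local_height (lplace D g) x.
  rewrite big_ltn_cond //= mulrC; congr (_ * _).
  by apply: eq_bigl => b; rewrite andbT.
have P0 b : 0 <= \prod_(g <- lf b) local_height (lplace D g) x by apply: prodr_ge0.
apply: ge0_ler_powR; rewrite ?invr_ge0 ?nnegrE //.
- by apply: mulr_ge0 => //; apply: prodr_ge0.
- by apply: mulr_ge0; apply: prodr_ge0.
apply: ler_wpM2l; first exact: prodr_ge0.
rewrite big_seq [leRHS]big_seq; apply: ler_prod => g gin; rewrite lh0 /=.
have [hv _] := lplace_above (@tb 0%N) gin.
have v0 := lplace_ge0 gin.
rewrite (local_height_lplace _ gin) /local_l2_height (local_degree_lplace (@tb 0%N) gin).
have S0 : 0 <= \sum_i lplace D g (x i) ^+ 2.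
  by apply: sumr_ge0 => i _; rewrite exprn_ge0.
have m0 : 0 <= maxnorm (lplace D g) x by apply: maxnorm_ge0.
rewrite mulrC powRrM powR_mulrn ?powR_ge0 //; apply: lerXn2r; rewrite ?nnegrE ?powR_ge0 //.
rewrite powR12_sqrt //; apply: maxnorm_le; first exact: sqrtr_ge0.
move=> i; rewrite -[leLHS]ger0_norm // -sqrtr_sqr ler_sqrt // (bigD1 i) //=.
by rewrite lerDl; apply: sumr_ge0 => j _; rewrite exprn_ge0.
Qed.

End FieldHeights.

(** * Heights of algebraic vectors *)

Section FieldHeightExtension.
Variables (R : realType) (K K' : fieldExtType rat).
Variables (D : primitive_data K) (D' : primitive_data K') (sigma : {rmorphism K -> K'}).

Local Notation lf b := (local_factors (base_abs R b) D).
Local Notation lf' b := (local_factors (base_abs R b) D').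
Let tb b := @base_abs_totally_bounded R b.

(** The places above a place [v] of the smaller field restrict to [v], and
    their local degrees add up to that of [v] times the relative degree, which
    the root of order the degree cancels. *)
Lemma field_height_ext (I : finType) (x : I -> K) : (exists i, x i != 0) ->
  field_height R (fun i => sigma (x i)) = field_height R x.
Proof.
move=> x0.
have sx0 : exists i, sigma (x i) != 0 by case: x0 => i xi; exists i; rewrite fmorph_eq0.
have [N1 h1] := field_height_partial R D x0.
have [N2 h2] := field_height_partial R D' sx0.
pose N := maxn N1 N2; rewrite (h1 N) ?(h2 N) ?leq_maxl ?leq_maxr //.
have d0 : (0 < \dim {:K})%N by apply: adim_gt0.
have [e [e0 de _]] := extension_degrees (@tb 0%N) D D' sigma.
have -> : partial_height R D' N (fun i => sigma (x i)) = partial_height R D N x ^+ e.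
  rewrite /partial_height -prodrXl; apply: eq_bigr => b bb.
  have [e' [_ de' he']] := extension_degrees (@tb b) D D' sigma.
  have ee : e' = e by apply/eqP; rewrite -(eqn_pmul2r d0) -de' -de.
  subst e'; rewrite -prodrXl.
  have -> : \prod_(g' <- lf' b) maxnorm (lplace D' g') (fun i => sigma (x i)) ^+ (size g').-1 =
    \prod_(g' <- lf' b) \prod_(g <- lf b | lplace D' g' \o sigma == lplace D g)
       maxnorm (lplace D g) x ^+ (size g').-1.
    rewrite big_seq [RHS]big_seq; apply: eq_bigr => g' gin'.
    have [g gin hg] := factor_above D sigma gin'.
    have gE := lplace_restrict (@tb b) gin' gin hg.
    have [_ lu _] := local_factorsP (base_abs R b) D.
    rewrite big_mkcond (bigD1_seq g) //= gE eqxx big1_seq ?mulr1.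
      by rewrite -gE.
    move=> h /andP [hg' hin]; case: eqP => // hE.
    by move: hg'; rewrite (lplace_inj (@tb b) gin hin hE) eqxx.
  under eq_bigr => g' _ do rewrite big_mkcond.
  rewrite exchange_big big_seq [RHS]big_seq; apply: eq_bigr => g gin /=.
  by rewrite -big_mkcond /= -expr_sum (he' g gin) mulnC exprM.
have p0 := partial_height_ge0 R D N x.
rewrite de natrM invfM powRrM; congr (_ `^ _).
by rewrite -powR_mulrn // -powRrM mulfV ?powRr1 // pnatr_eq0 -lt0n.
Qed.

End FieldHeightExtension.

(** The image of the primitive element determines an embedding, and its images
    satisfy the same rational relations. *)
Lemma embedding_extend (K K3 : fieldExtType rat) (D : primitive_data K)
    (iota : {rmorphism K -> algC}) (iota3 : {rmorphism K3 -> algC}) (t : K3) :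
  iota3 t = iota (prim D) ->
  exists sigma : {rmorphism K -> K3}, forall x, iota3 (sigma x) = iota x.
Proof.
move=> ht.
have H x : exists z, iota3 z = iota x.
  have [P ->] := prim_surj D x; exists (horner_alg t P).
  have E (L : fieldExtType rat) (j : {rmorphism L -> algC}) u :
      j (horner_alg u P) = (map_poly (ratr : rat -> algC) P).[j u].
    rewrite -horner_map -map_poly_comp; congr horner; apply: eq_map_poly => q /=.
    exact: fmorph_eq_rat (j \o in_alg L : {rmorphism rat -> algC}) q.
  by rewrite !E ht.
have [s hs] := choice H.
have sB : zmod_morphism s.
  by move=> x y; apply: (fmorph_inj iota3); rewrite rmorphB !hs rmorphB.
have sM : monoid_morphism s.
  split=> [|x y]; first by apply: (fmorph_inj iota3); rewrite hs !rmorph1.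
  by apply: (fmorph_inj iota3); rewrite rmorphM !hs rmorphM.
pose sr := HB.pack_for {rmorphism K -> K3} s
  (GRing.isZmodMorphism.Build _ _ s sB) (GRing.isMonoidMorphism.Build _ _ s sM).
by exists sr.
Qed.

Section Heights.
Variable R : realType.

Lemma common_model (J : finType) (y : J -> algC) :
  exists (K : fieldExtType rat) (iota : {rmorphism K -> algC}) (y' : J -> K),
    forall j, iota (y' j) = y j.
Proof.
by have [K iota y' h] := number_field_model_of y; exists K, iota, y'.
Qed.

(** Two number fields containing the coordinates are compared through a third
    one that contains both. *)
Lemma heightE (I : finType) (K : fieldExtType rat) (iota : {rmorphism K -> algC})
    (x' : I -> K) (x : I -> algC) :
  (forall i, iota (x' i) = x i) -> (exists i, x i != 0) ->
  height R x = field_height R x'.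
Proof.
move=> hx [i0 xi0]; rewrite /height.
case: (number_field_model_of x) => K0 iota0 x0 h0 /=.
pose D := primitive_data_of K; pose D0 := primitive_data_of K0.
have [K3 [iota3 [t ht]]] := common_model (fun b : bool => if b then iota (prim D) else iota0 (prim D0)).
have [s hs] := embedding_extend (ht true).
have [s0 hs0] := embedding_extend (ht false).
pose D3 := primitive_data_of K3.
have xi : x' i0 != 0 by rewrite -(fmorph_eq0 iota) hx.
have xi' : x0 i0 != 0 by rewrite -(fmorph_eq0 iota0) h0.
rewrite -(field_height_ext R D D3 s); last by exists i0.
rewrite -(field_height_ext R D0 D3 s0); last by exists i0.
congr field_height; apply/funext => i; apply: (fmorph_inj iota3).
by rewrite hs hs0 hx h0.
Qed.

Lemma height_scale (I : finType) (c : algC) (x : I -> algC) : c != 0 ->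
  (exists i, x i != 0) -> height R (fun i => c * x i) = height R x.
Proof.
move=> c0 [i0 xi0].
have [K [iota [z hz]]] := common_model (fun o : option I => if o is Some i then x i else c).
have hc := hz None; have hx i := hz (Some i); rewrite /= in hc hx.
have zi : z (Some i0) != 0 by rewrite -(fmorph_eq0 iota) hx.
rewrite (heightE (x' := fun i => z None * z (Some i)) (iota := iota)); last first.
- by exists i0; rewrite mulf_neq0.
- by move=> i; rewrite rmorphM hc hx.
rewrite (heightE (x' := fun i => z (Some i)) (iota := iota)) //; last by exists i0.
rewrite (field_height_scale R (primitive_data_of K)) //; last by exists i0.
by rewrite -(fmorph_eq0 iota) hc.
Qed.

Lemma height_ge1 (I : finType) (x : I -> algC) : (exists i, x i != 0) -> 1 <= height R x.
Proof.
move=> [i0 xi0].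
rewrite -(@height_scale _ (x i0)^-1 x) ?invr_eq0 //; last by exists i0.
set y := fun i => _; have yi : y i0 = 1 by rewrite /y mulVf.
have [K [iota [z hz]]] := common_model y.
rewrite (heightE hz); last by exists i0; rewrite yi oner_neq0.
apply: (field_height_ge1 R (primitive_data_of K) (i := i0)).
by apply: (fmorph_inj iota); rewrite hz yi rmorph1.
Qed.

Lemma height_dom (I J : finType) (Jf : J -> finType) (x : I -> algC)
    (y : forall j, Jf j -> algC) (C : R) : 0 <= C ->
  (exists i, x i != 0) -> (forall j, exists t, y j t != 0) ->
  (forall (K : fieldExtType rat) (iota : {rmorphism K -> algC}) (x' : I -> K)
     (y' : forall j, Jf j -> K),
     (forall i, iota (x' i) = x i) -> (forall j t, iota (y' j t) = y j t) ->
     (forall w : absValue R K, maxnorm w x' <= C * \prod_j maxnorm w (y' j)) /\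
     (forall w : absValue R K, ultrametric w -> maxnorm w x' <= \prod_j maxnorm w (y' j))) ->
  height R x <= C * \prod_j height R (y j).
Proof.
move=> C0 [i0 xi0] y0 H.
have [K [iota [z hz]]] := common_model
  (fun u : I + {j : J & Jf j} => match u with inl i => x i | inr jt => y (tag jt) (tagged jt) end).
pose x' i := z (inl i); pose y' (j : J) (t : Jf j) : K := z (inr (Tagged Jf t)).
have hx i : iota (x' i) = x i by rewrite /x' hz.
have hy j (t : Jf j) : iota (y' j t) = y j t by rewrite /y' hz.
have [h1 h2] := H K iota x' y' hx hy.
rewrite (heightE hx); last by exists i0.
have -> : \prod_j height R (y j) = \prod_j field_height R (y' j).
  by apply: eq_bigr => j _; apply: heightE (hy j) (y0 j).
apply: (field_height_dom (primitive_data_of K)) => //.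
- by exists i0; rewrite -(fmorph_eq0 iota) hx.
- by move=> j; have [t yt] := y0 j; exists t; rewrite -(fmorph_eq0 iota) hy.
Qed.

Lemma height_le_l2 (I : finType) (x : I -> algC) : (exists i, x i != 0) ->
  height R x <= l2_height R x.
Proof.
move=> [i0 xi0]; rewrite /height /l2_height.
case: (number_field_model_of x) => K iota x' hx /=.
apply: (field_height_le_l2 R (primitive_data_of K)).
by exists i0; rewrite -(fmorph_eq0 iota) hx.
Qed.

End Heights.

(** * Domination of heights *)

Section Tensor.
Variable R : realType.

Lemma maxnorm_tensor (K : fieldType) (w : absValue R K) (I J : finType)
    (x : I -> K) (y : J -> K) :
  maxnorm w (fun p : I * J => x p.1 * y p.2) = maxnorm w x * maxnorm w y.
Proof.
have w0 := abs_ge0 w; apply/eqP; rewrite eq_le; apply/andP; split.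
  apply: maxnorm_le => [|p]; first by rewrite mulr_ge0 ?maxnorm_ge0.
  by rewrite absM ler_pM ?maxnorm_ge.
suff H u : 0 <= u -> (forall i, w (x i) * maxnorm w y <= u) -> maxnorm w x * maxnorm w y <= u.
  apply: H => [|i]; first exact: maxnorm_ge0.
  suff H' u : 0 <= u -> (forall j, w (x i) * w (y j) <= u) -> w (x i) * maxnorm w y <= u.
    by apply: H' => [|j]; [exact: maxnorm_ge0 | rewrite -absM; exact: (maxnorm_ge w (fun p : I * J => x p.1 * y p.2) (i, j))].
  move=> u0 h; have [xi|xi] := eqVneq (w (x i)) 0; first by rewrite xi mul0r.
  have xp : 0 < w (x i) by rewrite lt0r xi w0.
  rewrite mulrC -ler_pdivlMr //; apply: maxnorm_le => [|j]; first by rewrite divr_ge0.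
  by rewrite ler_pdivlMr // mulrC.
move=> u0 h; have [yi|yi] := eqVneq (maxnorm w y) 0; first by rewrite yi mulr0.
have yp : 0 < maxnorm w y by rewrite lt0r yi maxnorm_ge0.
rewrite -ler_pdivlMr //; apply: maxnorm_le => [|j]; first by rewrite divr_ge0 // ltW.
by rewrite ler_pdivlMr.
Qed.

Lemma field_height_tensor (K : fieldExtType rat) (I J : finType) (x : I -> K) (y : J -> K) :
  (exists i, x i != 0) -> (exists j, y j != 0) ->
  field_height R (fun p : I * J => x p.1 * y p.2) = field_height R x * field_height R y.
Proof.
move=> x0 y0; pose D := primitive_data_of K.
have xy0 : exists p : I * J, x p.1 * y p.2 != 0.
  by case: x0 y0 => i xi [j yj]; exists (i, j); rewrite mulf_neq0.
have [N1 h1] := field_height_partial R D x0.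
have [N2 h2] := field_height_partial R D y0.
have [N3 h3] := field_height_partial R D xy0.
pose N := maxn N1 (maxn N2 N3).
rewrite (h1 N) ?(h2 N) ?(h3 N); try by rewrite /N; lia.
rewrite -powRM ?partial_height_ge0 //; congr (_ `^ _).
rewrite /partial_height -big_split; apply: eq_bigr => b bb /=.
rewrite -big_split /= big_seq [RHS]big_seq; apply: eq_bigr => g gin.
have [hv _] := lplace_above (@base_abs_totally_bounded R b) gin.
by rewrite -exprMn -(to_absValueE hv) maxnorm_tensor.
Qed.

Lemma height_tensor (I J : finType) (x : I -> algC) (y : J -> algC) :
  (exists i, x i != 0) -> (exists j, y j != 0) ->
  height R (fun p : I * J => x p.1 * y p.2) = height R x * height R y.
Proof.
move=> [i xi] [j yj].
have [K [iota [z hz]]] := common_model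
  (fun u : I + J => match u with inl i => x i | inr j => y j end).
have hx i' : iota (z (inl i')) = x i' by rewrite hz.
have hy i' : iota (z (inr i')) = y i' by rewrite hz.
rewrite (heightE R hx); last by exists i.
rewrite (heightE R hy); last by exists j.
rewrite -field_height_tensor.
- apply: (@heightE R _ K iota) => [p|]; first by rewrite rmorphM hx hy.
  by exists (i, j); rewrite mulf_neq0.
- by exists i; rewrite -(fmorph_eq0 iota) hx.
- by exists j; rewrite -(fmorph_eq0 iota) hy.
Qed.

End Tensor.

Section VectorHeights.
Variable R : realType.

(** The height, extended by the value 1 at the zero vector so that it is
    always at least 1. *)
Definition vheight (I : finType) (x : I -> algC) : R :=
  if [exists i, x i != 0] then height R x else 1.

Lemma vheight_height (I : finType) (x : I -> algC) i : x i != 0 -> vheight x = height R x.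
Proof. by move=> xi; rewrite /vheight ifT //; apply/existsP; exists i. Qed.

Lemma vheight_ge1 (I : finType) (x : I -> algC) : 1 <= vheight x.
Proof.
rewrite /vheight; case: ifPn => [/existsP h|//]; exact: height_ge1.
Qed.

Lemma vheight_ge0 (I : finType) (x : I -> algC) : 0 <= vheight x.
Proof. exact: le_trans ler01 (vheight_ge1 x). Qed.

Lemma vheight_zero (I : finType) (x : I -> algC) : (forall i, x i = 0) -> vheight x = 1.
Proof.
by move=> h; rewrite /vheight ifF //; apply/negbTE/existsPn => i; rewrite h eqxx.
Qed.

Lemma vheight_scale (I : finType) (c : algC) (x : I -> algC) : c != 0 ->
  vheight (fun i => c * x i) = vheight x.
Proof.
move=> c0; have [[i xi]|h] := pselect (exists i, x i != 0).
  rewrite (vheight_height xi) (vheight_height (i := i)) ?mulf_neq0 // height_scale //.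
  by exists i.
have x0 i : x i = 0 by apply/eqP; apply: contraT => xi; case: h; exists i.
by rewrite !vheight_zero // => i; rewrite x0 mulr0.
Qed.

Lemma vheight_tensor (I J : finType) (x : I -> algC) (y : J -> algC) :
  vheight (fun p : I * J => x p.1 * y p.2) <= vheight x * vheight y.
Proof.
have [[i xi]|h] := pselect (exists i, x i != 0); last first.
  rewrite vheight_zero ?mulr_ege1 ?vheight_ge1 // => p; case: (eqVneq (x p.1) 0) => [->|xp]; first by rewrite mul0r.
  by case: h; exists p.1.
have [[j yj]|h] := pselect (exists i, y i != 0); last first.
  rewrite vheight_zero ?mulr_ege1 ?vheight_ge1 // => p; case: (eqVneq (y p.2) 0) => [->|xp]; first by rewrite mulr0.
  by case: h; exists p.2.
rewrite (vheight_height xi) (vheight_height yj) (vheight_height (i := (i, j))) ?mulf_neq0 //.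
by rewrite height_tensor //; [exists i | exists j].
Qed.

(** The second hypothesis makes the convention at the zero vector harmless: a
    factor can vanish only if [x] does. *)
Lemma vheight_dom (I J : finType) (Jf : J -> finType) (x : I -> algC)
    (y : forall j, Jf j -> algC) (C : R) : 1 <= C ->
  (forall j, (forall t, y j t = 0) -> forall i, x i = 0) ->
  (forall (K : fieldExtType rat) (iota : {rmorphism K -> algC}) (x' : I -> K)
     (y' : forall j, Jf j -> K),
     (forall i, iota (x' i) = x i) -> (forall j t, iota (y' j t) = y j t) ->
     (forall w : absValue R K, maxnorm w x' <= C * \prod_j maxnorm w (y' j)) /\
     (forall w : absValue R K, ultrametric w -> maxnorm w x' <= \prod_j maxnorm w (y' j))) ->
  vheight x <= C * \prod_j vheight (y j).
Proof.
move=> C1 y0 H; have [[i xi]|h] := pselect (exists i, x i != 0); last first.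
  have P1 : 1 <= \prod_j vheight (y j).
    by elim/big_ind: _ => // [u v|j _]; [exact: mulr_ege1 | exact: vheight_ge1].
  rewrite vheight_zero; first by rewrite mulr_ege1.
  by move=> i; apply/eqP; apply: contraT => xi; case: h; exists i.
have yn j : exists t, y j t != 0.
  apply: contrapT => nh; move: xi; rewrite (y0 j) ?eqxx // => t.
  by apply/eqP; apply: contraT => yt; case: nh; exists t.
rewrite (vheight_height xi); have -> : \prod_j vheight (y j) = \prod_j height R (y j).
  by apply: eq_bigr => j _; have [t yt] := yn j; rewrite (vheight_height yt).
apply: height_dom => //; first exact: le_trans ler01 C1.
by exists i.
Qed.

Lemma abs_signed_sum (K : fieldType) (w : absValue R K) (T : Type) (s : seq (bool * T))
    (z : T -> K) (M : R) : (forall t, w (z t) <= M) ->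
  w (\sum_(u <- s) (-1) ^+ u.1 * z u.2) <= (size s)%:R * M.
Proof.
move=> hM; apply: le_trans (abs_sum _ _ _ _) _.
elim: s => [|u s IH]; first by rewrite big_nil mul0r.
rewrite big_cons /= -add1n natrD mulrDl mul1r lerD //.
by rewrite abs_sign.
Qed.

Lemma ultra_signed_sum (K : fieldType) (w : absValue R K) (T : Type) (s : seq (bool * T))
    (z : T -> K) (M : R) : ultrametric w -> 0 <= M -> (forall t, w (z t) <= M) ->
  w (\sum_(u <- s) (-1) ^+ u.1 * z u.2) <= M.
Proof.
move=> wu M0 hM; elim: s => [|u s IH]; first by rewrite big_nil abs0.
by rewrite big_cons; apply: le_trans (wu _ _) _; rewrite ge_max IH andbT abs_sign.
Qed.

(** At ultrametric places the number of terms of a sum does not count, and at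
    archimedean ones it counts for [C]. *)
Lemma vheight_sum_prod (I J T : finType) (x : I -> algC) (y : J -> T -> algC) (C : nat) :
  (0 < C)%N ->
  (forall i, exists s : seq (bool * (J -> T)), (size s <= C)%N /\
     x i = \sum_(u <- s) (-1) ^+ u.1 * \prod_j y j (u.2 j)) ->
  vheight x <= C%:R * \prod_j vheight (y j).
Proof.
move=> C0 H; apply: vheight_dom; first by rewrite ler1n.
  move=> j yj i; have [s [_ ->]] := H i; apply: big1 => u _.
  by rewrite (bigD1 j) //= yj mul0r mulr0.
move=> K iota x' y' hx hy.
have H' i : exists s : seq (bool * (J -> T)), (size s <= C)%N /\
     x' i = \sum_(u <- s) (-1) ^+ u.1 * \prod_j y' j (u.2 j).
  have [s [hs e]] := H i; exists s; split=> //.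
  apply: (fmorph_inj iota); rewrite hx e rmorph_sum; apply: eq_bigr => u _.
  by rewrite rmorphM rmorph_sign rmorph_prod; congr (_ * _); apply: eq_bigr => j _; rewrite hy.
have P0 (w : absValue R K) : 0 <= \prod_j maxnorm w (y' j).
  by apply: prodr_ge0 => j _; apply: maxnorm_ge0; apply: abs_ge0.
have term (w : absValue R K) (t : J -> T) : w (\prod_j y' j (t j)) <= \prod_j maxnorm w (y' j).
  by rewrite abs_prod; apply: ler_prod => j _; rewrite abs_ge0 maxnorm_ge.
split=> w; last first.
  move=> wu; apply: maxnorm_le => // i; have [s [_ ->]] := H' i.
  by apply: (@ultra_signed_sum _ w _ s (fun t : J -> T => \prod_j y' j (t j))).
apply: maxnorm_le => [|i]; first by rewrite mulr_ge0.
have [s [hs ->]] := H' i.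
apply: le_trans (@abs_signed_sum _ w _ s (fun t : J -> T => \prod_j y' j (t j)) _ (term w)) _.
by rewrite ler_wpM2r // ler_nat.
Qed.

Lemma vheight_sum (I T : finType) (x : I -> algC) (y : T -> algC) (C : nat) : (0 < C)%N ->
  (forall i, exists s : seq (bool * T), (size s <= C)%N /\
     x i = \sum_(u <- s) (-1) ^+ u.1 * y u.2) ->
  vheight x <= C%:R * vheight y.
Proof.
move=> C0 H; have -> : vheight y = \prod_(j : 'I_1) vheight y by rewrite big_ord1.
apply: (@vheight_sum_prod I 'I_1 T x (fun=> y)) => // i.
have [s [hs e]] := H i; exists [seq (u.1, fun=> u.2) | u <- s]; rewrite size_map; split=> //.
by rewrite e big_map; apply: eq_bigr => u _; rewrite big_ord1.
Qed.

Lemma vheight_sub (I T : finType) (x : I -> algC) (y : T -> algC) :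
  (forall i, x i = 0 \/ exists (b : bool) t, x i = (-1) ^+ b * y t) -> vheight x <= vheight y.
Proof.
move=> H; rewrite -[leRHS]mul1r; apply: (@vheight_sum I T x y 1) => // i.
case: (H i) => [->|[b [t ->]]]; first by exists [::]; rewrite big_nil.
by exists [:: (b, t)]; rewrite big_seq1.
Qed.

Lemma vheight_01 (I : finType) (x : I -> algC) : (forall i, x i = 0 \/ x i = 1) -> vheight x <= 1.
Proof.
move=> h; have P1 : \prod_(j : void) vheight (fun _ : unit => (0 : algC)) = 1 :> R by apply: big1 => -[].
rewrite -P1 -[leRHS]mul1r.
apply: (@vheight_sum_prod I void unit x (fun _ _ => 0) 1) => // i.
case: (h i) => ->; first by exists [::]; rewrite big_nil.
exists [:: (false, fun=> tt)]; split=> //; rewrite big_seq1 expr0 mul1r.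
by apply/esym/big1 => -[].
Qed.

(** The Mahler inequality in degree 2, place by place. If the absolute values
    of [a] and [b] are both at most 1 or both at least 1, then 1 or that of
    [ab] is the product of the maxima; otherwise the larger one differs from
    [a + b] by a number of size at most 1. *)
Lemma vheight_roots (a b : algC) :
  vheight (fun i : 'I_2 => if val i == 0%N then a else 1) * vheight (fun i : 'I_2 => if val i == 0%N then b else 1)
  <= 2 * vheight (fun i : 'I_3 => if val i == 0%N then 1 else if val i == 1%N then a + b else a * b).
Proof.
set x := fun i : 'I_2 => _; set y := fun i : 'I_2 => _; set z := fun i : 'I_3 => _.
have x1 : x (lift ord0 ord0) = 1 by [].
have y1 : y (lift ord0 ord0) = 1 by [].
have nz1 : 1 != 0 :> algC := oner_neq0 _.
have -> : vheight x * vheight y = vheight (fun p : 'I_2 * 'I_2 => x p.1 * y p.2).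
  rewrite (vheight_height (x := x) (i := lift ord0 ord0)) ?x1 //.
  rewrite (vheight_height (x := y) (i := lift ord0 ord0)) ?y1 //.
  rewrite (vheight_height (i := (lift ord0 ord0, lift ord0 ord0))) /= ?x1 ?y1 ?mulr1 //.
  by rewrite height_tensor //; exists (lift ord0 ord0); rewrite ?x1 ?y1.
have -> : vheight z = \prod_(j : 'I_1) vheight z by rewrite big_ord1.
apply: (@vheight_dom _ 'I_1 (fun=> 'I_3 : finType) _ (fun=> z)); first by rewrite ler1n.
  by move=> _ /(_ ord0) /eqP; rewrite /z /= (negPf nz1).
move=> K iota x' y' hx hy.
pose a' := x' (ord0, lift ord0 ord0); pose b' := x' (lift ord0 ord0, ord0).
have ha : iota a' = a by rewrite /a' hx /x /y /= mulr1.
have hb : iota b' = b by rewrite /b' hx /x /y /= mul1r.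
have zE0 : y' ord0 ord0 = 1 by apply: (fmorph_inj iota); rewrite hy rmorph1.
have zE1 : y' ord0 (@Ordinal 3 1 isT) = a' + b'.
  by apply: (fmorph_inj iota); rewrite hy rmorphD ha hb.
have zE2 : y' ord0 (@Ordinal 3 2 isT) = a' * b'.
  by apply: (fmorph_inj iota); rewrite hy rmorphM ha hb.
(* [C] is 2 at archimedean places and 1 at ultrametric ones. *)
have key (w : absValue R K) C : 1 <= C -> (forall u v, w u <= C * Num.max (w (u + v)) (w v)) ->
    maxnorm w x' <= C * maxnorm w (y' ord0).
  move=> C1 hC; have := abs_ge0 w a'; have := abs_ge0 w b' => wb wa.
  set M := maxnorm w (y' ord0).
  have M1 : 1 <= M by rewrite -(abs1 w) -zE0; apply: maxnorm_ge.
  have Ms : w (a' + b') <= M by rewrite -zE1; apply: maxnorm_ge.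
  have Mp : w a' * w b' <= M by rewrite -absM -zE2; apply: maxnorm_ge.
  have M0 : 0 <= M by lra.
  have CM : M <= C * M by nra.
  have ab : w a' <= C * M /\ w b' <= C * M.
    have [a1|a1] := leP (w a') 1; have [b1|b1] := leP (w b') 1.
    - by split; nra.
    - split; first by nra.
      apply: le_trans (hC b' a') _; apply: ler_wpM2l; first exact: le_trans ler01 C1.
      by rewrite ge_max addrC Ms (le_trans a1 M1).
    - split; last by nra.
      apply: le_trans (hC a' b') _; apply: ler_wpM2l; first exact: le_trans ler01 C1.
      by rewrite ge_max Ms (le_trans b1 M1).
    - by split; nra.
  apply: maxnorm_le => [|[i j]]; first by lra.
  have -> : x' (i, j) = (if val i == 0%N then a' else 1) * (if val j == 0%N then b' else 1).
    apply: (fmorph_inj iota); rewrite hx /x /y /= rmorphM.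
    by congr (_ * _); case: ifP; rewrite ?ha ?hb ?rmorph1.
  rewrite absM; case: ifP => _; case: ifP => _; rewrite ?abs1 ?mulr1 ?mul1r; by case: ab; lra.
split=> w; rewrite big_ord1.
  apply: key; first by rewrite ler1n.
  move=> u v; have := absB w (u + v) v; rewrite addrK => h.
  have h1 : w (u + v) <= Num.max (w (u + v)) (w v) by rewrite le_max lexx.
  have h2 : w v <= Num.max (w (u + v)) (w v) by rewrite le_max lexx orbT.
  by move: (Num.max _ _) h1 h2 => m; lra.
move=> wu; rewrite -[leRHS]mul1r; apply: key => // u v.
by have := wu (u + v) (- v); rewrite addrK absN mul1r.
Qed.

End VectorHeights.

(** * Heights of matrices and Cramer's rule *)

Section MatrixHeights.
Variable R : realType.

Definition mxheight m n (A : 'M[algC]_(m, n)) : R := vheight R (fun p : 'I_m * 'I_n => A p.1 p.2).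

Lemma mxheight_ge1 m n (A : 'M_(m, n)) : 1 <= mxheight A. Proof. exact: vheight_ge1. Qed.

Lemma mxheight_ge0 m n (A : 'M_(m, n)) : 0 <= mxheight A. Proof. exact: vheight_ge0. Qed.

Lemma mxheight_scale m n (c : algC) (A : 'M_(m, n)) : c != 0 -> mxheight (c *: A) = mxheight A.
Proof.
move=> c0; rewrite /mxheight -(vheight_scale R (fun p : 'I_m * 'I_n => A p.1 p.2) c0); congr vheight.
by apply/funext => p; rewrite mxE.
Qed.

Lemma mxheight_tr m n (A : 'M_(m, n)) : mxheight A^T <= mxheight A.
Proof.
by apply: vheight_sub => p; right; exists false, (p.2, p.1); rewrite expr0 mul1r mxE.
Qed.

Lemma mxheight_mul m n p (A : 'M_(m, n)) (B : 'M_(n, p)) : (0 < n)%N ->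
  mxheight (A *m B) <= n%:R * (mxheight A * mxheight B).
Proof.
move=> n0; apply: le_trans (_ : n%:R * vheight R (fun q : ('I_m * 'I_n) * ('I_n * 'I_p) =>
    A q.1.1 q.1.2 * B q.2.1 q.2.2) <= _).
  apply: vheight_sum => // -[i k] /=.
  exists [seq (false, ((i, j), (j, k))) | j <- enum 'I_n]; split.
    by rewrite size_map size_enum_ord.
  by rewrite big_map big_enum /= mxE; apply: eq_bigr => j _; rewrite expr0 mul1r.
rewrite ler_pM2l ?ltr0n //.
exact: (vheight_tensor R (fun q : 'I_m * 'I_n => A q.1 q.2) (fun q : 'I_n * 'I_p => B q.1 q.2)).
Qed.

Lemma mxheight_congr m n (P : 'M_(m, n)) (F : 'M_n) : (0 < n)%N ->
  mxheight (P *m F *m P^T) <= n%:R ^+ 2 * mxheight P ^+ 2 * mxheight F.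
Proof.
move=> n0; apply: le_trans (mxheight_mul _ _ n0) _.
have h := mxheight_mul P F n0; have h' := mxheight_tr P.
have := mxheight_ge0 P; have := mxheight_ge0 F; have := mxheight_ge0 (P *m F); have := mxheight_ge0 P^T.
have nr : 0 <= n%:R :> R by [].
move: (mxheight (P *m F)) (mxheight P^T) (mxheight P) (mxheight F) h h' => u v s t h h' v0 u0 t0 s0.
have -> : n%:R ^+ 2 * s ^+ 2 * t = n%:R * ((n%:R * (s * t)) * s) :> R by ring.
by apply: ler_wpM2l => //; apply: ler_pM.
Qed.

Lemma mulmx_delta2 n (F : 'M[algC]_n) i j :
  delta_mx 0 i *m F *m (delta_mx 0 j)^T = (F i j)%:M :> 'M_1.
Proof.
by rewrite trmx_delta -rowE -colE; apply/matrixP => a b; rewrite !ord1 !mxE eqxx mulr1n.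
Qed.

(** A binary form has two zeros, and the product of their heights is bounded
    by a multiple of the height of the form, so the square of the smaller
    height is. *)
Lemma isotropic_binary n (F : 'M[algC]_n) : (2 <= n)%N ->
  exists x : 'rV_n, [/\ x != 0, x *m F *m x^T = 0 & mxheight x ^+ 2 <= 4 * mxheight F].
Proof.
case: n F => [|[|n]] // F _; set i0 : 'I_n.+2 := ord0; set i1 : 'I_n.+2 := lift ord0 ord0.
pose e0 : 'rV[algC]_n.+2 := delta_mx 0 i0; pose e1 : 'rV[algC]_n.+2 := delta_mx 0 i1.
have [F0|F0] := eqVneq (F i0 i0) 0.
  exists e0; split.
  - by apply/eqP => /rowP /(_ i0); rewrite !mxE !eqxx => /eqP; rewrite oner_eq0.
  - by rewrite mulmx_delta2 F0 raddf0.
  - apply: le_trans (_ : 1 <= _); last by have := mxheight_ge1 F; lra.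
    rewrite exprn_ile1 ?mxheight_ge0 //; apply: vheight_01 => -[u j]; rewrite /= mxE.
    by case: (_ && _); [right | left].
pose a := F i0 i0; pose b := F i0 i1 + F i1 i0; pose c := F i1 i1.
pose s := sqrtC (b ^+ 2 - 4 * a * c).
have s2 : s ^+ 2 = b ^+ 2 - 4 * a * c by rewrite sqrtCK.
pose r1 := (- b + s) / (2 * a); pose r2 := (- b - s) / (2 * a).
have a0 : a != 0 := F0.
have two0 : 2 != 0 :> algC by rewrite pnatr_eq0.
have sumr : r1 + r2 = - b / a by rewrite /r1 /r2; field; rewrite a0.
have prodr : r1 * r2 = c / a.
  have -> : r1 * r2 = (b ^+ 2 - s ^+ 2) / (4 * a ^+ 2) by rewrite /r1 /r2; field; rewrite a0.
  by rewrite s2; field; rewrite a0.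
have root r : r \in [:: r1; r2] -> a * r ^+ 2 + b * r + c = 0.
  have -> : a * r ^+ 2 + b * r + c = a * ((r - r1) * (r - r2)).
    have -> : (r - r1) * (r - r2) = r ^+ 2 - (r1 + r2) * r + r1 * r2 by ring.
    by rewrite sumr prodr; field.
  by rewrite !inE => /orP [/eqP ->|/eqP ->]; rewrite subrr ?mul0r ?mulr0.
pose zz := fun i : 'I_3 => if val i == 0%N then 1 else if val i == 1%N then r1 + r2 else r1 * r2.
(* The coefficients of the form are, up to a common factor, the symmetric
   functions of its roots; the middle one is the sum of two equal entries of
   the matrix, whence the 2. *)
have hz : vheight R zz <= 2 * mxheight F.
  rewrite -(vheight_scale R zz a0); apply: vheight_sum => // i; rewrite /zz.
  case: ifP => _; first by exists [:: (false, (i0, i0))]; rewrite big_seq1 expr0 mul1r mulr1.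
  case: ifP => _.
    exists [:: (true, (i0, i1)); (true, (i1, i0))]; rewrite big_cons big_seq1 /=; split=> //.
    by rewrite sumr /b expr1; field.
  exists [:: (false, (i1, i1))]; rewrite big_seq1 expr0 mul1r; split=> //.
  by rewrite prodr mulrC divfK.
have := vheight_roots R r1 r2; rewrite -/zz.
set h1 := vheight R (fun i : 'I_2 => if val i == 0%N then r1 else 1).
set h2 := vheight R (fun i : 'I_2 => if val i == 0%N then r2 else 1) => h12.
have h1p : 0 <= h1 := vheight_ge0 _ _; have h2p : 0 <= h2 := vheight_ge0 _ _.
have [r [rin hr]] : exists r, r \in [:: r1; r2] /\
    vheight R (fun i : 'I_2 => if val i == 0%N then r else 1) ^+ 2 <= 4 * mxheight F.
  have [le12|lt21] := leP h1 h2.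
    exists r1; split; first by rewrite mem_head.
    by rewrite -/h1 expr2; apply: le_trans (ler_wpM2l h1p le12) _; lra.
  exists r2; split; first by rewrite !inE eqxx orbT.
  by rewrite -/h2 expr2; apply: le_trans (ler_wpM2r h2p (ltW lt21)) _; lra.
exists (r *: e0 + e1); split.
- apply/eqP => /rowP /(_ i1); rewrite !mxE !eqxx /=.
  by rewrite mulr0 add0r => /eqP; rewrite oner_eq0.
- rewrite linearD linearZ /= mulmxDl !mulmxDr -!scalemxAl !mulmxDl -!scalemxAl -!scalemxAr.
  rewrite -?scalemxAl !mulmx_delta2; apply/matrixP => u v; rewrite !ord1 !mxE eqxx !mulr1n.
  by rewrite -[RHS](root r rin) /a /b /c; ring.
- apply: le_trans hr; apply: lerXn2r; rewrite ?nnegrE ?mxheight_ge0 ?vheight_ge0 //.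
  apply: vheight_sub => -[u j]; rewrite /= !mxE !ord1 eqxx /=.
  have [->|j0] := eqVneq j i0.
    by right; exists false, ord0; rewrite /= expr0 mul1r mulr1 addr0.
  have [_|j1] := eqVneq j i1; last by left; rewrite mulr0 addr0.
  by right; exists false, (lift ord0 ord0); rewrite /= expr0 mul1r mulr0 add0r.
Qed.

End MatrixHeights.

Section Cramer.
Variable F : fieldType.

Definition replace_col r n (g : 'I_r -> 'I_n) (i : 'I_r) (j : 'I_n) : 'I_r -> 'I_n :=
  fun i' => if i' == i then j else g i'.

Lemma cramer r n (A : 'M[F]_(r, n)) (g : 'I_r -> 'I_n) i j :
  (\adj (colsub g A) *m A) i j = \det (colsub (replace_col g i j) A).
Proof.
rewrite (expand_det_col _ i) mxE; apply: eq_bigr => l _.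
rewrite !mxE /replace_col eqxx mulrC; congr (_ * _).
rewrite /cofactor; congr (_ * \det _); apply/matrixP => u v; rewrite !mxE.
by rewrite eq_sym (negPf (neq_lift _ _)).
Qed.

(** The matrix [A] brought to the reduced form having the identity in the
    columns [g]. Its entries are quotients of maximal minors, by Cramer's
    rule. *)
Definition reduced r n (A : 'M[F]_(r, n)) (g : 'I_r -> 'I_n) : 'M[F]_(r, n) :=
  invmx (colsub g A) *m A.

Section Reduced.
Variables (r n : nat) (A : 'M[F]_(r, n)) (g : 'I_r -> 'I_n).
Hypothesis D0 : \det (colsub g A) != 0.

Let unitD : colsub g A \in unitmx. Proof. by rewrite unitmxE unitfE. Qed.

Lemma reducedE i j :
  \det (colsub g A) * reduced A g i j = \det (colsub (replace_col g i j) A).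
Proof.
rewrite /reduced /invmx unitD -scalemxAl mxE mulrA divff // mul1r.
exact: cramer.
Qed.

Lemma reduced_id : colsub g (reduced A g) = 1%:M.
Proof. by rewrite -mulmx_colsub mulVmx. Qed.

Lemma reducedK : colsub g A *m reduced A g = A.
Proof. by rewrite /reduced mulmxA mulmxV // mul1mx. Qed.

Lemma pivot_inj : injective g.
Proof.
move=> i j gij; apply/eqP; apply: contraT => ij; move: D0.
rewrite -det_tr (determinant_alternate ij) ?eqxx // => l.
by rewrite !mxE gij.
Qed.

End Reduced.

Lemma exists_pivots r n (A : 'M[F]_(r, n)) : row_free A ->
  exists g : 'I_r -> 'I_n, \det (colsub g A) != 0.
Proof.
move=> fA; have full : row_full A^T by rewrite /row_full mxrank_tr.
exists (fullrankfun full); have := fullrowsub_unit full.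
by rewrite unitmxE unitfE -det_tr trmx_mxsub trmxK.
Qed.

End Cramer.

Section Minors.
Variable R : realType.

Definition minor r n (A : 'M[algC]_(r, n)) (h : {ffun 'I_r -> 'I_n}) : algC :=
  \det (colsub h A).

Lemma minor_det r n (A : 'M[algC]_(r, n)) (h : 'I_r -> 'I_n) :
  \det (colsub h A) = minor A (finfun h).
Proof. by congr (\det _); apply/matrixP => i j; rewrite !mxE ffunE. Qed.

(** The Leibniz formula writes a minor as a signed sum of [r`!] products with
    one factor from every row. *)
Lemma vheight_minor_rows r n (A : 'M[algC]_(r, n)) :
  vheight R (minor A) <= (r`!)%:R * \prod_(l < r) mxheight R (row l A).
Proof.
apply: le_trans (_ : (r`!)%:R * \prod_(l < r) vheight R (A l) <= _); last first.
  rewrite ler_pM2l ?ltr0n ?fact_gt0 //; apply: ler_prod => l _; rewrite vheight_ge0 /=.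
  by apply: vheight_sub => j; right; exists false, (ord0, j); rewrite expr0 mul1r mxE.
apply: vheight_sum_prod; first exact: fact_gt0.
move=> h; exists [seq (odd_perm s, fun l => h (s l)) | s : 'S_r <- enum {: 'S_r}]; split.
  by rewrite size_map -cardE card_Sn.
rewrite big_map big_enum /=; apply: eq_bigr => s _; congr (_ * _).
by apply: eq_bigr => l _; rewrite mxE.
Qed.

Lemma mxheight_reduced r n (A : 'M[algC]_(r, n)) (g : 'I_r -> 'I_n) :
  \det (colsub g A) != 0 -> mxheight R (reduced A g) <= vheight R (minor A).
Proof.
move=> D0; rewrite -(mxheight_scale R (reduced A g) D0).
apply: vheight_sub => -[i j]; right; exists false, (finfun (replace_col g i j)).
by rewrite /= mxE reducedE // expr0 mul1r minor_det.
Qed.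

(** The permutation gives the rank of each value of [h]. *)
Lemma sort_columns L N (h : 'I_L -> 'I_N) : injective h ->
  exists (f : increasing_maps L N) (s : 'S_L), forall i, h i = val f (s i).
Proof.
move=> hinj; pose r (u v : 'I_N) := (val u <= val v)%N.
pose l := sort r (codom h).
have sl : size l = L by rewrite size_sort size_codom card_ord.
have ul : uniq l by rewrite sort_uniq map_inj_uniq ?enum_uniq.
have ml i : h i \in l by rewrite mem_sort codom_f.
have sorted_l : sorted ltn (map val l).
  rewrite ltn_sorted_uniq_leq map_inj_uniq ?ul /=; last exact: val_inj.
  by rewrite sorted_map; apply: sort_sorted => u v; apply: leq_total.
pose t : L.-tuple 'I_N := tcast sl (in_tuple l).
have tl : t = l :> seq _ by rewrite val_tcast.
pose f : {ffun 'I_L -> 'I_N} := [ffun i => tnth t i].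
have fP : [forall i : 'I_L, forall j : 'I_L, (i < j)%N ==> (f i < f j)%N].
  apply/forallP => i; apply/forallP => j; apply/implyP => ij; rewrite !ffunE.
  rewrite !(tnth_nth (f i)) tl -!(nth_map _ 0%N val) ?sl //.
  by apply: (sorted_ltn_nth ltn_trans) => //; rewrite inE size_map sl.
have sP i : (index (h i) l < L)%N by apply: (@leq_trans (size l)); [rewrite index_mem | rewrite sl].
pose s0 (i : 'I_L) : 'I_L := Ordinal (sP i).
have s0inj : injective s0.
  move=> i j /(congr1 val) /= e; apply: hinj.
  by rewrite -(nth_index (h i) (ml i)) e nth_index.
exists (exist _ f fP), (perm s0inj) => i /=.
by rewrite permE ffunE (tnth_nth (h i)) tl /= nth_index.
Qed.

(** A repeated column gives the minor 0, and sorting the columns changes at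
    most the sign. *)
Lemma vheight_minor_increasing L N (B : 'M[algC]_(L, N)) :
  vheight R (minor B) <= vheight R (maximal_minors B).
Proof.
apply: vheight_sub => h; have [hi|hni] := boolP (injectiveb h); last first.
  left; have /injectivePn [i [j ij hij]] := hni.
  by rewrite /minor -det_tr (determinant_alternate ij) // => l; rewrite !mxE hij.
right; have [f [s hs]] := sort_columns (injectiveP _ hi).
exists (s : bool), f; rewrite /minor /maximal_minors.
have -> : colsub h B = col_perm s (colsub (val f) B).
  by apply/matrixP => i j; rewrite !mxE hs.
by rewrite col_permE det_mulmx det_perm odd_permV mulrC.
Qed.

(** The basis in reduced row echelon form, whose entries are quotients of
    Pluecker coordinates of [V]. *)
Lemma subspace_basis N (V : {vspace 'rV[algC]_N}) :
  exists P : 'M[algC]_(\dim V, N), [/\ row_free P, forall x, x *m P \in V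
    & mxheight R P <= subspace_height R V].
Proof.
set B := basis_matrix V.
have rowB i : row i B = tnth (vbasis V) i by apply/rowP => j; rewrite !mxE.
have comb (x : 'rV_(\dim V)) : x *m B = \sum_i x 0 i *: tnth (vbasis V) i.
  by rewrite mulmx_sum_row; apply: eq_bigr => i _; rewrite rowB.
have fB : row_free B.
  rewrite -kermx_eq0; apply/rowV0P => x /sub_kermxP; rewrite comb => x0.
  have := basis_free (vbasisP V); move/freeP => /(_ (fun i => x 0 i)) H.
  apply/rowP => i; rewrite mxE; apply: H => //.
  by rewrite -[RHS]x0; apply: eq_bigr => j _; rewrite (tnth_nth 0).
have inV (x : 'rV_(\dim V)) : x *m B \in V.
  rewrite comb; apply: rpred_sum => i _; apply: rpredZ.
  by apply: vbasis_mem; apply: mem_tnth.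
have [g D0] := exists_pivots fB.
exists (reduced B g); split.
- by rewrite /row_free mxrankMfree ?fB //; rewrite mxrank_unit // unitmx_inv unitmxE unitfE.
- by move=> x; rewrite /reduced mulmxA.
- apply: le_trans (mxheight_reduced D0) _; apply: le_trans (vheight_minor_increasing B) _.
  have [f [s fs]] := sort_columns (pivot_inj D0).
  have ne : maximal_minors B f != 0.
    apply: contraNneq D0; rewrite /maximal_minors => e.
    have -> : colsub g B = col_perm s (colsub (val f) B).
      by apply/matrixP => i j; rewrite !mxE fs.
    by rewrite col_permE det_mulmx e mul0r.
  rewrite (vheight_height R ne) /subspace_height; apply: height_le_l2.
  by exists f.
Qed.

End Minors.

(** * The orthogonal of an isotropic vector *)

Section PolarSubspace.
Variable R : realType.
Local Notation mxheight := (mxheight R).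

Lemma fact_le_expn r n : (r <= n)%N -> (r`! <= n ^ r)%N.
Proof.
elim: r => [|r IH] rn; first by rewrite fact0 expn0.
by rewrite factS expnS leq_mul // IH // ltnW.
Qed.

(** The vectors orthogonal to an isotropic vector [x1] for the first [j] forms
    are cut out by at most [j] linear equations. The kernel of such a system
    is parametrised by Cramer's rule; restricting to the parameters outside
    one nonzero coordinate [i0] of [x1] gives a complement of the line of
    [x1]. *)
Lemma polar_subspace j n (F : nat -> 'M[algC]_n) (x1 : 'rV_n) :
  x1 != 0 -> (forall m, (m < j)%N -> x1 *m F m *m x1^T = 0) ->
  exists n' (W : 'M[algC]_(n', n)) (i0 : 'I_n),
  [/\ [/\ (n <= n' + j + 1)%N & (n' <= n)%N],
      (forall y, y *m W = 0 -> y = 0 :> 'rV_n'),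
      x1 0 i0 != 0 /\ (forall y : 'rV_n', (y *m W) 0 i0 = 0),
      (forall m, (m < j)%N -> x1 *m F m *m W^T = 0)
    & mxheight W <= n%:R ^+ (2 * j) * mxheight x1 ^+ j * \prod_(m < j) mxheight (F m)].
Proof.
move=> x10 iso.
have n0 : (0 < n)%N.
  by case: n F x1 x10 iso => // F x1; rewrite [x1]thinmx0 eqxx.
pose L0 : 'M_(j, n) := \matrix_(m < j) (x1 *m F m).
(* A maximal independent set of equations [L], in reduced form [L'] with pivot
   columns [g]. *)
pose rho := maxrankfun L0; set r := \rank L0 in rho.
pose L : 'M_(r, n) := rowsub rho L0.
have fL : row_free L := maxrowsub_free L0.
have rj : (r <= j)%N := rank_leq_row L0.
have rn : (r <= n)%N := rank_leq_col L0.
have [g D0] := exists_pivots fL.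
pose D := \det (colsub g L); pose L' := reduced L g.
have ginj := pivot_inj D0.
have rowL0 (m : 'I_j) : row m L0 = x1 *m F m by rewrite rowK.
have L0x1 : L0 *m x1^T = 0.
  by apply/row_matrixP => m; rewrite row_mul rowL0 iso // row0.
have [B L0E] : exists B, L0 = B *m L'.
  have /submxP [B ->] : (L0 <= L)%MS by rewrite eq_maxrowsub.
  by exists (B *m colsub g L); rewrite -mulmxA reducedK.
have L'x1 : L' *m x1^T = 0.
  by rewrite /L' /reduced -mulmxA -[L]/(rowsub rho L0) mul_rowsub_mx L0x1 linear0 mulmx0.
(* A kernel vector is determined by its coordinates outside the pivots, so one
   of these coordinates of [x1] is not 0. *)
have [i0 i0g x1i0] : exists2 i0, i0 \notin codom g & x1 0 i0 != 0.
  apply: contrapT => H; move/eqP: x10; apply; apply/rowP => c; rewrite mxE.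
  have out i : i \notin codom g -> x1 0 i = 0.
    by move=> ig; apply/eqP; apply: contraT => xi; case: H; exists i.
  have [/codomP [i ->]|] := boolP (c \in codom g); last exact: out.
  have := congr1 (fun Z : 'cV_r => Z i 0) L'x1; rewrite !mxE (bigD1 (g i)) //=.
  have -> : L' i (g i) = 1.
    by have := congr1 (fun Z : 'M_r => Z i i) (reduced_id D0); rewrite !mxE eqxx.
  rewrite mul1r [x1^T _ _]mxE big1 ?addr0 // => c' cg.
  have [/codomP [i' ci']|c'n] := boolP (c' \in codom g); last by rewrite [x1^T _ _]mxE out ?mulr0.
  have := congr1 (fun Z : 'M_r => Z i i') (reduced_id D0); rewrite !mxE -ci' => ->.
  by rewrite (_ : i == i' = false) ?mul0r //; apply: contraNF cg => /eqP ->; rewrite ci'.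
(* The free parameters are the columns in [S]; [tau] enumerates them. *)
pose S : {set 'I_n} := [set c | (c \notin codom g) && (c != i0)].
pose tau (a : 'I_#|S|) : 'I_n := enum_val a.
have tauS a : (tau a \notin codom g) /\ (tau a != i0).
  by have := enum_valP a; rewrite inE => /andP [].
have tauinj : injective tau := enum_val_inj.
pose E : 'M[algC]_(r, n) := \matrix_(i, c) (g i == c)%:R.
pose W : 'M[algC]_(#|S|, n) := rowsub tau (1%:M - L'^T *m E).
have WE a c : W a c = (tau a == c)%:R - \sum_i L' i (tau a) * (g i == c)%:R.
  by rewrite !mxE; congr (_ - _); apply: eq_bigr => i _; rewrite !mxE.
have sumg a i : \sum_i' L' i' (tau a) * (g i' == g i)%:R = L' i (tau a).
  rewrite (bigD1 i) //= eqxx mulr1 big1 ?addr0 // => i' ii'.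
  by rewrite (inj_eq ginj) (negPf ii') mulr0.
have sumn a c : c \notin codom g -> \sum_i' L' i' (tau a) * (g i' == c)%:R = 0.
  move=> cg; apply: big1 => i _; rewrite (_ : g i == c = false) ?mulr0 //.
  by apply: contraNF cg => /eqP <-; apply: codom_f.
have WL' : W *m L'^T = 0.
  rewrite /W mul_rowsub_mx mulmxBl mul1mx -mulmxA.
  have -> : E *m L'^T = 1%:M.
    apply/matrixP => i i'; rewrite !mxE (bigD1 (g i)) //= mxE eqxx mul1r mxE.
    have := congr1 (fun Z : 'M_r => Z i' i) (reduced_id D0); rewrite !mxE => ->.
    rewrite big1 ?addr0 1?eq_sym // => c cg.
    by rewrite !mxE eq_sym (negPf cg) mul0r.
  by rewrite mulmx1 subrr linear0.
have yW y a : (y *m W) 0 (tau a) = y 0 a.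
  rewrite mxE (bigD1 a) //= WE eqxx sumn ?subr0 ?mulr1; last by case: (tauS a).
  rewrite big1 ?addr0 // => a' aa'; rewrite WE sumn; last by case: (tauS a).
  by rewrite (inj_eq tauinj) (negPf aa') subr0 mulr0.
exists #|S|, W, i0; split.
- split; last by have := max_card (mem S); rewrite card_ord.
  have : (#|~: S| <= r + 1)%N.
    have sub : (~: S) \subset ([set c in codom g] :|: [set i0]).
      by apply/fintype.subsetP => c; rewrite !inE negb_and !negbK.
    apply: leq_trans (subset_leq_card sub) _.
    apply: leq_trans (leq_card_setU _ _) _; rewrite cards1 leq_add2r cardsE.
    by rewrite card_codom // card_ord.
  have := cardsC S; rewrite card_ord; lia.
- by move=> y h; apply/rowP => a; rewrite -yW h !mxE.
- split=> // y; rewrite mxE big1 // => a _; rewrite WE sumn // subr0.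
  by case: (tauS a) => _ /negPf ->; rewrite mulr0.
- move=> m mj; have <- : row (Ordinal mj) L0 = x1 *m F m by rewrite rowL0.
  rewrite L0E row_mul -mulmxA -[L' *m W^T]trmxK trmx_mul trmxK WL'.
  by rewrite trmx0 mulmx0.
(* Multiplied by the pivot minor, the entries of [W] are minors of [L] up to
   sign. *)
- have h1 : mxheight W <= vheight R (minor L).
    rewrite -(mxheight_scale R W D0); apply: vheight_sub => -[a c] /=; rewrite mxE WE.
    have [/codomP [i ->]|cg] := boolP (c \in codom g).
      right; exists true, (finfun (replace_col g i (tau a))).
      rewrite sumg -minor_det -reducedE // expr1 mulN1r.
      rewrite (_ : tau a == g i = false) ?sub0r ?mulrN //.
      by case: (tauS a) => h _; apply: contraNF h => /eqP ->; apply: codom_f.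
    rewrite sumn // subr0; case: eqP => _; last by left; rewrite mulr0.
    by right; exists false, (finfun g); rewrite mulr1 expr0 mul1r minor_det.
  apply: le_trans h1 _; apply: le_trans (vheight_minor_rows R L) _.
  have nr1 : 1 <= n%:R :> R by rewrite ler1n.
  have rowb l : mxheight (row l L) <= n%:R * (mxheight x1 * mxheight (F (rho l))).
    have -> : row l L = x1 *m F (rho l) by rewrite row_rowsub rowL0.
    exact: mxheight_mul.
  apply: le_trans (_ : n%:R ^+ r * \prod_(l < r) (n%:R * (mxheight x1 * mxheight (F (rho l)))) <= _).
    apply: ler_pM; rewrite ?ler0n //.
    - by apply: prodr_ge0 => l _; apply: mxheight_ge0.
    - by rewrite -natrX ler_nat fact_le_expn.
    - by apply: ler_prod => l _; rewrite mxheight_ge0 rowb.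
  rewrite !big_split /= !prodr_const card_ord.
  have pF : \prod_(l < r) mxheight (F (rho l)) <= \prod_(m < j) mxheight (F m).
    have rinj : injective rho := @maxrankfun_inj _ _ _ L0.
    have -> : \prod_(l < r) mxheight (F (rho l)) = \prod_(m in [set rho l | l in [set: 'I_r]]) mxheight (F m).
      by rewrite big_imset /=; [apply: eq_bigl => l; rewrite inE | move=> u v _ _; apply: rinj].
    rewrite [leRHS](bigID (fun m : 'I_j => m \in [set rho l | l in [set: 'I_r]])) /=.
    rewrite -[leLHS]mulr1; apply: ler_wpM2l; first by apply: prodr_ge0 => m _; apply: mxheight_ge0.
    by elim/big_ind: _ => // [u v|m _]; [exact: mulr_ege1 | exact: mxheight_ge1].
  have P0 : 0 <= \prod_(l < r) mxheight (F (rho l)) by apply: prodr_ge0 => l _; apply: mxheight_ge0.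
  rewrite mulnC -[(_ * 2)%N]/(j * 2)%N muln2 -addnn exprD -!mulrA.
  have nj : n%:R ^+ r <= n%:R ^+ j :> R by rewrite ler_weXn2l.
  have xj : mxheight x1 ^+ r <= mxheight x1 ^+ j by rewrite ler_weXn2l ?mxheight_ge1.
  have n0' : 0 <= n%:R ^+ r :> R by rewrite exprn_ge0.
  have x0' : 0 <= mxheight x1 ^+ r by rewrite exprn_ge0 ?mxheight_ge0.
  by do !(apply: ler_pM; rewrite ?mulr_ge0 //).
Qed.

End PolarSubspace.

(** * The induction on the number of forms *)

(** The arithmetic of the induction step, for the squares of heights: [X1] and
    [X2] are those of the two vectors spanning the plane [U2], [w2] that of
    the basis of the complement, [y2] that of the coordinates of the second
    vector in it, and [X] that of the common zero; [A] is the product of the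
    heights of the first [j] forms. All terms are compared as monomials in [m]
    and [A]. *)
Lemma step_bound (R : realType) (j gam s : nat) (m A X1 w2 y2 X2 U2 X H : R) :
  2 <= m -> 1 <= A -> 0 <= X1 -> 0 <= w2 -> 0 <= y2 -> 0 <= X2 -> 0 <= U2 -> 0 <= H ->
  X1 <= m ^+ gam * A ^+ s -> w2 <= (m ^+ (2 * j)) ^+ 2 * X1 ^+ j * A ^+ 2 ->
  y2 <= m ^+ gam * (m ^+ (2 * j) * w2 ^+ j * A) ^+ s -> X2 <= m ^+ 2 * (y2 * w2) ->
  U2 <= X1 * X2 -> X <= 2 ^+ 4 * m ^+ 2 * U2 ^+ 2 * H ->
  X <= m ^+ (10 + 4 * gam + 4 * j * s + 2 * j * (4 + gam) * (j * s + 1)) *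
       A ^+ (4 * s + 2 * j ^ 2 * s ^ 2 + 6 * j * s + 4) * H.
Proof.
move=> m2 A1 X10 w20 y20 X20 U20 H0 hX1 hw2 hy2 hX2 hU2 hX.
have m0 : 0 <= m by apply: le_trans m2.
have A0 : 0 <= A by apply: le_trans A1.
(* An opaque name for monomials, so that only exponents are computed. *)
have [pw pwE] : exists pw : nat -> nat -> R, forall a b, pw a b = m ^+ a * A ^+ b.
  by exists (fun a b => m ^+ a * A ^+ b).
have pw0 a b : 0 <= pw a b by rewrite pwE mulr_ge0 ?exprn_ge0.
have pwM a b c d : pw a b * pw c d = pw (a + c)%N (b + d)%N by rewrite !pwE !exprD mulrACA.
have pwX a b e : pw a b ^+ e = pw (a * e)%N (b * e)%N by rewrite !pwE exprMn -!exprM.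
have mE a : m ^+ a = pw a 0%N by rewrite pwE mulr1.
have AE a : A ^+ a = pw 0%N a by rewrite pwE mul1r.
have A1E : A = pw 0%N 1%N by rewrite pwE mul1r.
pose w3 := pw (2 * j * 2 + gam * j)%N (s * j + 2)%N.
have w30 : 0 <= w3 by apply: pw0.
have {}hX1 : X1 <= pw gam s by rewrite pwE.
have {}hw2 : w2 <= w3.
  apply: le_trans hw2 _.
  apply: le_trans (_ : (m ^+ (2 * j)) ^+ 2 * pw gam s ^+ j * A ^+ 2 <= _).
    rewrite ler_wpM2r ?exprn_ge0 // ler_wpM2l ?exprn_ge0 //.
    by apply: lerXn2r; rewrite ?nnegrE.
  by rewrite mE AE !pwX !pwM !mul0n !add0n !addn0.
pose y3 := m ^+ gam * (m ^+ (2 * j) * w3 ^+ j * A) ^+ s.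
have {}hy2 : y2 <= y3.
  apply: le_trans hy2 _; rewrite ler_wpM2l ?exprn_ge0 //.
  apply: lerXn2r; rewrite ?nnegrE ?mulr_ge0 ?exprn_ge0 //.
  rewrite ler_wpM2r // ler_wpM2l ?exprn_ge0 //.
  by apply: lerXn2r; rewrite ?nnegrE.
have {}hX2 : X2 <= m ^+ 2 * (y3 * w3).
  apply: le_trans hX2 _; rewrite ler_wpM2l ?exprn_ge0 //; exact: ler_pM.
have {}hU2 : U2 <= pw gam s * (m ^+ 2 * (y3 * w3)).
  by apply: le_trans hU2 _; apply: ler_pM.
apply: le_trans hX _; rewrite ler_wpM2r //.
apply: le_trans (_ : m ^+ 4 * m ^+ 2 * (pw gam s * (m ^+ 2 * (y3 * w3))) ^+ 2 <= _).
  apply: ler_pM; rewrite ?mulr_ge0 ?exprn_ge0 //.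
    by rewrite ler_wpM2r ?exprn_ge0 //; apply: lerXn2r; rewrite ?nnegrE.
  by apply: lerXn2r; rewrite ?nnegrE //; apply: le_trans hU2.
rewrite -pwE /y3 /w3 [in leLHS]A1E [in leLHS]mE.
rewrite !mE !(pwX, pwM) le_eqVlt; apply/orP; left; apply/eqP.
by congr (pw _ _); rewrite -?mulnn; ring.
Qed.

Lemma prod_last_le (R : realType) (j s : nat) (G : nat -> R) : (0 < j)%N -> (0 < s)%N ->
  (forall i, 1 <= G i) ->
  (\prod_(i < j.-1) G i) ^+ s * G j.-1 <= (\prod_(i < j) G i) ^+ s.
Proof.
move=> j0 s0 G1; have -> : \prod_(i < j) G i = \prod_(i < j.-1) G i * G j.-1.
  by case: j j0 => // j' _; rewrite big_ord_recr.
rewrite exprMn; apply: ler_wpM2l.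
  by rewrite exprn_ge0 // prodr_ge0 // => i _; apply: le_trans ler01 (G1 i).
by rewrite -{1}[G _]expr1; apply: ler_weXn2l.
Qed.

Section CommonZero.
Variable R : realType.
Local Notation mxheight := (mxheight R).

(** The bound is stated for the squares of heights, so that all the exponents
    are integers. The last form enters to the first power only, because of
    [isotropic_binary]. The parameter [M] is kept apart from [n] so that the
    constant does not depend on the subspaces of the induction. *)
Definition common_zero_bound (k gam s : nat) := forall (n M : nat) (F : nat -> 'M[algC]_n),
  ('C(k.+1, 2) < n)%N -> (n <= M)%N -> (forall m, (m < k)%N -> (F m)^T = F m) ->
  exists x : 'rV_n, [/\ x != 0, forall m, (m < k)%N -> x *m F m *m x^T = 0
    & mxheight x ^+ 2 <= M%:R ^+ gam * (\prod_(m < k.-1) mxheight (F m)) ^+ s * mxheight (F k.-1)].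

Lemma common_zero1 : common_zero_bound 1 2 1.
Proof.
move=> n M F n1 nM _; rewrite binn in n1; have [x [x0 xF hx]] := isotropic_binary R (F 0) n1.
exists x; split=> // [[|m] //|].
rewrite big_ord0 expr1 mulr1 /=; apply: le_trans hx _.
rewrite ler_wpM2r ?mxheight_ge0 // -natrX ler_nat.
by rewrite -[4%N]/(2 ^ 2)%N leq_exp2r //; apply: leq_trans nM.
Qed.

Lemma prod_mxheight_ge1 n (j : nat) (F : nat -> 'M[algC]_n) : 1 <= \prod_(m < j) mxheight (F m).
Proof. by elim/big_ind: _ => // [u v|m _]; [exact: mulr_ege1 | exact: mxheight_ge1]. Qed.

(** Once each vector has a coordinate 1, the entries of both appear among the
    products of an entry of one with an entry of the other. *)
Lemma normalized_pair n (x1 x2 : 'rV[algC]_n) : x1 != 0 -> x2 != 0 ->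
  exists c1 c2, [/\ c1 != 0, c2 != 0 & mxheight (col_mx (c1 *: x1) (c2 *: x2)) <= mxheight x1 * mxheight x2].
Proof.
move=> /rV0Pn [i1 h1] /rV0Pn [i2 h2].
exists (x1 0 i1)^-1, (x2 0 i2)^-1; rewrite !invr_eq0; split=> //.
set u := _ *: x1; set v := _ *: x2.
have u1 : u 0 i1 = 1 by rewrite mxE mulVf.
have v1 : v 0 i2 = 1 by rewrite mxE mulVf.
rewrite -(mxheight_scale R x1 (c := (x1 0 i1)^-1)) ?invr_eq0 // -/u.
rewrite -(mxheight_scale R x2 (c := (x2 0 i2)^-1)) ?invr_eq0 // -/v.
apply: le_trans (vheight_tensor R (fun p : 'I_1 * 'I_n => u p.1 p.2) (fun p : 'I_1 * 'I_n => v p.1 p.2)).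
apply: vheight_sub => -[a c] /=; right; exists false.
case: (split_ordP a) => a' ->; rewrite ?col_mxEu ?col_mxEd !ord1.
  by exists ((0, c), (0, i2)); rewrite /= v1 mulr1 expr0 mul1r.
by exists ((0, i1), (0, c)); rewrite /= u1 !mul1r.
Qed.

(** A zero [x1] of the first [j] forms is completed by a zero [x2] in a
    complement of it inside its orthogonal, giving a plane on which these
    forms vanish, and the last form has a zero in that plane. *)
Lemma common_zero_step j gam s : (0 < j)%N -> (0 < s)%N -> common_zero_bound j gam s ->
  common_zero_bound j.+1 (10 + 4 * gam + 4 * j * s + 2 * j * (4 + gam) * (j * s + 1))
                         (4 * s + 2 * j ^ 2 * s ^ 2 + 6 * j * s + 4).
Proof.
move=> j0 s0 IH n M F hn nM sym.
have bin : 'C(j.+2, 2) = ('C(j.+1, 2) + j.+1)%N by rewrite binS bin1.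
have hn1 : ('C(j.+1, 2) < n)%N by apply: leq_ltn_trans hn; rewrite bin leq_addr.
have symj m : (m < j)%N -> (F m)^T = F m by move=> mj; apply: sym; apply: ltnW.
have [x1 [x10 x1F hx1]] := IH n M F hn1 nM symj.
have [n' [W [i0 [[nn' n'n] Wfree [x1i0 Wi0] x1W hW]]]] := polar_subspace R x10 x1F.
have hn' : ('C(j.+1, 2) < n')%N by lia.
have n'M : (n' <= M)%N by apply: leq_trans nM.
have symW m : (m < j)%N -> (W *m F m *m W^T)^T = W *m F m *m W^T.
  by move=> mj; rewrite !trmx_mul trmxK symj // mulmxA.
have [y [y0 yF hy]] := IH n' M (fun m => W *m F m *m W^T) hn' n'M symW.
(* [x2] is kept opaque, so that terms remain small. *)
have [x2 x2E] : exists x2, x2 = y *m W by exists (y *m W).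
have x20 : x2 != 0 by apply: contraNneq y0 => h; apply/eqP/Wfree; rewrite -x2E.
have x2i0 : x2 0 i0 = 0 by rewrite x2E.
have F22 m : (m < j)%N -> x2 *m F m *m x2^T = 0.
  by move=> mj; rewrite x2E trmx_mul -[RHS](yF m mj) !mulmxA.
have F12 m : (m < j)%N -> x1 *m F m *m x2^T = 0.
  by move=> mj; rewrite x2E trmx_mul !mulmxA x1W // mul0mx.
have F21 m : (m < j)%N -> x2 *m F m *m x1^T = 0.
  move=> mj; have := congr1 trmx (F12 m mj).
  by rewrite !trmx_mul trmxK symj // trmx0 mulmxA.
have [c1 [c2 [c10 c20 hU]]] := normalized_pair x10 x20.
set U := col_mx _ _ in hU.
have [z [z0 zF hz]] := isotropic_binary R (U *m F j *m U^T) (leqnn 2).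
have zU : z *m U = lsubmx (z : 'rV_(1 + 1)) *m (c1 *: x1) + rsubmx (z : 'rV_(1 + 1)) *m (c2 *: x2).
  by rewrite -{1}[z](hsubmxK (z : 'rV_(1 + 1))) mul_row_col.
pose x := z *m U.
exists x; split.
(* The coordinate [i0] separates [x1] from [x2], hence these are independent.
   *)
- apply/eqP => x00.
  have : x 0 i0 = 0 by rewrite x00 mxE.
  rewrite /x zU !mxE !big_ord1 !mxE x2i0 !mulr0 addr0 => /eqP.
  rewrite !mulf_eq0 (negPf c10) (negPf x1i0) !orbF => /eqP zl.
  have zl0 : lsubmx (z : 'rV_(1 + 1)) = 0 by apply/matrixP => a b; rewrite !ord1 !mxE.
  move: x00; rewrite /x zU zl0 mul0mx add0r => zr.
  have zr0 : rsubmx (z : 'rV_(1 + 1)) = 0.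
    apply/matrixP => a b; rewrite !ord1 !mxE; move: x20 => /rV0Pn [i2 x2i].
    have := congr1 (fun Z : 'rV_n => Z 0 i2) zr; rewrite !mxE big_ord1 !mxE => /eqP.
    by rewrite !mulf_eq0 (negPf c20) (negPf x2i) !orbF => /eqP.
  by move/eqP: z0; apply; rewrite -[z](hsubmxK (z : 'rV_(1 + 1))) zl0 zr0 row_mx0.
- move=> m; rewrite ltnS leq_eqVlt => /orP [/eqP ->|mj].
    by rewrite /x trmx_mul -[RHS]zF !mulmxA.
  have UFU : U *m F m *m U^T = 0.
    have Z (c c' : algC) (u v : 'rV_n) : u *m F m *m v^T = 0 -> (c *: u) *m F m *m (c' *: v)^T = 0.
      by move=> h; rewrite linearZ /= -scalemxAr -!scalemxAl h !scaler0.
    rewrite /U mul_col_mx tr_col_mx mul_col_row !Z ?F22 ?F12 ?F21 ?x1F //.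
    exact: block_mx0.
  by rewrite /x trmx_mul !mulmxA -(mulmxA z) -(mulmxA z) UFU mulmx0 mul0mx.
rewrite /=.
have n2 : (2 <= n)%N.
  by apply: leq_trans hn; rewrite bin ltnS; apply: leq_trans (leq_addl _ _).
have n0 : (0 < n)%N := ltnW n2.
have n'0 : (0 < n')%N := leq_ltn_trans (leq0n _) hn'.
set A : R := \prod_(i < j) mxheight (F i).
have A1 : 1 <= A := prod_mxheight_ge1 j F.
have A0 : 0 <= A := le_trans ler01 A1.
set m : R := M%:R.
have nr : n%:R <= m by rewrite /m ler_nat.
have n'r : n'%:R <= m by rewrite /m ler_nat.
have m2 : 2 <= m by rewrite /m ler_nat; apply: leq_trans nM.
have m0 : 0 <= m := ler0n _ _.
have le_sq (u v : R) : 0 <= u -> u <= v -> u ^+ 2 <= v ^+ 2.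
  by move=> u0 uv; rewrite lerXn2r ?nnegrE // (le_trans u0 uv).
have congr_le (a : nat) (Q : 'M[algC]_(a, n)) (G : 'M[algC]_n) :
    mxheight (Q *m G *m Q^T) <= m ^+ 2 * mxheight Q ^+ 2 * mxheight G.
  apply: le_trans (mxheight_congr R Q G n0) _.
  by do 2!(rewrite ler_wpM2r ?exprn_ge0 ?mxheight_ge0 //); apply: le_sq; rewrite ?ler0n.
apply: (@step_bound R j gam s m A (mxheight x1 ^+ 2) (mxheight W ^+ 2) (mxheight y ^+ 2) (mxheight x2 ^+ 2) (mxheight U ^+ 2)).
- exact: m2.
- exact: A1.
- exact: exprn_ge0 (mxheight_ge0 R _).
- exact: exprn_ge0 (mxheight_ge0 R _).
- exact: exprn_ge0 (mxheight_ge0 R _).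
- exact: exprn_ge0 (mxheight_ge0 R _).
- exact: exprn_ge0 (mxheight_ge0 R _).
- exact: mxheight_ge0.
- apply: le_trans hx1 _; rewrite -/m -mulrA ler_wpM2l ?exprn_ge0 //.
  by apply: (prod_last_le j0 s0 (G := fun i => mxheight (F i))) => i; apply: mxheight_ge1.
- have -> : (m ^+ (2 * j)) ^+ 2 * (mxheight x1 ^+ 2) ^+ j * A ^+ 2 = (m ^+ (2 * j) * mxheight x1 ^+ j * A) ^+ 2.
    rewrite (exprMn 2 (_ * _) A) (exprMn 2 (_ ^+ _)); congr (_ * _ * _); exact: exprAC.
  apply: le_sq; first exact: mxheight_ge0.
  apply: le_trans hW _; rewrite ler_wpM2r // ler_wpM2r ?exprn_ge0 ?mxheight_ge0 //.
  by apply: lerXn2r; rewrite ?nnegrE ?ler0n.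
- apply: le_trans hy _; rewrite -/m -mulrA ler_wpM2l ?exprn_ge0 //.
  apply: le_trans (prod_last_le j0 s0 (G := fun i => mxheight (W *m F i *m W^T)) _) _.
    by move=> i; apply: mxheight_ge1.
  have P0 : 0 <= \prod_(i < j) mxheight (W *m F i *m W^T) := le_trans ler01 (prod_mxheight_ge1 j (fun i => W *m F i *m W^T)).
  have PA : \prod_(i < j) mxheight (W *m F i *m W^T) <= m ^+ (2 * j) * (mxheight W ^+ 2) ^+ j * A.
    apply: le_trans (_ : \prod_(i < j) (m ^+ 2 * mxheight W ^+ 2 * mxheight (F i)) <= _).
      by apply: ler_prod => i _; rewrite mxheight_ge0 congr_le.
    by rewrite big_split /= prodr_const card_ord exprMn -(exprM m).
  by rewrite lerXn2r // nnegrE ?P0 // (le_trans P0 PA).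
- rewrite x2E -!exprMn; apply: le_sq; first exact: mxheight_ge0.
  apply: le_trans (mxheight_mul R _ _ n'0) _.
  by rewrite ler_wpM2r ?mulr_ge0 ?mxheight_ge0.
- by rewrite -exprMn; apply: le_sq => //; apply: mxheight_ge0.
- have hx : mxheight x ^+ 2 <= 4 * (mxheight z ^+ 2 * mxheight U ^+ 2).
    have -> : 4 * (mxheight z ^+ 2 * mxheight U ^+ 2) = (2 * (mxheight z * mxheight U)) ^+ 2.
      by rewrite !exprMn -natrX.
    apply: le_sq; first exact: mxheight_ge0.
    rewrite /x; exact: (mxheight_mul R z U isT).
  apply: le_trans hx _.
  have -> : 2 ^+ 4 * m ^+ 2 * (mxheight U ^+ 2) ^+ 2 * mxheight (F j)
      = 4 * (4 * (m ^+ 2 * mxheight U ^+ 2 * mxheight (F j)) * mxheight U ^+ 2).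
    by move: (mxheight U) (mxheight (F j)) => u f; ring.
  rewrite ler_wpM2l // ler_wpM2r ?exprn_ge0 ?mxheight_ge0 //.
  by apply: le_trans hz _; rewrite ler_wpM2l.
Qed.

(** [gam <= 6 B_k] and [s <= 2 B_k] are preserved by the step, as B_k >=
    max(9, k). *)
Lemma step_exponents_le (k B gam s : nat) : (2 <= k)%N -> (9 <= B)%N -> (k <= B)%N ->
  (gam <= 6 * B)%N -> (s <= 2 * B)%N ->
  (10 + 4 * gam + 4 * k * s + 2 * k * (4 + gam) * (k * s + 1) <= 6 * (4 * k.+1 ^ 2 * B ^ 2))%N /\
  (4 * s + 2 * k ^ 2 * s ^ 2 + 6 * k * s + 4 <= 2 * (4 * k.+1 ^ 2 * B ^ 2))%N.
Proof.
move=> k2 B9 kB hg hs.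
have h1 : (k * B * k <= k * B * B)%N by rewrite leq_mul2l kB orbT.
have h2 : (9 * (k * B) <= k * B * B)%N by rewrite mulnC leq_mul2l B9 orbT.
have h3 : (9 * B <= B * B)%N by rewrite leq_mul2r B9 orbT.
have h4 : (9 * k <= k * B)%N by rewrite mulnC leq_mul2l B9 orbT.
split.
  apply: (@leq_trans (10 + 4 * (6 * B) + 4 * k * (2 * B) + 2 * k * (4 + 6 * B) * (k * (2 * B) + 1)))%N.
    by rewrite !leq_add ?leq_mul ?leq_add ?leq_mul.
  by rewrite -!mulnn; lia.
apply: (@leq_trans (4 * (2 * B) + 2 * k ^ 2 * (2 * B) ^ 2 + 6 * k * (2 * B) + 4))%N.
  by rewrite !leq_add ?leq_mul ?leq_exp2r.
by rewrite -!mulnn; lia.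
Qed.

(** An integral form of the constant of the theorem, through its recurrence.
    The value below 2 is a default. *)
Fixpoint Bnat (k : nat) : nat :=
  if k is k'.+1 then if (k' <= 1)%N then 9 else (4 * k ^ 2 * Bnat k' ^ 2)%N else 9.

Lemma BnatS k : (2 <= k)%N -> Bnat k.+1 = (4 * k.+1 ^ 2 * Bnat k ^ 2)%N.
Proof. by case: k => [|[|k]]. Qed.

Lemma Bnat_ge k : (2 <= k)%N -> (9 <= Bnat k)%N /\ (k <= Bnat k)%N.
Proof.
elim: k => // k IH; rewrite leq_eqVlt => /orP [/eqP <- //|k2].
have [h1 h2] := IH k2; rewrite BnatS //; move: (Bnat k) h1 h2 => B h1 h2.
have : (B <= B ^ 2)%N by rewrite -mulnn leq_pmulr //; lia.
have : (1 <= k.+1 ^ 2)%N by rewrite expn_gt0.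
by move: (k.+1 ^ 2)%N (B ^ 2)%N => u v; nia.
Qed.

Lemma common_zero k : (2 <= k)%N -> exists gam s,
  [/\ (0 < s)%N, (gam <= 6 * Bnat k)%N, (s <= 2 * Bnat k)%N & common_zero_bound k gam s].
Proof.
elim: k => // k IH; rewrite leq_eqVlt => /orP [/eqP [<-]|k2].
  (* For two forms, the step gives the exponents 54 and 16. *)
  have := @common_zero_step 1 2 1 isT isT common_zero1.
  by move=> h; do 2!eexists; split; last exact: h.
have [gam [s [s0 hg hs h]]] := IH k2.
have k0 : (0 < k)%N by apply: ltnW.
have [B9 kB] := Bnat_ge k2; have [e1 e2] := step_exponents_le k2 B9 kB hg hs.
do 2!eexists; split; last exact: (common_zero_step k0 s0 h); rewrite ?BnatS //.
by rewrite addn_gt0 orbT.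
Qed.

End CommonZero.

(** * The bound of the theorem *)

(** These are the comparisons of the exponents of the height of [V] and of
    [N]. The first one is an equality for [k = 2], where B_2 = 9, and has room
    for larger [k] since then B_k >= 324 (k - 1). *)
Lemma Bnat_exponents k L : (2 <= k)%N -> (k * (k + 1) %/ 2 + 1 <= L)%N ->
  (81 * (2 + 2 * k.-1 * Bnat k) <= 20 * Bnat k ^ 2)%N /\
  (27 * (2 + (2 * k + 1) * Bnat k) <= 10 * (L + 1) * Bnat k ^ 2)%N.
Proof.
move=> k2 hL; have kL : (k + 2 <= L)%N.
  apply: leq_trans hL; rewrite -[2%N]/(1 + 1)%N addnA leq_add2r leq_divRL //; nia.
have [B9 kB] := Bnat_ge k2; split.
  move: k2; rewrite leq_eqVlt => /orP [/eqP <- //|]; case: (k) => // j; rewrite ltnS => j2.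
  have [b9 _] := Bnat_ge j2; rewrite BnatS //=; set C := (4 * _ * _)%N.
  have hC : (324 * j <= C)%N.
    rewrite /C; have : (81 <= Bnat j ^ 2)%N by rewrite -[81%N]/(9 ^ 2)%N leq_exp2r.
    have : (j <= j.+1 ^ 2)%N by rewrite -mulnn; nia.
    by move: (j.+1 ^ 2)%N (Bnat j ^ 2)%N => u v; nia.
  have : (324 * (j * C) <= C ^ 2)%N by rewrite -mulnn mulnA leq_mul2r hC orbT.
  by have : (C <= j * C)%N; [rewrite leq_pmull //; lia | nia].
have : (9 * Bnat k <= Bnat k ^ 2)%N by rewrite -mulnn leq_mul2r B9 orbT.
move: (Bnat k) B9 => B B9; move: (B ^ 2)%N => B2 h.
have : (10 * (k + 3) * (9 * B) <= 10 * (L + 1) * B2)%N by apply: leq_mul => //; lia.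
by move=> h'; apply: leq_trans h'; nia.
Qed.

Lemma BconstE (R : realType) k : (2 <= k)%N -> Bconst R k = (Bnat k)%:R.
Proof.
have E (j : nat) : (2 <= j)%N ->
    Bconst R j.+1 = 4^-1 * 36 ^+ (2 ^ (j.+1 - 2)) *
       \prod_(3 <= m < j.+2) m%:R ^+ (2 ^ (j.+1 - m + 1)).
  by case: j => [|[|j]].
elim: k => // k IH; rewrite leq_eqVlt => /orP [/eqP <- //|k2].
have {}IH := IH k2; rewrite BnatS // natrM natrM !natrX -IH E //.
rewrite big_nat_recr //= subnn add0n expn1.
have -> : \prod_(3 <= m < k.+1) m%:R ^+ (2 ^ (k.+1 - m + 1)) =
    (\prod_(3 <= m < k.+1) m%:R ^+ (2 ^ (k - m + 1))) ^+ 2 :> R.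
  rewrite -prodrXl; apply: eq_big_nat => m /andP [_ mk].
  by rewrite -exprM -expnSr subSn // addSn.
move: k2; rewrite leq_eqVlt => /orP [/eqP [<-]|k3].
  by rewrite /Bconst eqxx big_geq // expr1n mul1r; field.
case: (k) k3 => // j j2; rewrite E //.
have -> : (j.+2 - 2 = (j.+1 - 2).+1)%N by lia.
by rewrite expnSr exprM; move: (\prod_(_ <= _ < _) _) (36 ^+ _) (j.+2%:R) => p q r; field.
Qed.

(** The power of 3 is at least 1, and the exponents of the other factors are
    compared by [Bnat_exponents]. *)
Lemma bound_of_integral_exponents (R : realType) (k N L : nat) (V P H : R) :
  (2 <= k)%N -> (k * (k + 1) %/ 2 + 1 <= L)%N -> (0 < N)%N -> 1 <= V -> 1 <= P -> 1 <= H ->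
  N%:R ^+ (2 + (2 * k + 1) * Bnat k) * V ^+ (2 + 2 * k.-1 * Bnat k) * P ^+ Bnat k * H <=
  (3 `^ (L%:R ^+ 2 / 2) * N%:R `^ (3 * (L%:R + 1) / 2) * V) `^ (20 * Bconst R k ^+ 2 / 81)
     * P `^ Bconst R k * H ^+ 2.
Proof.
move=> k2 hL N0 V1 P1 H1; have [hV hN] := Bnat_exponents k2 hL.
rewrite BconstE //; set B := Bnat k in hV hN *.
have V0 : 0 <= V := le_trans ler01 V1.
have P0 : 0 <= P := le_trans ler01 P1.
have H0 : 0 <= H := le_trans ler01 H1.
have N1 : 1 <= N%:R :> R by rewrite ler1n.
set E := 20 * _ / 81; set c := 3 * _ / 2.
have E0 : 0 <= E by rewrite /E !mulr_ge0 ?exprn_ge0 ?invr_ge0 ?ler0n.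
have hVE : (2 + 2 * k.-1 * B)%:R <= E.
  by rewrite /E ler_pdivlMr ?ltr0n // -natrX -!natrM ler_nat mulnC.
have hNE : (2 + (2 * k + 1) * B)%:R <= c * E.
  have -> : c * E = (10 * (L + 1) * B ^ 2)%:R / 27.
    by rewrite /c /E natrM natrM natrX natrD; field.
  by rewrite ler_pdivlMr ?ltr0n // -natrM ler_nat mulnC.
move: (2 + _ * B)%N (2 + _ * B)%N hNE hVE {hN hV} => a b hNE hVE.
rewrite powR_mulrn // powRM ?mulr_ge0 ?powR_ge0 // powRM ?powR_ge0 // -(powRrM N%:R).
apply: ler_pM; rewrite ?mulr_ge0 ?exprn_ge0 ?ler0n //; last by rewrite expr2 ler_peMl.
rewrite ler_wpM2r ?exprn_ge0 //.
apply: ler_pM; rewrite ?exprn_ge0 //; last first.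
  by rewrite -powR_mulrn // ler_powR.
rewrite -[leLHS]mul1r; apply: ler_pM; rewrite ?exprn_ge0 //; last first.
  by rewrite -powR_mulrn // ler_powR.
rewrite -powRrM -[leLHS](powRr0 3) ler_powR ?ler1n // mulr_ge0 //.
by rewrite !mulr_ge0 ?exprn_ge0 ?invr_ge0 ?ler0n.
Qed.

Lemma quad_evalE N (F : 'M[algC]_N) (w : 'rV[algC]_N) :
  quad_eval F w = (w *m F *m w^T) 0 0.
Proof.
rewrite /quad_eval mxE; under [RHS]eq_bigr do rewrite !mxE mulr_suml.
rewrite exchange_big; apply: eq_bigr => j _; apply: eq_bigr => i _.
by rewrite [_ * F _ _]mulrC mulrAC.
Qed.

(** The appended coordinate 1 repeats an entry of the vector. *)
Lemma affine_height_le (R : realType) N (w : 'rV[algC]_N) i : w 0 i = 1 ->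
  affine_height R w <= mxheight R w.
Proof.
move=> wi; rewrite /affine_height -(vheight_height R (i := None)) ?oner_neq0 //.
apply: vheight_sub => o; right; exists false; case: o => [a|].
  by exists (0, a); rewrite mul1r.
by exists (0, i); rewrite wi mulr1.
Qed.

Lemma form_heightE (R : realType) N (F : 'M[algC]_N) : F != 0 -> form_height R F = mxheight R F.
Proof.
move=> F0; have [[i j] Fij] : exists p, F p.1 p.2 != 0.
  apply: contrapT => h; move/eqP: F0; apply; apply/matrixP => i j; rewrite mxE.
  by apply/eqP/negPn/negP => Fij; apply: h; exists (i, j).
by rewrite /form_height /mxheight (vheight_height R (i := (i, j))).
Qed.

(** The forms are pulled back to [V] along a basis [P] of small height. Each
    pulled back form costs a factor [N ^ 2 * h ^ 2], where [h] is the height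
    of [V]. *)
Lemma common_zero_subspace (R : realType) (k gam s N : nat) (F : nat -> 'M[algC]_N)
    (V : {vspace 'rV[algC]_N}) :
  (0 < k)%N -> (0 < s)%N -> common_zero_bound R k gam s -> ('C(k.+1, 2) < \dim V)%N ->
  (\dim V <= N)%N -> (forall m, (m < k)%N -> (F m)^T = F m) ->
  exists w : 'rV_N, [/\ w != 0, w \in V, forall m, (m < k)%N -> w *m F m *m w^T = 0
    & mxheight R w ^+ 2 <= N%:R ^+ (4 + gam + 2 * k.-1 * s) * subspace_height R V ^+ (4 + 2 * k.-1 * s)
        * (\prod_(m < k.-1) mxheight R (F m)) ^+ s * mxheight R (F k.-1)].
Proof.
move=> k0 s0 H hL LN sym; have [P [Pfree PV hP]] := subspace_basis R V.
have symP m : (m < k)%N -> (P *m F m *m P^T)^T = P *m F m *m P^T.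
  by move=> mk; rewrite !trmx_mul trmxK sym // mulmxA.
have [x [x0 xF hx]] := H _ N (fun m => P *m F m *m P^T) hL LN symP.
exists (x *m P); split.
- by rewrite mulmx_free_eq0.
- exact: PV.
- by move=> m mk; rewrite trmx_mul -[RHS](xF m mk) !mulmxA.
have L0 : (0 < \dim V)%N := leq_ltn_trans (leq0n _) hL.
have N0 : (0 < N)%N := leq_trans L0 LN.
have NR : 0 <= N%:R :> R := ler0n _ _.
have LR : (\dim V)%:R <= N%:R :> R by rewrite ler_nat.
move: (subspace_height R V) hP => h hP.
have h0 : 0 <= h := le_trans (mxheight_ge0 R P) hP.
have hPF m : mxheight R (P *m F m *m P^T) <= N%:R ^+ 2 * h ^+ 2 * mxheight R (F m).
  apply: le_trans (mxheight_congr R P (F m) N0) _; rewrite ler_wpM2r ?mxheight_ge0 // ler_wpM2l ?exprn_ge0 //.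
  by rewrite lerXn2r ?nnegrE ?mxheight_ge0.
have hprod : \prod_(m < k.-1) mxheight R (P *m F m *m P^T)
    <= (N%:R ^+ 2 * h ^+ 2) ^+ k.-1 * \prod_(m < k.-1) mxheight R (F m).
  apply: le_trans (_ : \prod_(m < k.-1) (N%:R ^+ 2 * h ^+ 2 * mxheight R (F m)) <= _).
    by apply: ler_prod => m _; rewrite mxheight_ge0 hPF.
  by rewrite big_split /= prodr_const card_ord.
have hw : mxheight R (x *m P) ^+ 2 <= (N%:R * (mxheight R x * h)) ^+ 2.
  apply: lerXn2r; rewrite ?nnegrE ?mxheight_ge0 ?mulr_ge0 ?mxheight_ge0 //.
  apply: le_trans (mxheight_mul R x P L0) _.
  apply: ler_pM; rewrite ?ler0n ?mulr_ge0 ?mxheight_ge0 //.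
  by rewrite ler_wpM2l ?mxheight_ge0.
have p0 := le_trans ler01 (prod_mxheight_ge1 R k.-1 (fun m => P *m F m *m P^T)).
have q0 := le_trans ler01 (prod_mxheight_ge1 R k.-1 F).
have f0 := mxheight_ge0 R (F k.-1); have f0' := mxheight_ge0 R (P *m F k.-1 *m P^T).
move: (hPF k.-1) hprod p0 q0 f0 f0' hx hw => {hPF}.
move: (mxheight R x) (mxheight R (x *m P)) (mxheight R (F k.-1)) (mxheight R _) (\prod_(_ < _) _) (\prod_(_ < _) _).
move=> X W f f' p q.
move: (N%:R) NR => n n0 hf hp p0 q0 f0 f0' hx hw.
move: (k.-1) hp => j hp; set c := n ^+ 2 * h ^+ 2 in hf hp.
have c0 : 0 <= c by rewrite mulr_ge0 ?exprn_ge0.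
apply: le_trans hw _.
have -> : (n * (X * h)) ^+ 2 = c * X ^+ 2 by rewrite /c !exprMn mulrCA mulrC mulrA mulrAC mulrA.
apply: le_trans (_ : c * (n ^+ gam * (c ^+ j * p) ^+ s * (c * f)) <= _).
  rewrite ler_wpM2l //; apply: le_trans hx _.
  apply: ler_pM; rewrite ?mulr_ge0 ?exprn_ge0 // ler_wpM2l ?exprn_ge0 //.
  by apply: lerXn2r; rewrite ?nnegrE ?mulr_ge0 ?exprn_ge0.
have -> : c * (n ^+ gam * (c ^+ j * p) ^+ s * (c * f)) = n ^+ gam * c ^+ (2 + j * s) * p ^+ s * f.
  by rewrite exprMn -exprM [c ^+ (2 + _)]exprD; ring.
rewrite /c exprMn -!exprM !mulnDr -!mulnA ?(mulnA 2) mulrA -exprD.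
have -> : (4 + gam + 2 * j * s = gam + (2 * 2 + 2 * j * s))%N by rewrite addnCA addnA.
exact: lexx.
Qed.

Lemma le_of_square_bound (R : realType) (n h p f X : R) (a b e a' b' e' : nat) :
  1 <= n -> 1 <= h -> 1 <= p -> 1 <= f -> 0 <= X -> X ^+ 2 <= n ^+ a' * h ^+ b' * p ^+ e' * f ->
  (a' <= a * 2)%N -> (b' <= b * 2)%N -> (e' <= e * 2)%N ->
  X <= n ^+ a * h ^+ b * p ^+ e * f.
Proof.
move=> n1 h1 p1 f1 X0 hX ha hb he.
have [n0 h0 p0 f0] : [/\ 0 <= n, 0 <= h, 0 <= p & 0 <= f].
  by rewrite !(le_trans ler01).
have M0 c d l : 0 <= n ^+ c * h ^+ d * p ^+ l by rewrite !mulr_ge0 ?exprn_ge0.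
have Y0 : 0 <= n ^+ a * h ^+ b * p ^+ e * f := mulr_ge0 (M0 a b e) f0.
rewrite -ler_sqr ?nnegrE //; apply: le_trans hX _.
rewrite !exprMn -!exprM; apply: ler_pM; rewrite ?M0 //; last by rewrite expr2 ler_peMl.
apply: ler_pM; rewrite ?mulr_ge0 ?exprn_ge0 ?ler_weXn2l //.
by apply: ler_pM; rewrite ?exprn_ge0 ?ler_weXn2l.
Qed.

Theorem theorem1p4 (R : realType) (k N L : nat)
  (F : nat -> 'M[algC]_N) (V : {vspace 'rV[algC]_N})
  (hk : (2 <= k)%N)
  (hFquad : forall m : nat, (1 <= m <= k)%N -> is_quadratic_form (F m))
  (hFnz : forall m : nat, (1 <= m <= k)%N -> F m != 0)
  (hV : \dim V = L)
  (hLN : (L <= N)%N)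
  (hkL : (k * (k + 1) %/ 2 + 1 <= L)%N) :
  exists w : 'rV[algC]_N,
    [/\ w != 0,
        w \in V,
        forall m : nat, (1 <= m <= k)%N -> quad_eval (F m) w = 0
      & affine_height R w <=
          (3 `^ (L%:R ^+ 2 / 2) * N%:R `^ (3 * (L%:R + 1) / 2)
             * subspace_height R V) `^ (20 * Bconst R k ^+ 2 / 81)
          * (\prod_(1 <= n < k) form_height R (F n)) `^ Bconst R k
          * form_height R (F k) ^+ 2].
Proof.
have k0 : (0 < k)%N := ltnW hk.
have [gam [s [s0 hgam hs H]]] := common_zero R hk.
have hL : ('C(k.+1, 2) < \dim V)%N.
  by move: hkL; rewrite hV bin2 -divn2 mulnC !addn1.
have LN : (\dim V <= N)%N by rewrite hV.
have sym m : (m < k)%N -> (F m.+1)^T = F m.+1.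
  by move=> mk; apply/matrixP => a b; rewrite mxE hFquad.
have [x [x0 xV xF hx]] := common_zero_subspace k0 s0 H hL LN sym.
have [i xi] : exists i, x 0 i != 0 := rV0Pn _ x0.
(* Scaling a coordinate to 1 makes the affine height a projective one. *)
have c0 : (x 0 i)^-1 != 0 by rewrite invr_eq0.
exists ((x 0 i)^-1 *: x); split.
- by rewrite scaler_eq0 negb_or c0.
- exact: rpredZ.
- case=> // m /andP [_ mk]; rewrite quad_evalE linearZ /= -scalemxAr -!scalemxAl xF //.
  by rewrite !scaler0 mxE.
have N0 : (0 < N)%N := leq_trans (leq_ltn_trans (leq0n _) hL) LN.
have hVge : 1 <= subspace_height R V.
  by have [P [_ _ hP]] := subspace_basis R V; apply: le_trans hP; apply: mxheight_ge1.
have Fk : form_height R (F k) = mxheight R (F k.-1.+1).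
  by rewrite prednK // form_heightE // hFnz // k0 leqnn.
have FP : \prod_(1 <= n < k) form_height R (F n) = \prod_(m < k.-1) mxheight R (F m.+1).
  rewrite -[k in LHS](prednK k0) big_add1 /= big_mkord; apply: eq_bigr => m _.
  by rewrite form_heightE // hFnz // ltnS /=; apply: leq_trans (ltn_ord m) (leq_pred k).
have wi : ((x 0 i)^-1 *: x) 0 i = 1 by rewrite mxE mulVf.
apply: le_trans (affine_height_le R wi) _.
rewrite (mxheight_scale R x c0).
rewrite Fk FP; have p1 := prod_mxheight_ge1 R k.-1 (fun m => F m.+1).
have f1 := mxheight_ge1 R (F k.-1.+1).
apply: le_trans (bound_of_integral_exponents hk hkL N0 hVge p1 f1).
move: hx hVge p1 f1 (mxheight_ge0 R x).
move: (mxheight R x) (mxheight R (F _)) (subspace_height R V) (\prod_(m < _) _) => X f h p.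
move=> hX h1 p1 f1 X0; set B := Bnat k in hgam hs *.
apply: (le_of_square_bound _ h1 p1 f1 X0 hX); rewrite ?ler1n //.
- have : (k.-1 * s <= k.-1 * (2 * B))%N by rewrite leq_mul2l hs orbT.
  have [B9 _] := Bnat_ge hk; rewrite -/B in B9.
  by move: (prednK k0) hgam B9; move: (k.-1) => j <-; nia.
- have : (k.-1 * s <= k.-1 * (2 * B))%N by rewrite leq_mul2l hs orbT.
  by move: (k.-1) => j; nia.
- by rewrite mulnC.
Qed.
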